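(* Every $f\in C^{\infty}(\mathbb T)$ can be uniquely decomposed as $f=g+h$ (on $\mathbb T$) with $g\in A^{\infty}(D)$ and $h\in A_0^{\infty}(\hat{\mathbb C}\setminus \overline D)$. Moreover, $$C^{\infty}(\mathbb T)=A^{\infty}(D)\oplus A_0^{\infty}(\hat{\mathbb C}\setminus \overline D).$$
   Context: $D$ is the open unit disc in $\mathbb C$, $\mathbb T=\partial D$ the unit circle, $\hat{\mathbb C}=\mathbb C\cup\{\infty\}$. $C^{\infty}(\mathbb T)$ is the space of complex-valued functions $f$ on $\mathbb T$ such that $\theta\mapsto f(e^{i\theta})$ is infinitely differentiable, topologized by the semi-norms $\|d^lf/d\theta^l\|_\infty$, $l\ge 0$. $A^{\infty}(D)$ is the space of holomorphic functions on $D$ all of whose derivatives $f^{(l)}$, $l\ge 0$, extend continuously to $\overline D$, topologized by the semi-norms $\sup_{\overline D}|f^{(l)}|$, $l\ge0$. $A_0^{\infty}(\hat{\mathbb C}\setminus\overline D)$ is the space of functions $f$ holomorphic on $\mathbb C\setminus\overline D$ all of whose derivatives $f^{(l)}$, $l\ge0$, extend continuously to $\mathbb C\setminus D$, with $\lim_{z\to\infty}f(z)=0$, topologized by the semi-norms $\sup_{\mathbb C\setminus D}|f^{(l)}|$, $l\ge 0$. Both spaces are regarded as subspaces of $C^\infty(\mathbb T)$ via restriction of the continuous extension to $\mathbb T$. For subspaces $A,C$ of a topological vector space $B$, $B=A\oplus C$ means $B=A+C$, $A\cap C=0$, and the associated projections $B\to A$ and $B\to C$ are continuous. *)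

(* Defs.v *)
From Stdlib Require Import Reals Lra List.
From Coquelicot Require Import Coquelicot.

Definition unit_disc (z : C) : Prop := Cmod z < 1.
Definition closed_disc (z : C) : Prop := Cmod z <= 1.
Definition unit_circle (z : C) : Prop := Cmod z = 1.
Definition exterior (z : C) : Prop := 1 < Cmod z.
Definition closed_exterior (z : C) : Prop := 1 <= Cmod z.

Definition agree_on (S : C -> Prop) (f g : C -> C) : Prop :=
  forall z, S z -> f z = g z.

(* The filter of punctured neighbourhoods of the point at infinity. *)
Definition C_infinity (P : C -> Prop) : Prop :=
  exists M : R, forall z : C, M < Cmod z -> P z.

Definition holomorphic_on (U : C -> Prop) (f : C -> C) : Prop :=
  forall z : C, U z -> @ex_derive C_AbsRing C_NormedModule f z.

Definition C_derive_n (l : nat) (f : C -> C) : C -> C :=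
  Nat.iter l C_derive f.

Definition extends_continuously (U K : C -> Prop) (f : C -> C) : Prop :=
  exists e : C -> C,
    @continuous_on C_UniformSpace C_UniformSpace K e /\ agree_on U e f.

(* The value at [z], in the closure of [U], of the continuous extension of
   the restriction of [f] to [U]. *)
Definition ext (U : C -> Prop) (f : C -> C) (z : C) : C :=
  @iota C_CompleteNormedModule
    (fun y : C => filterlim f (within U (@locally C_UniformSpace z))
                              (@locally C_UniformSpace y)).

Definition sup_on (S : C -> Prop) (f : C -> C) : Rbar :=
  Lub_Rbar (fun r : R => exists z : C, S z /\ r = Cmod (f z)).

Definition cis (t : R) : C := (cos t, sin t).

(* [d^l/dt^l F(t)] for a complex-valued function [F] of a real variable. *)
Definition RC_derive_n (F : R -> C) (l : nat) (t : R) : C :=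
  (Derive_n (fun s => Re (F s)) l t, Derive_n (fun s => Im (F s)) l t).

(* A space of complex functions on the set [dom], topologized by the countable
   family of semi-norms [snorm].  Its elements are represented by total
   functions [C -> C] whose values off [dom] are irrelevant: two of them are
   the same element when they agree on [dom]. *)
Record fspace : Type := Fspace {
  dom : C -> Prop;
  mem : (C -> C) -> Prop;
  snorm : nat -> (C -> C) -> Rbar
}.

Definition smooth_circle : fspace := {|
  dom := unit_circle;
  mem := fun f => forall (l : nat) (t : R),
    @ex_derive R_AbsRing C_R_NormedModule
      (RC_derive_n (fun s => f (cis s)) l) t;
  snorm := fun l f =>
    Lub_Rbar (fun r : R => exists t : R,
      r = Cmod (RC_derive_n (fun s => f (cis s)) l t))
|}.

Definition A_infty : fspace := {|
  dom := unit_disc;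
  mem := fun f =>
    holomorphic_on unit_disc f /\
    forall l : nat, extends_continuously unit_disc closed_disc (C_derive_n l f);
  snorm := fun l f => sup_on closed_disc (ext unit_disc (C_derive_n l f))
|}.

Definition A0_infty : fspace := {|
  dom := exterior;
  mem := fun f =>
    holomorphic_on exterior f /\
    (forall l : nat,
       extends_continuously exterior closed_exterior (C_derive_n l f)) /\
    filterlim f C_infinity (@locally C_UniformSpace (RtoC 0));
  snorm := fun l f => sup_on closed_exterior (ext exterior (C_derive_n l f))
|}.

(* Neighbourhood filter of [f] in the topology generated by the semi-norms. *)
Definition nbhs (X : fspace) (f : C -> C) (U : (C -> C) -> Prop) : Prop :=
  exists (L : list nat) (eps : posreal), forall g : C -> C, mem X g ->
    (forall l, In l L -> Rbar_lt (snorm X l (fun z => (g z - f z)%C)) eps) ->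
    U g.

Definition continuous_map (X Y : fspace) (P : (C -> C) -> (C -> C)) : Prop :=
  forall f, mem X f ->
    mem Y (P f) /\ filterlim P (nbhs X f) (nbhs Y (P f)).

(* [A] is regarded as a subspace of [B] via [i]: a continuous linear
   injection. *)
Record subspace_via (B A : fspace) (i : (C -> C) -> (C -> C)) : Prop := {
  sub_zero : mem A (fun _ => RtoC 0);
  sub_lin : forall (k : C) a a', mem A a -> mem A a' ->
    mem A (fun z => (k * a z + a' z)%C);
  sub_map_lin : forall (k : C) a a', mem A a -> mem A a' ->
    agree_on (dom B) (i (fun z => (k * a z + a' z)%C))
                     (fun z => (k * i a z + i a' z)%C);
  sub_inj : forall a a', mem A a -> mem A a' ->
    agree_on (dom B) (i a) (i a') -> agree_on (dom A) a a';
  sub_cont : continuous_map A B i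
}.

Definition decomposes (B : fspace) (iA iC : (C -> C) -> (C -> C))
    (b a c : C -> C) : Prop :=
  agree_on (dom B) b (fun z => (iA a z + iC c z)%C).

(* [B = A (+) C'].  The projections are continuous for the topologies that [A]
   and [C'] carry themselves.  Since [iA] is continuous and the projection to
   [A] is a left inverse of it, the topology of [A] is then the one induced by
   [B], so that it makes no difference which of the two is meant; likewise for
   [C']. *)
Record topological_direct_sum (B A C' : fspace)
    (iA iC : (C -> C) -> (C -> C)) : Prop := {
  tds_left : subspace_via B A iA;
  tds_right : subspace_via B C' iC;
  tds_sum : forall b, mem B b <->
    exists a c, mem A a /\ mem C' c /\ decomposes B iA iC b a c;
  tds_cap : forall a c, mem A a -> mem C' c ->
    agree_on (dom B) (iA a) (iC c) ->
    agree_on (dom B) (iA a) (fun _ => RtoC 0);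
  tds_proj : exists PA PC : (C -> C) -> (C -> C),
    (forall b, mem B b -> decomposes B iA iC b (PA b) (PC b)) /\
    continuous_map B A PA /\ continuous_map B C' PC
}.

Lemma ext_eq (U K : C -> Prop) (f e : C -> C) (z : C) :
  (forall w, U w -> K w) ->
  @continuous_on C_UniformSpace C_UniformSpace K e -> agree_on U e f ->
  K z -> ProperFilter (within U (@locally C_UniformSpace z)) ->
  ext U f z = e z.
Proof.
intros UK ce ef Kz pU.
apply (@iota_filterlim_locally C_AbsRing C_CompleteNormedModule C
         (within U (@locally C_UniformSpace z)) _ f (e z)).
intros P HP; specialize (ce z Kz P HP).
unfold filtermap, within in *.
refine (filter_imp _ _ _ ce).
intros w Hw Uw; rewrite <- (ef w Uw); apply Hw, UK, Uw.
Qed.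

Lemma within_locally_proper (U : C -> Prop) (z : C) :
  (forall eps : posreal, exists w : C, U w /\ Cmod (w - z)%C < eps) ->
  ProperFilter (within U (@locally C_UniformSpace z)).
Proof.
intros H; constructor; [ | apply within_filter, locally_filter].
intros P [eps HP]; destruct (H eps) as [w [Uw dw]].
exists w; apply HP; trivial.
now apply C_NormedModule_mixin_compat1.
Qed.

Lemma disc_proper (z : C) : closed_disc z ->
  ProperFilter (within unit_disc (@locally C_UniformSpace z)).
Proof.
unfold closed_disc, unit_disc; intros Hz; apply within_locally_proper; intros eps.
pose proof (cond_pos eps) as He.
pose (d := Rmin (eps / 2) (1 / 2)).
assert (Hd : 0 < d <= 1 / 2 /\ d < eps).
{ unfold d, Rmin; destruct Rle_dec; lra. }
pose proof (Cmod_ge_0 z).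
exists (RtoC (1 - d) * z)%C; split.
- rewrite Cmod_mult, Cmod_R, Rabs_pos_eq; nra.
- replace (RtoC (1 - d) * z - z)%C with (RtoC (- d) * z)%C
    by (rewrite RtoC_minus, RtoC_opp; ring).
  rewrite Cmod_mult, Cmod_R, Rabs_Ropp, Rabs_pos_eq; nra.
Qed.

Lemma exterior_proper (z : C) : closed_exterior z ->
  ProperFilter (within exterior (@locally C_UniformSpace z)).
Proof.
unfold closed_exterior, exterior; intros Hz.
apply within_locally_proper; intros eps.
pose proof (cond_pos eps) as He.
pose (d := eps / (2 * Cmod z)).
assert (Hd : 0 < d) by (apply Rdiv_lt_0_compat; lra).
assert (Hdz : d * Cmod z = eps / 2) by (unfold d; field; lra).
exists (RtoC (1 + d) * z)%C; split.
- rewrite Cmod_mult, Cmod_R, Rabs_pos_eq; nra.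
- replace (RtoC (1 + d) * z - z)%C with (RtoC d * z)%C
    by (rewrite RtoC_plus; ring).
  rewrite Cmod_mult, Cmod_R, Rabs_pos_eq; lra.
Qed.

(* Main.v *)
Require Import Defs.
From Stdlib Require Import Reals ZArith Lra Lia List ClassicalEpsilon.
From Coquelicot Require Import Coquelicot.
Local Open Scope R_scope.

(** Both spaces are spaces of power series with rapidly decreasing coefficients:
    [g] belongs to [A_infty] iff [g z = sum a_n z^n] and [h] belongs to
    [A0_infty] iff [h z = sum b_n z^-n] with [b_0 = 0], where [(a_n)] and [(b_n)]
    are rapidly decreasing, and the semi-norms are equivalent to the weighted
    sup-norms of the coefficients.  The expansion of a holomorphic function [p] on
    a punctured disc, bounded near the centre, is obtained from Fourier series:
    its Fourier coefficients on the circle of radius [r] are multiples of [r^n] by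
    differentiation under the integral sign, so that those with [n < 0] vanish.  The
    exterior reduces to the disc through [z -> 1/z].  The splitting of a smooth
    function on the circle is then that of its Fourier series into the terms with
    [n >= 0] and those with [n < 0], and its continuity is the decay
    [|n|^k |c_n| <= sup |f^(k)|]. *)


(** * Complex-valued functions of a real or complex variable *)

(** The boundary values [ext] are defined by limits. With rapidly decreasing coefficients a series
    converges absolutely on the closed disc and is Lipschitz there, so it is its own continuous
    extension, and likewise for every derivative. Decay is counted by the weights [(INR n + 1) ^ k]:
    a differentiation costs one order and absolute summation costs two, so the semi-norm of index
    [l] of a projection is controlled by those of index [0] and [l + 2]. Conversely, Cauchy
    estimates on circles of radius tending to 1 turn the boundedness of each derivative near the
    unit circle into bounds on its coefficients, hence into rapid decrease. Differentiation under
    the integral sign asks for a continuous derivative; its continuity is read off from the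
    extension condition for the first derivative. In polar coordinates the complex derivative ties
    the radial derivative to the angular one, so the Fourier coefficients on the circle of radius
    [r] satisfy [r c_n' = n c_n]; for [n < 0] a nonzero solution is unbounded at the centre. *)

Notation is_C_derive := (@is_derive C_AbsRing C_NormedModule).
Notation is_RC_derive := (@is_derive R_AbsRing C_R_NormedModule).
Notation RC_continuous := (@continuous R_UniformSpace C_UniformSpace).

Definition CInt (F : R -> C) (a b : R) : C := @RInt C_R_CompleteNormedModule F a b.

Lemma C_ext (z w : C) : Re z = Re w -> Im z = Im w -> z = w.
Proof. destruct z, w; unfold Re, Im; simpl; congruence. Qed.

Lemma Cmod_minus_sym (z w : C) : Cmod (z - w) = Cmod (w - z).
Proof. rewrite <- Cmod_opp; f_equal; ring. Qed.

Lemma Cmod_triangle_minus (z w : C) : Cmod z <= Cmod (z - w) + Cmod w.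
Proof.
replace z with (z - w + w)%C at 1 by ring; apply Cmod_triangle.
Qed.

(** The uniform structure of [C] is that of a product, whose balls are squares; [sqrt 2] compares
    them with the discs of [Cmod]. *)
Lemma C_locally_iff (z : C) (P : C -> Prop) :
  @locally C_UniformSpace z P <->
  exists d : posreal, forall w, Cmod (w - z) < d -> P w.
Proof.
split.
- intros [d Hd]; exists d; intros w Hw; apply Hd.
  now apply C_NormedModule_mixin_compat1.
- intros [d Hd].
  assert (Hs : 0 < d / sqrt 2).
  { apply Rdiv_lt_0_compat; [apply cond_pos | apply Rlt_sqrt2_0]. }
  exists (mkposreal _ Hs); intros w Hw; apply Hd.
  pose proof (C_NormedModule_mixin_compat2 z w _ Hw) as H; simpl in H.
  replace (pos d) with (sqrt 2 * (d / sqrt 2)); [exact H|].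
  field; apply Rgt_not_eq, Rlt_sqrt2_0.
Qed.

Lemma is_C_derive_iff (f : C -> C) (z l : C) :
  is_C_derive f z l <->
  forall eps : posreal, exists d : posreal, forall w, Cmod (w - z) < d ->
    Cmod (f w - f z - l * (w - z)) <= eps * Cmod (w - z).
Proof.
split.
- intros [_ H] eps.
  specialize (H z (fun P HP => HP) eps).
  destruct H as [d Hd]; exists d; intros w Hw.
  specialize (Hd w Hw).
  rewrite (Cmult_comm l); exact Hd.
- intros H; split; [apply is_linear_scal_l|].
  intros x Hx.
  rewrite <- (is_filter_lim_locally_unique _ _ Hx).
  intros eps; destruct (H eps) as [d Hd]; exists d; intros w Hw.
  specialize (Hd w Hw); rewrite (Cmult_comm l) in Hd; exact Hd.
Qed.

Lemma norm_C_R (z : C) : @norm R_AbsRing C_R_NormedModule z = Cmod z.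
Proof.
symmetry; apply Cmod_norm.
Qed.

Lemma is_RC_derive_iff (F : R -> C) (t : R) (l : C) :
  is_RC_derive F t l <->
  forall eps : posreal, exists d : posreal, forall s, Rabs (s - t) < d ->
    Cmod (F s - F t - l * RtoC (s - t)) <= eps * Rabs (s - t).
Proof.
split.
- intros [_ H] eps.
  specialize (H t (fun P HP => HP) eps).
  destruct H as [d Hd]; exists d; intros w Hw.
  specialize (Hd w Hw).
  rewrite (Cmult_comm l), <- scal_R_Cmult, <- norm_C_R; exact Hd.
- intros H; split; [apply is_linear_scal_l|].
  intros x Hx.
  rewrite <- (is_filter_lim_locally_unique _ _ Hx).
  intros eps; destruct (H eps) as [d Hd]; exists d; intros w Hw.
  specialize (Hd w Hw).
  rewrite (Cmult_comm l), <- scal_R_Cmult, <- norm_C_R in Hd; exact Hd.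
Qed.

Lemma RC_continuous_iff (F : R -> C) (t : R) :
  RC_continuous F t <->
  forall eps : posreal, exists d : posreal, forall s, Rabs (s - t) < d ->
    Cmod (F s - F t) < eps.
Proof.
split.
- intros H eps.
  destruct (H (fun w => Cmod (w - F t) < eps)) as [d Hd].
  + apply C_locally_iff; exists eps; auto.
  + exists d; exact Hd.
- intros H P HP; apply C_locally_iff in HP; destruct HP as [e He].
  destruct (H e) as [d Hd]; exists d; intros s Hs; apply He, Hd, Hs.
Qed.

Lemma is_RC_derive_comp_iff (F : R -> C) (t : R) (l : C) :
  is_RC_derive F t l <->
  is_derive (fun s => Re (F s)) t (Re l) /\ is_derive (fun s => Im (F s)) t (Im l).
Proof.
split.
- intros H; split.
  + apply (filterdiff_comp F (fun z : C => fst z) (fun y => scal y l) (fun z => fst z)).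
    * exact H.
    * apply filterdiff_linear, is_linear_fst.
  + apply (filterdiff_comp F (fun z : C => snd z) (fun y => scal y l) (fun z => snd z)).
    * exact H.
    * apply filterdiff_linear, is_linear_snd.
- intros [H1 H2].
  apply is_RC_derive_iff; intros eps.
  assert (He : 0 < eps / 2) by (pose proof (cond_pos eps); lra).
  destruct H1 as [_ H1]; destruct H2 as [_ H2].
  destruct (H1 t (fun P HP => HP) (mkposreal _ He)) as [d1 Hd1].
  destruct (H2 t (fun P HP => HP) (mkposreal _ He)) as [d2 Hd2].
  exists (mkposreal _ (Rmin_stable_in_posreal d1 d2)); simpl; intros s Hs.
  specialize (Hd1 s (Rlt_le_trans _ _ _ Hs (Rmin_l _ _))).
  specialize (Hd2 s (Rlt_le_trans _ _ _ Hs (Rmin_r _ _))).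
  change (Rabs (Re (F s) - Re (F t) - (s - t) * Re l) <= eps / 2 * Rabs (s - t)) in Hd1.
  change (Rabs (Im (F s) - Im (F t) - (s - t) * Im l) <= eps / 2 * Rabs (s - t)) in Hd2.
  set (x := Re (F s) - Re (F t) - (s - t) * Re l) in *.
  set (y := Im (F s) - Im (F t) - (s - t) * Im l) in *.
  replace (F s - F t - l * RtoC (s - t))%C with (RtoC x + Ci * RtoC y)%C.
  + eapply Rle_trans; [apply Cmod_triangle|].
    rewrite Cmod_mult, Cmod_Ci, !Cmod_R; lra.
  + apply C_ext; unfold x, y, Re, Im; destruct l; simpl; ring.
Qed.

Lemma C_continuous_comp_iff {U : UniformSpace} (F : U -> C) (t : U) :
  @continuous U C_UniformSpace F t <->
  continuous (fun s => Re (F s)) t /\ continuous (fun s => Im (F s)) t.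
Proof.
split.
- intros H; split.
  + apply (continuous_comp F (fun z : C => fst z)); [exact H|].
    intros P [d Hd]; exists d; intros y [Hy _]; apply Hd, Hy.
  + apply (continuous_comp F (fun z : C => snd z)); [exact H|].
    intros P [d Hd]; exists d; intros y [_ Hy]; apply Hd, Hy.
- intros [H1 H2] P [d Hd].
  destruct (H1 _ (locally_ball (Re (F t)) d)) as [d1 A].
  destruct (H2 _ (locally_ball (Im (F t)) d)) as [d2 B].
  exists (mkposreal _ (Rmin_stable_in_posreal d1 d2)); intros s Hs; apply Hd; split.
  + apply A; eapply ball_le; [apply Rmin_l | exact Hs].
  + apply B; eapply ball_le; [apply Rmin_r | exact Hs].
Qed.

Lemma is_RC_derive_continuous (F : R -> C) (t : R) (l : C) :
  is_RC_derive F t l -> RC_continuous F t.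
Proof.
intros H; apply is_RC_derive_comp_iff in H; destruct H as [H1 H2].
apply C_continuous_comp_iff; split;
  eapply (ex_derive_continuous (V := R_NormedModule)); eexists; eassumption.
Qed.

Lemma C_continuous_const {U : UniformSpace} (c : C) (t : U) :
  @continuous U C_UniformSpace (fun _ => c) t.
Proof. apply continuous_const. Qed.

Lemma C_continuous_plus {U : UniformSpace} (F G : U -> C) (t : U) :
  @continuous U C_UniformSpace F t -> @continuous U C_UniformSpace G t ->
  @continuous U C_UniformSpace (fun s => F s + G s)%C t.
Proof. apply (continuous_plus (V := C_R_NormedModule)). Qed.

Lemma C_continuous_mult {U : UniformSpace} (F G : U -> C) (t : U) :
  @continuous U C_UniformSpace F t -> @continuous U C_UniformSpace G t ->
  @continuous U C_UniformSpace (fun s => F s * G s)%C t.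
Proof.
rewrite !C_continuous_comp_iff; intros [F1 F2] [G1 G2]; split; simpl.
- apply (continuous_minus (V := R_NormedModule)); apply (continuous_mult (K := R_AbsRing)); assumption.
- apply (continuous_plus (V := R_NormedModule)); apply (continuous_mult (K := R_AbsRing)); assumption.
Qed.

Lemma is_RC_derive_plus (F G : R -> C) (t : R) (l m : C) :
  is_RC_derive F t l -> is_RC_derive G t m ->
  is_RC_derive (fun s => F s + G s)%C t (l + m)%C.
Proof. intros; apply (is_derive_plus (V := C_R_NormedModule)); assumption. Qed.

Lemma is_RC_derive_mult (F G : R -> C) (t : R) (l m : C) :
  is_RC_derive F t l -> is_RC_derive G t m ->
  is_RC_derive (fun s => F s * G s)%C t (l * G t + F t * m)%C.
Proof.
rewrite !is_RC_derive_comp_iff; intros [F1 F2] [G1 G2]; split.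
- evar_last.
  { apply (is_derive_minus (V := R_NormedModule) (fun s => Re (F s) * Re (G s)) (fun s => Im (F s) * Im (G s)));
    apply (is_derive_mult (K := R_AbsRing)); try eassumption; intros; apply Rmult_comm. }
  unfold minus, plus, opp, mult; simpl; unfold Re, Im; ring.
- evar_last.
  { apply (is_derive_plus (V := R_NormedModule) (fun s => Re (F s) * Im (G s)) (fun s => Im (F s) * Re (G s)));
    apply (is_derive_mult (K := R_AbsRing)); try eassumption; intros; apply Rmult_comm. }
  unfold minus, plus, opp, mult; simpl; unfold Re, Im; ring.
Qed.

Lemma is_RC_derive_const (c : C) (t : R) : is_RC_derive (fun _ => c) t (RtoC 0).
Proof. apply (is_derive_const (V := C_R_NormedModule)). Qed.

Lemma is_RC_derive_scal (c : C) (F : R -> C) (t : R) (l : C) :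
  is_RC_derive F t l -> is_RC_derive (fun s => c * F s)%C t (c * l)%C.
Proof.
intros H; evar_last.
{ apply (is_RC_derive_mult (fun _ => c) F); [apply is_RC_derive_const | exact H]. }
simpl; ring.
Qed.

Lemma is_RC_derive_eq (F : R -> C) (t : R) (l m : C) :
  is_RC_derive F t l -> l = m -> is_RC_derive F t m.
Proof. now intros H <-. Qed.

(** A chain rule for [f] differentiable only relative to a set [S] that contains the curve. It
    serves on the unit circle, where a power series is controlled from the closed disc alone and not
    from a full neighbourhood. *)
Lemma is_RC_derive_chain_within (S : C -> Prop) (f : C -> C) (G : R -> C) (t : R) (l m : C) :
  (forall eps : posreal, exists d : posreal, forall w, S w -> Cmod (w - G t) < d ->
     Cmod (f w - f (G t) - l * (w - G t)) <= eps * Cmod (w - G t)) ->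
  (forall s, S (G s)) -> is_RC_derive G t m ->
  is_RC_derive (fun s => f (G s)) t (l * m)%C.
Proof.
intros Hf SG HG.
assert (cG := is_RC_derive_continuous _ _ _ HG).
rewrite is_RC_derive_iff in HG.
rewrite RC_continuous_iff in cG.
apply is_RC_derive_iff; intros eps.
pose proof (cond_pos eps) as He.
pose proof (Cmod_ge_0 l); pose proof (Cmod_ge_0 m).
(* The remainder of [f] is measured against [G s - G t], of modulus at most
   [(Cmod m + 1) * Rabs (s - t)]; the remainder of [G] gets multiplied by [l]. Each receives half of
   [eps], and the [1] inside [Rmin] yields the bound on [G s - G t]. *)
assert (H1 : 0 < eps / (2 * (Cmod m + 1))) by (apply Rdiv_lt_0_compat; lra).
assert (H2 : 0 < Rmin 1 (eps / (2 * (Cmod l + 1)))).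
{ apply Rmin_pos; [lra | apply Rdiv_lt_0_compat; lra]. }
destruct (Hf (mkposreal _ H1)) as [d1 Hd1].
destruct (HG (mkposreal _ H2)) as [d2 Hd2].
destruct (cG d1) as [d3 Hd3].
exists (mkposreal _ (Rmin_stable_in_posreal d2 d3)); simpl; intros s Hs.
specialize (Hd2 s (Rlt_le_trans _ _ _ Hs (Rmin_l _ _))).
specialize (Hd3 s (Rlt_le_trans _ _ _ Hs (Rmin_r _ _))).
specialize (Hd1 _ (SG s) Hd3); simpl in Hd1, Hd2.
set (D := (G s - G t)%C) in *; set (E := (D - m * RtoC (s - t))%C) in *.
set (A := (f (G s) - f (G t) - l * D)%C) in *.
replace (f (G s) - f (G t) - l * m * RtoC (s - t))%C with (A + l * E)%C
  by (unfold A, E; ring).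
assert (HD : Cmod D <= (Cmod m + 1) * Rabs (s - t)).
{ replace D with (m * RtoC (s - t) + E)%C by (unfold E; ring).
  eapply Rle_trans; [apply Cmod_triangle|].
  rewrite Cmod_mult, Cmod_R.
  pose proof (Rmin_l 1 (eps / (2 * (Cmod l + 1)))).
  pose proof (Rabs_pos (s - t)); nra. }
eapply Rle_trans; [apply Cmod_triangle|]; rewrite Cmod_mult.
assert (HA : Cmod A <= eps / 2 * Rabs (s - t)).
{ eapply Rle_trans; [exact Hd1|].
  replace (eps / 2 * Rabs (s - t)) with
    (eps / (2 * (Cmod m + 1)) * ((Cmod m + 1) * Rabs (s - t))) by (field; lra).
  apply Rmult_le_compat_l; [lra | exact HD]. }
assert (HE : Cmod l * Cmod E <= eps / 2 * Rabs (s - t)).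
{ apply Rle_trans with ((Cmod l + 1) * (eps / (2 * (Cmod l + 1)) * Rabs (s - t))).
  - apply Rmult_le_compat; try apply Cmod_ge_0; try lra.
    eapply Rle_trans; [exact Hd2|]; apply Rmult_le_compat_r; [apply Rabs_pos | apply Rmin_r].
  - right; field; lra. }
lra.
Qed.

Lemma is_RC_derive_chain (f : C -> C) (G : R -> C) (t : R) (l m : C) :
  is_C_derive f (G t) l -> is_RC_derive G t m ->
  is_RC_derive (fun s => f (G s)) t (l * m)%C.
Proof.
rewrite is_C_derive_iff; intros Hf HG.
apply (is_RC_derive_chain_within (fun _ => True)); auto.
intros eps; destruct (Hf eps) as [d Hd]; exists d; auto.
Qed.

(** * The unit circle and polar coordinates *)

Lemma cis_derive (a t : R) :
  is_RC_derive (fun s => cis (a * s)) t (Ci * RtoC a * cis (a * t))%C.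
Proof.
apply is_RC_derive_comp_iff; split; simpl; auto_derive; auto; ring.
Qed.

Lemma cis_plus (s t : R) : cis (s + t) = (cis s * cis t)%C.
Proof. apply C_ext; simpl; [apply cos_plus | rewrite sin_plus; ring]. Qed.

Lemma cis_0 : cis 0 = RtoC 1.
Proof. apply C_ext; simpl; [apply cos_0 | apply sin_0]. Qed.

Lemma Cmod_cis (t : R) : Cmod (cis t) = 1.
Proof.
unfold Cmod, cis; simpl.
replace (cos t * (cos t * 1) + sin t * (sin t * 1)) with 1; [apply sqrt_1|].
pose proof (sin2_cos2 t) as H; unfold Rsqr in H; lra.
Qed.

Lemma cis_neq_0 (t : R) : cis t <> RtoC 0.
Proof. intros H; pose proof (Cmod_cis t) as E; rewrite H, Cmod_0 in E; lra. Qed.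

Lemma cis_neg (t : R) : cis (- t) = (/ cis t)%C.
Proof.
assert (H : (cis (- t) * cis t = 1)%C).
{ rewrite <- cis_plus, Rplus_opp_l; apply cis_0. }
rewrite <- (Cmult_1_r (cis (- t))), <- (Cinv_r (cis t)) by apply cis_neq_0.
rewrite Cmult_assoc, H; ring.
Qed.

Lemma cis_polar (z : C) : exists t, z = (RtoC (Cmod z) * cis t)%C.
Proof.
destruct (Ceq_dec z 0) as [->|Hz].
{ exists 0; rewrite Cmod_0; ring. }
apply Cmod_gt_0 in Hz.
set (r := Cmod z) in *.
set (x := fst z / r); set (y := snd z / r).
assert (Hxy : x² + y² = 1).
{ unfold x, y, Rsqr.
  assert (r * r = fst z * fst z + snd z * snd z).
  { unfold r, Cmod; rewrite sqrt_sqrt; simpl; try ring.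
    pose proof (Rle_0_sqr (fst z)); pose proof (Rle_0_sqr (snd z)); unfold Rsqr in *; lra. }
  field_simplify; [|lra]. apply (Rmult_eq_reg_r (r^2)); [|nra].
  unfold Rdiv; rewrite Rmult_assoc, Rinv_l; nra. }
assert (Hx : -1 <= x <= 1).
{ unfold Rsqr in Hxy; split; nra. }
assert (S : sqrt (1 - x²) = Rabs y).
{ rewrite <- sqrt_Rsqr_abs; f_equal; lra. }
destruct (Rle_dec 0 y) as [Hy|Hy].
- exists (acos x); apply C_ext; simpl.
  + rewrite cos_acos by assumption; unfold x, Re; field; lra.
  + rewrite sin_acos, S, Rabs_pos_eq by assumption; unfold y, Im; field; lra.
- exists (- acos x); apply C_ext; simpl.
  + rewrite cos_neg, cos_acos by assumption; unfold x, Re; field; lra.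
  + rewrite sin_neg, sin_acos, S, Rabs_left by lra; unfold y, Im; field; lra.
Qed.

(** * Integrals of complex-valued functions of a real variable *)

Lemma CInt_correct (F : R -> C) (a b : R) :
  (forall t, RC_continuous F t) ->
  @is_RInt C_R_NormedModule F a b (CInt F a b).
Proof.
intros H; apply (RInt_correct (V := C_R_CompleteNormedModule)).
apply (ex_RInt_continuous (V := C_R_CompleteNormedModule)); intros; apply H.
Qed.

Lemma CInt_unique (F : R -> C) (a b : R) (l : C) :
  @is_RInt C_R_NormedModule F a b l -> CInt F a b = l.
Proof. apply (is_RInt_unique (V := C_R_CompleteNormedModule)). Qed.

Lemma CInt_ext (F G : R -> C) (a b : R) :
  (forall t, F t = G t) -> CInt F a b = CInt G a b.
Proof. intros H; apply (RInt_ext (V := C_R_CompleteNormedModule)); intros; apply H. Qed.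

Lemma CInt_plus (F G : R -> C) (a b : R) :
  (forall t, RC_continuous F t) -> (forall t, RC_continuous G t) ->
  CInt (fun t => F t + G t)%C a b = (CInt F a b + CInt G a b)%C.
Proof.
intros HF HG; apply CInt_unique.
apply (is_RInt_plus (V := C_R_NormedModule)); apply CInt_correct; assumption.
Qed.

Lemma CInt_comp (F : R -> C) (a b : R) :
  (forall t, RC_continuous F t) ->
  CInt F a b = (RInt (fun t => Re (F t)) a b, RInt (fun t => Im (F t)) a b).
Proof.
intros H; apply CInt_unique.
assert (H1 : forall t, continuous (fun s => Re (F s)) t)
  by (intros t; now apply C_continuous_comp_iff).
assert (H2 : forall t, continuous (fun s => Im (F s)) t)
  by (intros t; now apply C_continuous_comp_iff).
apply (is_RInt_fct_extend_pair (U := R_NormedModule) (V := R_NormedModule));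
  apply (RInt_correct (V := R_CompleteNormedModule));
  apply (ex_RInt_continuous (V := R_CompleteNormedModule)); intros; auto.
Qed.

(** The integral is taken in a real normed module, so a complex scalar is moved out by way of the
    two components. *)
Lemma CInt_scal (c : C) (F : R -> C) (a b : R) :
  (forall t, RC_continuous F t) ->
  CInt (fun t => c * F t)%C a b = (c * CInt F a b)%C.
Proof.
intros H; apply CInt_unique.
assert (I := CInt_correct F a b H); set (v := CInt F a b) in *.
assert (I1 := is_RInt_fct_extend_fst (U := R_NormedModule) (V := R_NormedModule) _ _ _ _ I).
assert (I2 := is_RInt_fct_extend_snd (U := R_NormedModule) (V := R_NormedModule) _ _ _ _ I).
apply (is_RInt_fct_extend_pair (U := R_NormedModule) (V := R_NormedModule)); simpl.
- apply (is_RInt_minus (V := R_NormedModule)); apply (is_RInt_scal (V := R_NormedModule)); assumption.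
- apply (is_RInt_plus (V := R_NormedModule)); apply (is_RInt_scal (V := R_NormedModule)); assumption.
Qed.

Lemma CInt_minus (F G : R -> C) (a b : R) :
  (forall t, RC_continuous F t) -> (forall t, RC_continuous G t) ->
  CInt (fun t => F t - G t)%C a b = (CInt F a b - CInt G a b)%C.
Proof.
intros HF HG; apply CInt_unique.
apply (is_RInt_minus (V := C_R_NormedModule)); apply CInt_correct; assumption.
Qed.

Lemma Cmod_CInt_le (F : R -> C) (a b M : R) :
  a <= b -> (forall t, RC_continuous F t) ->
  (forall t, a <= t <= b -> Cmod (F t) <= M) ->
  Cmod (CInt F a b) <= (b - a) * M.
Proof.
intros Hab HF HM; rewrite <- norm_C_R.
apply (norm_RInt_le_const (V := C_R_NormedModule) F); [exact Hab | |].
- intros t Ht; rewrite norm_C_R; now apply HM.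
- now apply CInt_correct.
Qed.

Lemma CInt_derive (F dF : R -> C) (a b : R) :
  (forall t, is_RC_derive F t (dF t)) -> (forall t, RC_continuous dF t) ->
  CInt dF a b = (F b - F a)%C.
Proof.
intros H1 H2; apply CInt_unique.
apply (is_RInt_derive (V := C_R_CompleteNormedModule)); intros; auto.
Qed.

Lemma CInt_shift (F : R -> C) (a b s : R) :
  (forall t, RC_continuous F t) ->
  CInt (fun t => F (t + s)) a b = CInt F (a + s) (b + s).
Proof.
intros H.
transitivity (CInt F (1 * a + s) (1 * b + s)); [|f_equal; ring].
rewrite <- (RInt_comp_lin (V := C_R_CompleteNormedModule)).
- apply CInt_ext; intros t.
  change (F (t + s) = scal 1 (F (1 * t + s)) :> C_R_ModuleSpace).
  rewrite Rmult_1_l; symmetry; apply (scal_one (F (t + s) : C_R_ModuleSpace)).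
- eexists; now apply CInt_correct.
Qed.

Lemma CInt_periodic (F : R -> C) (s : R) :
  (forall t, RC_continuous F t) -> (forall t, F (t + 2 * PI) = F t) ->
  CInt F s (s + 2 * PI) = CInt F 0 (2 * PI).
Proof.
intros H HP.
assert (E : forall a b, @ex_RInt C_R_CompleteNormedModule F a b)
  by (intros a b; eexists; now apply CInt_correct).
assert (X1 : (CInt F 0 s + CInt F s (s + 2 * PI) = CInt F 0 (s + 2 * PI))%C)
  by (apply (RInt_Chasles (V := C_R_CompleteNormedModule)); apply E).
assert (X2 : (CInt F 0 (2 * PI) + CInt F (2 * PI) (s + 2 * PI) = CInt F 0 (s + 2 * PI))%C)
  by (apply (RInt_Chasles (V := C_R_CompleteNormedModule)); apply E).
assert (X3 : CInt F (2 * PI) (s + 2 * PI) = CInt F 0 s).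
{ rewrite <- (Rplus_0_l (2 * PI)) at 1; rewrite <- CInt_shift by assumption.
  apply CInt_ext; intros; apply HP. }
rewrite X3, <- X1 in X2.
transitivity (CInt F 0 s + CInt F s (s + 2 * PI) - CInt F 0 s)%C.
- ring.
- rewrite <- X2; ring.
Qed.

(** * Fourier series *)

Definition expi (n : Z) (t : R) : C := cis (IZR n * t).

Lemma expi_plus (n m : Z) (t : R) : expi (n + m) t = (expi n t * expi m t)%C.
Proof. unfold expi; rewrite plus_IZR, Rmult_plus_distr_r; apply cis_plus. Qed.

Lemma expi_0 (t : R) : expi 0 t = RtoC 1.
Proof. unfold expi; rewrite Rmult_0_l; apply cis_0. Qed.

Lemma expi_1 (t : R) : expi 1 t = cis t.
Proof. unfold expi; f_equal; ring. Qed.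

Lemma expi_shift (n : Z) (s t : R) : expi n (s + t) = (expi n s * expi n t)%C.
Proof. unfold expi; rewrite Rmult_plus_distr_l; apply cis_plus. Qed.

Lemma expi_of_nat (n : nat) (t : R) : expi (Z.of_nat n) t = (cis t ^ n)%C.
Proof.
induction n as [|n IH]; [apply expi_0|].
replace (Z.of_nat (S n)) with (1 + Z.of_nat n)%Z by lia.
now rewrite expi_plus, expi_1, IH.
Qed.

Lemma expi_opp (n : Z) (t : R) : expi (- n) t = (/ expi n t)%C.
Proof. unfold expi; rewrite opp_IZR, Ropp_mult_distr_l_reverse; apply cis_neg. Qed.

Lemma Cmod_expi (n : Z) (t : R) : Cmod (expi n t) = 1.
Proof. apply Cmod_cis. Qed.

Lemma expi_derive (n : Z) (t : R) : is_RC_derive (expi n) t (Ci * RtoC (IZR n) * expi n t)%C.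
Proof. apply cis_derive. Qed.

Lemma expi_continuous (n : Z) (t : R) : RC_continuous (expi n) t.
Proof. eapply is_RC_derive_continuous, expi_derive. Qed.

Lemma expi_2PI (n : Z) : expi n (2 * PI) = RtoC 1.
Proof.
assert (H : cis (2 * PI) = RtoC 1).
{ apply C_ext; simpl; [apply cos_2PI | apply sin_2PI]. }
assert (P : forall m, expi (Z.of_nat m) (2 * PI) = RtoC 1).
{ intros m; rewrite expi_of_nat, H; apply Cpow_1_l. }
destruct (Z_le_gt_dec 0 n) as [Hn|Hn].
- rewrite <- (Z2Nat.id n) by assumption; apply P.
- rewrite <- (Z.opp_involutive n), expi_opp, <- (Z2Nat.id (- n)) by lia.
  rewrite P; apply C_ext; simpl; field.
Qed.

Lemma expi_periodic (n : Z) (t : R) : expi n (t + 2 * PI) = expi n t.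
Proof. rewrite expi_shift, expi_2PI; ring. Qed.

Lemma cis_periodic (t : R) : cis (t + 2 * PI) = cis t.
Proof. rewrite <- !expi_1; apply expi_periodic. Qed.

Lemma cis_continuous (t : R) : RC_continuous cis t.
Proof. apply (continuous_ext (expi 1)); [apply expi_1 | apply expi_continuous]. Qed.

(** The Fourier coefficient without its factor [/ (2 * PI)], which reappears in [taylor_coef],
    [plus_coef] and [minus_coef]. *)
Definition fc (F : R -> C) (n : Z) : C :=
  CInt (fun t => F t * expi (- n) t)%C 0 (2 * PI).

Lemma two_PI_pos : 0 < 2 * PI.
Proof. pose proof PI_RGT_0; lra. Qed.

Lemma fc_continuous (F : R -> C) (n : Z) :
  (forall t, RC_continuous F t) ->
  forall t, RC_continuous (fun t => F t * expi n t)%C t.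
Proof. intros H t; apply C_continuous_mult; [apply H | apply expi_continuous]. Qed.

Lemma fc_ext (F G : R -> C) (n : Z) : (forall t, F t = G t) -> fc F n = fc G n.
Proof. intros H; apply CInt_ext; intros t; now rewrite H. Qed.

Lemma fc_minus (F G : R -> C) (n : Z) :
  (forall t, RC_continuous F t) -> (forall t, RC_continuous G t) ->
  fc (fun t => F t - G t)%C n = (fc F n - fc G n)%C.
Proof.
intros HF HG; unfold fc.
rewrite <- CInt_minus by (intros; now apply fc_continuous).
apply CInt_ext; intros; ring.
Qed.

Lemma fc_plus (F G : R -> C) (n : Z) :
  (forall t, RC_continuous F t) -> (forall t, RC_continuous G t) ->
  fc (fun t => F t + G t)%C n = (fc F n + fc G n)%C.
Proof.
intros HF HG; unfold fc.
rewrite <- CInt_plus by (intros; now apply fc_continuous).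
apply CInt_ext; intros; ring.
Qed.

Lemma fc_scal (c : C) (F : R -> C) (n : Z) :
  (forall t, RC_continuous F t) ->
  fc (fun t => c * F t)%C n = (c * fc F n)%C.
Proof.
intros HF; unfold fc.
rewrite <- CInt_scal by (intros; now apply fc_continuous).
apply CInt_ext; intros; ring.
Qed.

Lemma fc_mult_expi (F : R -> C) (m n : Z) :
  fc (fun t => F t * expi m t)%C n = fc F (n - m).
Proof.
apply CInt_ext; intros t.
replace (- (n - m))%Z with (m + - n)%Z by ring; rewrite expi_plus; ring.
Qed.

Lemma Cmod_fc_le (F : R -> C) (n : Z) (M : R) :
  (forall t, RC_continuous F t) -> (forall t, 0 <= t <= 2 * PI -> Cmod (F t) <= M) ->
  Cmod (fc F n) <= 2 * PI * M.
Proof.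
intros HF HM.
replace (2 * PI * M) with ((2 * PI - 0) * M) by ring.
apply Cmod_CInt_le.
- apply Rlt_le, two_PI_pos.
- now apply fc_continuous.
- intros t Ht; rewrite Cmod_mult, Cmod_expi, Rmult_1_r; now apply HM.
Qed.

(** Integration by parts: the increment of [F * expi (- n)] over a full period vanishes. *)
Lemma fc_derive (F dF : R -> C) (n : Z) :
  (forall t, is_RC_derive F t (dF t)) -> (forall t, RC_continuous dF t) ->
  (forall t, F (t + 2 * PI) = F t) ->
  fc dF n = (Ci * RtoC (IZR n) * fc F n)%C.
Proof.
intros HF HdF HP.
assert (cF : forall t, RC_continuous F t)
  by (intros t; eapply is_RC_derive_continuous, HF).
assert (H : CInt (fun t => dF t * expi (- n) t + (- (Ci * RtoC (IZR n))) * (F t * expi (- n) t))%C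
              0 (2 * PI) = RtoC 0).
{ rewrite (CInt_derive (fun t => F t * expi (- n) t)%C).
  - replace (2 * PI) with (0 + 2 * PI) by ring.
    rewrite HP, expi_periodic; ring.
  - intros t; eapply is_RC_derive_eq.
    + apply is_RC_derive_mult; [apply HF | apply expi_derive].
    + rewrite opp_IZR, RtoC_opp; ring.
  - intros t; apply C_continuous_plus; [now apply fc_continuous|].
    apply C_continuous_mult; [apply C_continuous_const | now apply fc_continuous]. }
assert (c1 := fc_continuous F (- n) cF); assert (c2 := fc_continuous dF (- n) HdF).
rewrite (CInt_plus (fun t => dF t * expi (- n) t)%C
          (fun t => (- (Ci * RtoC (IZR n))) * (F t * expi (- n) t))%C) in H;
  [ | exact c2 | intros; apply C_continuous_mult; [apply C_continuous_const | apply c1] ].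
rewrite (CInt_scal _ (fun t => F t * expi (- n) t)%C) in H by exact c1.
fold (fc dF n) in H; fold (fc F n) in H.
apply Ceq_minus; rewrite <- H; ring.
Qed.

(** For [n <> 0], [fc_derive] applied to a constant gives [0 = Ci * n * fc 1 n]. *)
Lemma fc_1 (n : Z) : fc (fun _ => RtoC 1) n = if Z.eq_dec n 0 then RtoC (2 * PI) else RtoC 0.
Proof.
destruct (Z.eq_dec n 0) as [->|Hn].
- unfold fc; rewrite (CInt_derive (fun t => RtoC t * 1)%C).
  + rewrite <- RtoC_mult; apply C_ext; simpl; ring.
  + intros t; apply is_RC_derive_comp_iff; simpl Z.opp; rewrite expi_0; split; simpl;
      auto_derive; auto; ring.
  + apply fc_continuous; intros; apply C_continuous_const.
- assert (H : fc (fun _ => RtoC 0) n = (Ci * RtoC (IZR n) * fc (fun _ => RtoC 1) n)%C).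
  { apply fc_derive; auto; intros; [apply is_RC_derive_const | apply C_continuous_const]. }
  assert (Z : fc (fun _ => RtoC 0) n = RtoC 0).
  { unfold fc; rewrite (CInt_derive (fun _ => RtoC 0)).
    - ring.
    - intros t; rewrite Cmult_0_l; apply is_RC_derive_const.
    - apply fc_continuous; intros; apply C_continuous_const. }
  rewrite Z in H.
  assert (N : (Ci * RtoC (IZR n))%C <> RtoC 0).
  { apply Cmult_neq_0; [apply Ci_nz|].
    intros E; apply RtoC_inj in E; apply Hn, eq_IZR, E. }
  set (v := fc _ n) in *; set (w := (Ci * RtoC (IZR n))%C) in *.
  replace v with (/ w * (w * v))%C by (field; assumption).
  rewrite <- H; ring.
Qed.

(* Translating by half a period [PI / n] of [expi n] changes the sign of the integral. *)
Lemma riemann_lebesgue (k : R -> C) (eps : posreal) :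
  (forall t, RC_continuous k t) -> (forall t, k (t + 2 * PI) = k t) ->
  exists N : Z, (0 < N)%Z /\ forall n : Z, (N <= Z.abs n)%Z -> Cmod (fc k n) <= eps.
Proof.
intros ck pk.
pose proof two_PI_pos as HPI.
assert (Heta : 0 < eps / (2 * PI)) by (apply Rdiv_lt_0_compat; [apply cond_pos | assumption]).
(* The translation [s] below satisfies [Rabs s <= PI], so [t + s] stays in this interval for [t] in
   a period. The accuracy [eps / (2 * PI)] is divided by the length of the period. *)
destruct (unifcont_normed_1d (V := C_R_NormedModule) k (- PI) (3 * PI)
            (fun t _ => ck t) (mkposreal _ Heta)) as [d Hd].
assert (HN : exists N : Z, (0 < N)%Z /\ PI / IZR N < d).
{ destruct (archimed (PI / d)) as [A _].
  assert (0 < PI / d) by (apply Rdiv_lt_0_compat; [lra | apply cond_pos]).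
  assert (U : 0 < IZR (up (PI / d))) by lra.
  exists (up (PI / d)); split.
  - now apply lt_IZR.
  - apply (Rmult_lt_reg_r (IZR (up (PI / d)))); [lra|].
    apply (Rmult_lt_compat_r d) in A; [|apply cond_pos].
    replace (PI / d * d) with PI in A by (field; apply Rgt_not_eq, cond_pos).
    replace (PI / IZR (up (PI / d)) * IZR (up (PI / d))) with PI by (field; lra).
    lra. }
destruct HN as [N [N0 HN]]; exists N; split; [exact N0|]; intros n Hn.
assert (Hn0 : n <> 0%Z) by lia.
assert (In0 : IZR n <> 0) by (now apply not_0_IZR).
set (s := PI / IZR n).
assert (Hs : Rabs s < d /\ Rabs s <= PI).
{ unfold s, Rdiv; rewrite Rabs_mult, Rabs_inv, <- abs_IZR, (Rabs_pos_eq PI) by lra.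
  assert (1 <= IZR N) by (apply IZR_le; lia).
  assert (IZR N <= IZR (Z.abs n)) by (now apply IZR_le).
  assert (0 < / IZR (Z.abs n) <= / IZR N).
  { split; [apply Rinv_0_lt_compat; lra | apply Rinv_le_contravar; lra]. }
  assert (/ IZR N <= 1) by (rewrite <- Rinv_1; apply Rinv_le_contravar; lra).
  unfold Rdiv in HN; split; nra. }
set (G := fun t => (k t * expi (- n) t)%C).
assert (cG : forall t, RC_continuous G t) by (now apply fc_continuous).
assert (ck' : forall t, RC_continuous (fun t => k (t + s)) t).
{ intros t; apply (continuous_comp (fun t => t + s) k); [|apply ck].
  apply (continuous_plus (V := R_NormedModule)); [apply continuous_id | apply continuous_const]. }
assert (E1 : fc k n = CInt (fun t => G (t + s)) 0 (2 * PI)).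
{ rewrite CInt_shift by assumption; rewrite Rplus_0_l, (Rplus_comm _ s).
  rewrite CInt_periodic; [reflexivity | assumption |].
  intros t; unfold G; now rewrite pk, expi_periodic. }
assert (E2 : expi (- n) s = (- (1))%C).
{ unfold expi, s; rewrite opp_IZR; replace (- IZR n * (PI / IZR n)) with (- PI) by (field; assumption).
  apply C_ext; simpl; rewrite ?cos_neg, ?sin_neg, ?cos_PI, ?sin_PI; ring. }
assert (E3 : fc k n = (- (1) * fc (fun t => k (t + s)%R) n)%C).
{ rewrite E1, <- fc_scal by assumption; apply CInt_ext; intros t; unfold G.
  rewrite expi_shift, E2; ring. }
assert (E4 : (RtoC 2 * fc k n = CInt (fun t => (k t - k (t + s)%R) * expi (- n) t)%C 0 (2 * PI))%C).
{ change (RtoC 2 * fc k n = fc (fun t => k t - k (t + s)%R)%C n)%C.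
  rewrite fc_minus by assumption.
  replace (RtoC 2 * fc k n)%C with (fc k n + fc k n)%C by ring.
  rewrite E3 at 2; ring. }
assert (E5 : Cmod (RtoC 2 * fc k n) <= (2 * PI - 0) * (eps / (2 * PI))).
{ rewrite E4; apply Cmod_CInt_le; [lra | |].
  - apply fc_continuous; intros t; apply C_continuous_plus; [apply ck|].
    apply (continuous_opp (V := C_R_NormedModule)), ck'.
  - intros t Ht; rewrite Cmod_mult, Cmod_expi, Rmult_1_r, Cmod_minus_sym.
    apply Rlt_le; rewrite <- norm_C_R.
    assert (B := proj2 Hs); apply Rabs_le_between in B.
    apply Hd; [lra | lra |].
    change (Rabs (t + s - t) < d); replace (t + s - t) with s by ring; apply Hs. }
rewrite Cmod_mult, Cmod_R, Rabs_pos_eq in E5 by lra.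
replace ((2 * PI - 0) * (eps / (2 * PI))) with (pos eps) in E5
  by (field; pose proof PI_RGT_0; lra).
pose proof (Cmod_ge_0 (fc k n)); lra.
Qed.

(** The quotient by [cis t - cis t0] has its singularity removed by the value [l / (Ci * cis t0)],
    the derivative with respect to the point of the circle instead of the angle. Defining [k]
    through [cis t] makes it periodic and settles all the angles congruent to [t0] at once. *)
Lemma difference_quotient_continuous (f : C -> C) (t0 : R) (l : C) :
  (forall t, RC_continuous (fun t => f (cis t)) t) ->
  is_RC_derive (fun t => f (cis t)) t0 l ->
  exists k : R -> C, (forall t, RC_continuous k t) /\
    (forall t, k (t + 2 * PI) = k t) /\
    forall t, (k t * (cis t - cis t0) = f (cis t) - f (cis t0))%C.
Proof.
intros cf df.
set (L := (l / (Ci * cis t0))%C).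
assert (N : (Ci * cis t0)%C <> RtoC 0)
  by (apply Cmult_neq_0; [apply Ci_nz | apply cis_neq_0]).
exists (fun t => if Ceq_dec (cis t) (cis t0) then L
          else ((f (cis t) - f (cis t0)) / (cis t - cis t0))%C).
split; [|split].
- intros t1; destruct (Ceq_dec (cis t1) (cis t0)) as [E|E].
  + apply RC_continuous_iff; intros eps.
    destruct (Ceq_dec (cis t1) (cis t0)) as [_|]; [|contradiction].
    pose proof (cond_pos eps) as He; pose proof (Cmod_ge_0 L) as HL.
    (* If both first-order expansions have error at most [eta * Rabs u], then the denominator is at
       least [Rabs u / 2], which is where [eta <= 1 / 2] enters, and the numerator [DF - L * Dc] is
       at most [eta * (1 + Cmod L) * Rabs u]. The error of the quotient is then at most
       [2 * eta * (1 + Cmod L)]. *)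
    set (eta := Rmin (1 / 2) (eps / (4 * (1 + Cmod L)))).
    assert (He1 : 0 < eta).
    { apply Rmin_pos; [lra | apply Rdiv_lt_0_compat; lra]. }
    assert (He2 : eta <= 1 / 2) by apply Rmin_l.
    assert (He3 : 2 * eta * (1 + Cmod L) < eps).
    { assert (eta <= eps / (4 * (1 + Cmod L))) by apply Rmin_r.
      apply Rle_lt_trans with (2 * (eps / (4 * (1 + Cmod L))) * (1 + Cmod L)); [nra|].
      replace (2 * (eps / (4 * (1 + Cmod L))) * (1 + Cmod L)) with (eps / 2) by (field; lra).
      lra. }
    assert (dc := cis_derive 1 t0).
    rewrite is_RC_derive_iff in df, dc.
    destruct (df (mkposreal _ He1)) as [d1 Hd1].
    destruct (dc (mkposreal _ He1)) as [d2 Hd2].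
    exists (mkposreal _ (Rmin_stable_in_posreal d1 d2)); simpl; intros s Hs.
    destruct (Ceq_dec (cis s) (cis t0)) as [_|Es].
    { replace (L - L)%C with (RtoC 0) by ring; rewrite Cmod_0; assumption. }
    set (u := s - t1) in *.
    (* [t1] only has the same image as [t0] on the circle; the expansion at [t0] is carried over to
       [t1] by the displacement [u]. *)
    assert (Cs : cis s = cis (t0 + u)).
    { replace s with (t1 + u) by (unfold u; ring); now rewrite !cis_plus, E. }
    rewrite Cs in Es |- *.
    specialize (Hd1 (t0 + u)); specialize (Hd2 (t0 + u)); simpl in Hd1, Hd2.
    rewrite !Rmult_1_l in Hd2.
    replace (t0 + u - t0) with u in Hd1, Hd2 by ring.
    specialize (Hd1 (Rlt_le_trans _ _ _ Hs (Rmin_l _ _))).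
    specialize (Hd2 (Rlt_le_trans _ _ _ Hs (Rmin_r _ _))).
    set (DF := (f (cis (t0 + u)) - f (cis t0))%C) in *.
    set (Dc := (cis (t0 + u) - cis t0)%C) in *.
    assert (Dn : Dc <> RtoC 0) by (now apply Cminus_eq_contra).
    assert (B1 : (1 - eta) * Rabs u <= Cmod Dc).
    { assert (Cmod (Ci * RtoC 1 * cis t0 * RtoC u) = Rabs u)
        by (rewrite !Cmod_mult, !Cmod_R, Cmod_Ci, Cmod_cis, Rabs_R1; ring).
      pose proof (Cmod_triangle_minus (Ci * RtoC 1 * cis t0 * RtoC u) Dc).
      rewrite (Cmod_minus_sym _ Dc) in H0; lra. }
    assert (B2 : Cmod (DF - L * Dc) <= eta * (1 + Cmod L) * Rabs u).
    { replace (DF - L * Dc)%C with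
        ((DF - l * RtoC u) + - (L * (Dc - Ci * RtoC 1 * cis t0 * RtoC u)))%C.
      - eapply Rle_trans; [apply Cmod_triangle|].
        rewrite Cmod_opp, Cmod_mult; nra.
      - replace l with (L * (Ci * cis t0))%C by (unfold L; field; split; [apply cis_neq_0 | apply Ci_nz]).
        ring. }
    replace (DF / Dc - L)%C with ((DF - L * Dc) / Dc)%C by (field; assumption).
    rewrite Cmod_div by assumption.
    apply Cmod_gt_0 in Dn.
    apply (Rmult_lt_reg_r (Cmod Dc)); [assumption|].
    unfold Rdiv; rewrite Rmult_assoc, Rinv_l by lra.
    assert (0 <= Rabs u) by apply Rabs_pos.
    assert (Hu : Rabs u <= 2 * Cmod Dc) by nra.
    apply Rle_lt_trans with (2 * eta * (1 + Cmod L) * Cmod Dc).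
    * apply (Rmult_le_compat_l (eta * (1 + Cmod L))) in Hu; [lra | nra].
    * now apply Rmult_lt_compat_r.
  + set (Q := fun t => ((f (cis t) - f (cis t0)) * / (cis t - cis t0))%C).
    assert (cQ : RC_continuous Q t1).
    { apply C_continuous_mult.
      - apply C_continuous_plus; [apply cf | apply C_continuous_const].
      - assert (H : RC_continuous (fun t => cis t - cis t0)%C t1)
          by (apply C_continuous_plus; [apply cis_continuous | apply C_continuous_const]).
        apply C_continuous_comp_iff in H; destruct H as [H1 H2].
        assert (Hn : Re (cis t1 - cis t0) ^ 2 + Im (cis t1 - cis t0) ^ 2 <> 0).
        { intros Z; apply E; apply Ceq_minus, Cmod_eq_0.
          unfold Cmod; fold (Re (cis t1 - cis t0)) (Im (cis t1 - cis t0)).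
          rewrite Z; apply sqrt_0. }
        assert (CD : continuous (fun t => / (Re (cis t - cis t0) ^ 2 + Im (cis t - cis t0) ^ 2)) t1).
        { apply (continuous_comp (fun t => Re (cis t - cis t0) ^ 2 + Im (cis t - cis t0) ^ 2) Rinv).
          - apply (continuous_plus (V := R_NormedModule)); simpl;
              repeat (apply (continuous_mult (K := R_AbsRing)); try assumption);
              apply continuous_const.
          - apply continuous_Rinv, Hn. }
        apply C_continuous_comp_iff; split; simpl.
        + apply (continuous_mult (K := R_AbsRing)); assumption.
        + apply (continuous_mult (K := R_AbsRing)); [|assumption].
          apply (continuous_opp (V := R_NormedModule)); assumption. }
    assert (V : exists d : posreal, forall s, Rabs (s - t1) < d -> cis s <> cis t0).
    { assert (H : 0 < Cmod (cis t1 - cis t0)) by (now apply Cmod_gt_0, Cminus_eq_contra).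
      destruct (proj1 (RC_continuous_iff _ _) (cis_continuous t1) (mkposreal _ H)) as [d Hd].
      exists d; intros s Hs Es; specialize (Hd s Hs); simpl in Hd.
      rewrite Es, Cmod_minus_sym in Hd; lra. }
    destruct V as [d Hd].
    apply (continuous_ext_loc _ Q); [|exact cQ].
    exists d; intros s Hs; destruct (Ceq_dec (cis s) (cis t0)) as [Z|_]; [|reflexivity].
    elim (Hd s Hs Z).
- intros t; now rewrite cis_periodic.
- intros t; destruct (Ceq_dec (cis t) (cis t0)) as [E|E].
  + rewrite E; ring.
  + field; now apply Cminus_eq_contra.
Qed.

Definition Csum (a : nat -> C) (n : nat) : C := @sum_n C_AbelianMonoid a n.

Lemma Csum_0 (a : nat -> C) : Csum a 0 = a 0%nat.
Proof. apply (sum_O (G := C_AbelianMonoid)). Qed.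

Lemma Csum_S (a : nat -> C) (n : nat) : Csum a (S n) = (Csum a n + a (S n))%C.
Proof. apply (sum_Sn (G := C_AbelianMonoid)). Qed.

(** Pairing [n] with [- n] makes [Csum] produce the symmetric partial sums. *)
Definition fourier_term (F : R -> C) (t : R) (n : nat) : C :=
  match n with
  | O => fc F 0
  | S _ => (fc F (Z.of_nat n) * expi (Z.of_nat n) t + fc F (- Z.of_nat n) * expi (- Z.of_nat n) t)%C
  end.

(* Writing [F - F t0 = (expi 1 - expi 1 t0) k], the Fourier series of [F] at [t0]
   telescopes up to two Fourier coefficients of [k]. *)
Lemma fourier_inversion (f : C -> C) (t0 : R) (l : C) (eps : posreal) :
  (forall t, RC_continuous (fun t => f (cis t)) t) ->
  is_RC_derive (fun t => f (cis t)) t0 l ->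
  exists N0 : nat, forall N, (N0 <= N)%nat ->
    Cmod (Csum (fourier_term (fun t => f (cis t)) t0) N - RtoC (2 * PI) * f (cis t0)) <= eps.
Proof.
intros cf df; set (F := fun t => f (cis t)) in *.
destruct (difference_quotient_continuous f t0 l cf df) as [k [ck [pk Hk]]].
set (d := fun n => (expi n t0 * fc k n)%C).
(* Multiplication of [k] by [expi 1] shifts its coefficients by one, so apart from the constant
   [F t0] each term is a difference of consecutive values of [d]. *)
assert (T : forall n, (fc F n * expi n t0 =
   F t0 * fc (fun _ => RtoC 1) n * expi n t0 + cis t0 * (d (n - 1)%Z - d n))%C).
{ intros n.
  assert (H : (fc F n = F t0 * fc (fun _ => RtoC 1) n + fc k (n - 1) - cis t0 * fc k n)%C).
  { rewrite <- (fc_mult_expi k 1 n), <- !fc_scal by auto using C_continuous_const.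
    assert (C1 : forall t, RC_continuous (fun t => F t0 * 1)%C t)
      by (intros; apply C_continuous_const).
    assert (C2 := fc_continuous k 1 ck).
    assert (C3 : forall t, RC_continuous (fun t => cis t0 * k t)%C t)
      by (intros; apply C_continuous_mult; [apply C_continuous_const | apply ck]).
    rewrite <- fc_plus, <- fc_minus; auto.
    - apply fc_ext; intros t; rewrite expi_1.
      replace (F t) with (F t0 + (f (cis t) - f (cis t0)))%C by (unfold F; ring).
      rewrite <- Hk; ring.
    - intros; now apply C_continuous_plus. }
  unfold d; rewrite H.
  replace (expi n t0) with (cis t0 * expi (n - 1) t0)%C; [ring|].
  rewrite <- expi_1, <- expi_plus; f_equal; ring. }
assert (S : forall N, Csum (fourier_term F t0) N =
  (RtoC (2 * PI) * F t0 + cis t0 * (d (- Z.of_nat N - 1)%Z - d (Z.of_nat N)))%C).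
{ induction N as [|N IH].
  - rewrite Csum_0; specialize (T 0%Z); rewrite fc_1, expi_0 in T; simpl in T |- *.
    rewrite Cmult_1_r in T; rewrite T; ring.
  - rewrite Csum_S, IH; unfold fourier_term; rewrite !T, !fc_1.
    destruct (Z.eq_dec (Z.of_nat (S N)) 0) as [|_]; [lia|].
    destruct (Z.eq_dec (- Z.of_nat (S N)) 0) as [|_]; [lia|].
    replace (Z.of_nat (S N) - 1)%Z with (Z.of_nat N) by lia.
    replace (- Z.of_nat (S N))%Z with (- Z.of_nat N - 1)%Z by lia.
    ring. }
assert (He : 0 < eps / 2) by (pose proof (cond_pos eps); lra).
destruct (riemann_lebesgue k (mkposreal _ He) ck pk) as [N0 [_ HN]]; simpl in HN.
exists (Z.to_nat N0); intros N HNN; rewrite S.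
match goal with |- Cmod ?x <= _ =>
  replace x with (cis t0 * (d (- Z.of_nat N - 1)%Z + - d (Z.of_nat N)))%C by (unfold F; ring) end.
rewrite Cmod_mult, Cmod_cis, Rmult_1_l.
eapply Rle_trans; [apply Cmod_triangle|]; rewrite Cmod_opp.
unfold d; rewrite !Cmod_mult, !Cmod_expi, !Rmult_1_l.
pose proof (HN (- Z.of_nat N - 1)%Z ltac:(lia)).
pose proof (HN (Z.of_nat N) ltac:(lia)).
lra.
Qed.

(** * Complex power series *)

Definition is_Cseries (a : nat -> C) (l : C) : Prop :=
  forall eps : posreal, exists N0 : nat, forall N, (N0 <= N)%nat ->
    Cmod (Csum a N - l) <= eps.

(** A total function, so that a power series can be written before its convergence is known;
    [CSeries_correct] gives it its meaning. *)
Definition CSeries (a : nat -> C) : C :=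
  (Series (fun n => Re (a n)), Series (fun n => Im (a n))).

Lemma Cmod_eq_of_le (z w : C) (K : R) :
  (forall eps : posreal, Cmod (z - w) <= K * eps) -> z = w.
Proof.
intros H; apply Ceq_minus, Cmod_eq_0, Rle_antisym; [|apply Cmod_ge_0].
apply le_epsilon; intros eps He; rewrite Rplus_0_l.
destruct (Rle_lt_dec K 0) as [HK|HK].
- specialize (H (mkposreal _ He)); simpl in H; nra.
- assert (P : 0 < eps / K) by (now apply Rdiv_lt_0_compat).
  specialize (H (mkposreal _ P)); simpl in H.
  replace eps with (K * (eps / K)) by (field; lra); exact H.
Qed.

Lemma is_Cseries_unique (a : nat -> C) (l m : C) :
  is_Cseries a l -> is_Cseries a m -> l = m.
Proof.
intros Hl Hm; apply (Cmod_eq_of_le _ _ 2); intros eps.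
destruct (Hl eps) as [N1 H1]; destruct (Hm eps) as [N2 H2].
specialize (H1 (N1 + N2)%nat ltac:(lia)); specialize (H2 (N1 + N2)%nat ltac:(lia)).
replace (l - m)%C with ((Csum a (N1 + N2) - m) + - (Csum a (N1 + N2) - l))%C by ring.
eapply Rle_trans; [apply Cmod_triangle|]; rewrite Cmod_opp; lra.
Qed.

Lemma Csum_ext (a b : nat -> C) (N : nat) :
  (forall n, a n = b n) -> Csum a N = Csum b N.
Proof. intros H; apply (sum_n_ext (G := C_AbelianMonoid)); exact H. Qed.

Lemma is_Cseries_ext (a b : nat -> C) (l : C) :
  (forall n, a n = b n) -> is_Cseries a l -> is_Cseries b l.
Proof.
intros H Ha eps; destruct (Ha eps) as [N0 HN]; exists N0; intros N HNN.
rewrite <- (Csum_ext a b) by exact H; now apply HN.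
Qed.

Lemma Csum_lin (c : C) (a b : nat -> C) (N : nat) :
  Csum (fun n => c * a n + b n)%C N = (c * Csum a N + Csum b N)%C.
Proof.
induction N as [|N IH]; [now rewrite !Csum_0|].
rewrite !Csum_S, IH; ring.
Qed.

Lemma Csum_zero (N : nat) : Csum (fun _ => RtoC 0) N = RtoC 0.
Proof. induction N as [|N IH]; [apply Csum_0 | rewrite Csum_S, IH; ring]. Qed.

Lemma is_Cseries_eq (a : nat -> C) (l : C) : (forall N, Csum a N = l) -> is_Cseries a l.
Proof.
intros H eps; exists 0%nat; intros N _; rewrite H.
replace (l - l)%C with (RtoC 0) by ring; rewrite Cmod_0; apply Rlt_le, cond_pos.
Qed.

Lemma is_Cseries_lin (c : C) (a b : nat -> C) (l m : C) :
  is_Cseries a l -> is_Cseries b m ->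
  is_Cseries (fun n => c * a n + b n)%C (c * l + m)%C.
Proof.
intros Ha Hb eps.
pose proof (Cmod_ge_0 c) as Hc; pose proof (cond_pos eps) as He.
assert (P : 0 < eps / (Cmod c + 1)) by (apply Rdiv_lt_0_compat; lra).
assert (P1 : 0 < eps / (Cmod c + 1) / 2) by lra.
assert (E : (Cmod c + 1) * (eps / (Cmod c + 1) / 2) = eps / 2) by (field; lra).
destruct (Ha (mkposreal _ P1)) as [N1 H1].
assert (P2 : 0 < eps / 2) by lra.
destruct (Hb (mkposreal _ P2)) as [N2 H2].
exists (N1 + N2)%nat; intros N HN.
specialize (H1 N ltac:(lia)); specialize (H2 N ltac:(lia)); simpl in H1, H2.
rewrite Csum_lin.
replace (c * Csum a N + Csum b N - (c * l + m))%C with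
  (c * (Csum a N - l) + (Csum b N - m))%C by ring.
eapply Rle_trans; [apply Cmod_triangle|]; rewrite Cmod_mult.
pose proof (Cmod_ge_0 (Csum a N - l)); nra.
Qed.

(* A telescoping majorant of [1 / (n + 1) ^ 2], whose sum is [2]. *)
Definition tele (n : nat) : R := 2 / ((INR n + 1) * (INR n + 2)).

Lemma tele_pos (n : nat) : 0 < tele n.
Proof.
unfold tele; pose proof (pos_INR n); apply Rdiv_lt_0_compat; nra.
Qed.

Lemma tele_diff (n : nat) : tele n = 2 / (INR n + 1) - 2 / (INR (S n) + 1).
Proof. unfold tele; rewrite S_INR; pose proof (pos_INR n); field; lra. Qed.

Lemma inv_sqr_le_tele (n : nat) : / (INR n + 1) ^ 2 <= tele n.
Proof.
unfold tele; pose proof (pos_INR n).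
replace (2 / ((INR n + 1) * (INR n + 2))) with (/ ((INR n + 1) * (INR n + 2) / 2))
  by (field; lra).
apply Rinv_le_contravar; nra.
Qed.

Lemma sum_tele (n : nat) : sum_n tele n = 2 - 2 / (INR (S n) + 1).
Proof.
induction n as [|n IH].
- rewrite sum_O, tele_diff; simpl; lra.
- rewrite sum_Sn, IH, tele_diff; unfold plus; simpl; lra.
Qed.

Lemma ex_series_tele : ex_series tele.
Proof.
exists 2; change (is_lim_seq (sum_n tele) 2).
apply (is_lim_seq_ext (fun n => 2 - 2 / (INR (S n) + 1))).
{ intros n; symmetry; apply sum_tele. }
evar_last.
{ apply is_lim_seq_minus'; [apply is_lim_seq_const|].
  apply (is_lim_seq_ext (fun n => 2 * / INR (n + 2))).
  { intros n; rewrite plus_INR, (S_INR n); unfold Rdiv; do 2 f_equal; simpl; ring. }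
  apply is_lim_seq_mult'; [apply is_lim_seq_const|].
  apply (is_lim_seq_incr_n (fun n => / INR n) 2).
  evar_last; [apply is_lim_seq_inv; [apply is_lim_seq_INR | easy] | reflexivity]. }
simpl; f_equal; ring.
Qed.

(** The telescoping majorant gives an explicit tail. For a power series the bound depends on [M] and
    [N] alone and is thus uniform in the point, which later allows integration term by term. *)
Lemma Cmod_tail_le (a : nat -> C) (M : R) (N p : nat) :
  (forall n, Cmod (a n) <= M * tele n) ->
  Cmod (Csum a (N + p) - Csum a N) <= 2 * M / (INR N + 1).
Proof.
intros H.
assert (HM : 0 <= M).
{ pose proof (H 0%nat); pose proof (tele_pos 0); pose proof (Cmod_ge_0 (a 0%nat)); nra. }
assert (B : Cmod (Csum a (N + p) - Csum a N) <=
  2 * M / (INR (S N) + 1) - 2 * M / (INR (S (N + p)) + 1)).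
{ induction p as [|p IH].
  - rewrite Nat.add_0_r; replace (Csum a N - Csum a N)%C with (RtoC 0) by ring.
    rewrite Cmod_0; lra.
  - rewrite Nat.add_succ_r, Csum_S.
    replace (Csum a (N + p) + a (S (N + p)) - Csum a N)%C with
      ((Csum a (N + p) - Csum a N) + a (S (N + p)))%C by ring.
    eapply Rle_trans; [apply Cmod_triangle|].
    specialize (H (S (N + p))); rewrite tele_diff in H.
    unfold Rdiv in *; lra. }
eapply Rle_trans; [exact B|].
pose proof (pos_INR (S (N + p))); pose proof (pos_INR N).
assert (0 <= 2 * M / (INR (S (N + p)) + 1)) by (apply Rdiv_le_0_compat; lra).
assert (2 * M / (INR (S N) + 1) <= 2 * M / (INR N + 1)).
{ apply Rmult_le_compat_l; [lra|]; apply Rinv_le_contravar; rewrite ?S_INR; lra. }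
lra.
Qed.

Lemma CSeries_correct (a : nat -> C) (M : R) :
  (forall n, Cmod (a n) <= M * tele n) -> is_Cseries a (CSeries a).
Proof.
intros H.
assert (S1 : ex_series (fun n => Re (a n))).
{ apply (ex_series_le (K := R_AbsRing) (V := R_CompleteNormedModule) _ (fun n => M * tele n)).
  - intros n; eapply Rle_trans; [|apply H].
    eapply Rle_trans; [apply Rmax_l | apply Rmax_Cmod].
  - apply (ex_series_scal (V := R_NormedModule) M), ex_series_tele. }
assert (S2 : ex_series (fun n => Im (a n))).
{ apply (ex_series_le (K := R_AbsRing) (V := R_CompleteNormedModule) _ (fun n => M * tele n)).
  - intros n; eapply Rle_trans; [|apply H].
    eapply Rle_trans; [apply Rmax_r | apply Rmax_Cmod].
  - apply (ex_series_scal (V := R_NormedModule) M), ex_series_tele. }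
apply Series_correct in S1; apply Series_correct in S2.
intros eps.
assert (He : 0 < eps / 2) by (pose proof (cond_pos eps); lra).
destruct (S1 _ (locally_ball _ (mkposreal _ He))) as [N1 H1].
destruct (S2 _ (locally_ball _ (mkposreal _ He))) as [N2 H2].
exists (N1 + N2)%nat; intros N HN.
specialize (H1 N ltac:(lia)); specialize (H2 N ltac:(lia)).
assert (R : Re (Csum a N) = sum_n (fun n => Re (a n)) N).
{ clear; induction N as [|N IH]; [now rewrite Csum_0, sum_O|].
  rewrite Csum_S, sum_Sn, re_plus, IH; reflexivity. }
assert (I : Im (Csum a N) = sum_n (fun n => Im (a n)) N).
{ clear; induction N as [|N IH]; [now rewrite Csum_0, sum_O|].
  rewrite Csum_S, sum_Sn, im_plus, IH; reflexivity. }
set (x := sum_n (fun n => Re (a n)) N - Series (fun n => Re (a n))).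
set (y := sum_n (fun n => Im (a n)) N - Series (fun n => Im (a n))).
change (Rabs x < eps / 2) in H1; change (Rabs y < eps / 2) in H2.
replace (Csum a N - CSeries a)%C with (RtoC x + Ci * RtoC y)%C.
- eapply Rle_trans; [apply Cmod_triangle|].
  rewrite Cmod_mult, Cmod_Ci, !Cmod_R; lra.
- apply C_ext; unfold CSeries, Cminus.
  + rewrite (re_plus (Csum a N)), re_opp, R; unfold x; simpl; ring.
  + rewrite (im_plus (Csum a N)), im_opp, I; unfold y; simpl; ring.
Qed.

Lemma is_Cseries_tail (a : nat -> C) (l : C) (M : R) (N : nat) :
  (forall n, Cmod (a n) <= M * tele n) -> is_Cseries a l ->
  Cmod (l - Csum a N) <= 2 * M / (INR N + 1).
Proof.
intros H Hl; apply le_epsilon; intros eps He.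
destruct (Hl (mkposreal _ He)) as [N1 H1].
specialize (H1 (N + N1)%nat ltac:(lia)); simpl in H1.
pose proof (Cmod_tail_le a M N N1 H).
replace (l - Csum a N)%C with
  ((Csum a (N + N1) - Csum a N) + - (Csum a (N + N1) - l))%C by ring.
eapply Rle_trans; [apply Cmod_triangle|]; rewrite Cmod_opp; lra.
Qed.

Lemma is_Cseries_bound (a : nat -> C) (l : C) (M : R) :
  (forall n, Cmod (a n) <= M * tele n) -> is_Cseries a l -> Cmod l <= 2 * M.
Proof.
intros H Hl; apply le_epsilon; intros eps He.
destruct (Hl (mkposreal _ He)) as [N H1].
specialize (H1 N ltac:(lia)); simpl in H1.
assert (HM : 0 <= M).
{ pose proof (H 0%nat); pose proof (tele_pos 0); pose proof (Cmod_ge_0 (a 0%nat)); nra. }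
assert (B : Cmod (Csum a N) <= M * sum_n tele N).
{ clear H1; induction N as [|N IH].
  - rewrite Csum_0, sum_O; apply H.
  - rewrite Csum_S, sum_Sn; eapply Rle_trans; [apply Cmod_triangle|].
    specialize (H (S N)); unfold plus; simpl; lra. }
rewrite sum_tele in B.
assert (0 <= 2 / (INR (S N) + 1)).
{ apply Rdiv_le_0_compat; [lra|]; pose proof (pos_INR (S N)); lra. }
pose proof (Cmod_triangle_minus l (Csum a N)) as T.
rewrite Cmod_minus_sym in T; nra.
Qed.

(** * Power series under weighted bounds on the coefficients *)

Definition ps (a : nat -> C) (z : C) : C := CSeries (fun n => a n * z ^ n)%C.

(** [M] bounds a weighted sup-norm of the coefficients. The base [INR n + 1] in place of [INR n]
    keeps the term of index [0] under control. *)
Definition bnd (k : nat) (rho M : R) (a : nat -> C) : Prop :=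
  forall n, Cmod (a n) * rho ^ n * (INR n + 1) ^ k <= M.

(** For [rho = 1] this is rapid decrease. All orders are asked for, so that the property survives
    differentiation on the closed disc, boundary included. *)
Definition conv (rho : R) (a : nat -> C) : Prop :=
  forall k, exists M, bnd k rho M a.

Lemma bnd_pos (k : nat) (rho M : R) (a : nat -> C) : bnd k rho M a -> 0 <= M.
Proof.
intros H; eapply Rle_trans; [|apply (H 0%nat)].
simpl; rewrite Rplus_0_l, pow1, !Rmult_1_r; apply Cmod_ge_0.
Qed.

Lemma bnd_le (j k : nat) (rho M : R) (a : nat -> C) :
  0 <= rho -> (j <= k)%nat -> bnd k rho M a -> bnd j rho M a.
Proof.
intros Hr Hjk H n; eapply Rle_trans; [|apply H].
apply Rmult_le_compat_l.
- apply Rmult_le_pos; [apply Cmod_ge_0 | now apply pow_le].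
- apply Rle_pow; [pose proof (pos_INR n); lra | assumption].
Qed.

Lemma ps_term_le (rho M : R) (a : nat -> C) (z : C) :
  0 <= rho -> bnd 2 rho M a -> Cmod z <= rho ->
  forall n, Cmod (a n * z ^ n) <= M * tele n.
Proof.
intros Hr H Hz n.
rewrite Cmod_mult, Cmod_pow.
pose proof (pos_INR n) as Pn.
apply Rle_trans with (M * / (INR n + 1) ^ 2).
- apply (Rmult_le_reg_r ((INR n + 1) ^ 2)); [apply pow_lt; lra|].
  rewrite (Rmult_assoc M), Rinv_l, Rmult_1_r by (apply pow_nonzero; lra).
  eapply Rle_trans; [|apply (H n)].
  apply Rmult_le_compat_r; [apply pow_le; lra|].
  apply Rmult_le_compat_l; [apply Cmod_ge_0|].
  apply pow_incr; split; [apply Cmod_ge_0 | exact Hz].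
- apply Rmult_le_compat_l; [eapply bnd_pos, H | apply inv_sqr_le_tele].
Qed.

Lemma ps_correct (rho M : R) (a : nat -> C) (z : C) :
  0 <= rho -> bnd 2 rho M a -> Cmod z <= rho ->
  is_Cseries (fun n => a n * z ^ n)%C (ps a z).
Proof.
intros Hr H Hz; apply (CSeries_correct _ M); now apply (ps_term_le rho).
Qed.

Lemma ps_unique (rho M : R) (a : nat -> C) (z l : C) :
  0 <= rho -> bnd 2 rho M a -> Cmod z <= rho ->
  is_Cseries (fun n => a n * z ^ n)%C l -> ps a z = l.
Proof.
intros; eapply is_Cseries_unique; [eapply ps_correct; eassumption | assumption].
Qed.

Lemma Cmod_ps_le (rho M : R) (a : nat -> C) (z : C) :
  0 <= rho -> bnd 2 rho M a -> Cmod z <= rho -> Cmod (ps a z) <= 2 * M.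
Proof.
intros Hr H Hz; eapply is_Cseries_bound; [|now apply (ps_correct rho M)].
now apply (ps_term_le rho).
Qed.

Lemma ps_ext (a b : nat -> C) (z : C) : (forall n, a n = b n) -> ps a z = ps b z.
Proof.
intros H; unfold ps, CSeries; f_equal; apply Series_ext; intros n; now rewrite H.
Qed.

Lemma ps_at_0 (rho M : R) (a : nat -> C) : 0 <= rho -> bnd 2 rho M a -> ps a 0 = a 0%nat.
Proof.
intros Hr H; apply (ps_unique rho M); auto; [rewrite Cmod_0; exact Hr|].
apply is_Cseries_eq; induction N as [|N IH].
- rewrite Csum_0; simpl; ring.
- rewrite Csum_S, IH, Cpow_S; ring.
Qed.

Lemma ps_zero_coef (z : C) : ps (fun _ => RtoC 0) z = RtoC 0.
Proof.
apply (ps_unique (Cmod z) 0); [apply Cmod_ge_0 | | lra |].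
- intros n; rewrite Cmod_0; lra.
- apply (is_Cseries_ext (fun _ => RtoC 0)); [intros; ring|].
  apply is_Cseries_eq, Csum_zero.
Qed.

Lemma conv_lin (rho : R) (c : C) (a b : nat -> C) :
  0 <= rho -> conv rho a -> conv rho b -> conv rho (fun n => c * a n + b n)%C.
Proof.
intros Hr Ha Hb k; destruct (Ha k) as [M HM]; destruct (Hb k) as [M' HM'].
exists (Cmod c * M + M'); intros n; specialize (HM n); specialize (HM' n).
assert (P : 0 <= rho ^ n * (INR n + 1) ^ k).
{ apply Rmult_le_pos; apply pow_le; [assumption | pose proof (pos_INR n); lra]. }
pose proof (Cmod_triangle (c * a n) (b n)) as T; rewrite Cmod_mult in T.
pose proof (Cmod_ge_0 c).
apply (Rmult_le_compat_r _ _ _ P) in T.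
apply (Rmult_le_compat_l (Cmod c)) in HM; [|assumption].
rewrite Rmult_assoc; lra.
Qed.

Lemma ps_lin (rho : R) (c : C) (a b : nat -> C) (z : C) :
  0 <= rho -> conv rho a -> conv rho b -> Cmod z <= rho ->
  ps (fun n => c * a n + b n)%C z = (c * ps a z + ps b z)%C.
Proof.
intros Hr Ha Hb Hz.
destruct (Ha 2%nat) as [M HM]; destruct (Hb 2%nat) as [M' HM'].
destruct (conv_lin rho c a b Hr Ha Hb 2%nat) as [M2 HM2].
apply (ps_unique rho M2); auto.
apply (is_Cseries_ext (fun n => c * (a n * z ^ n) + b n * z ^ n)%C).
{ intros n; ring. }
apply is_Cseries_lin; eapply ps_correct; eassumption.
Qed.

(** * Differentiation expressed on coefficients *)

Definition Dcoef (a : nat -> C) (n : nat) : C := (RtoC (INR (S n)) * a (S n))%C.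

(* Coefficients of [- u ^ 2 * p'(u)], which is the derivative of [p (1 / z)]
   expressed in the variable [u = 1 / z]. *)
Definition Ecoef (b : nat -> C) (n : nat) : C :=
  match n with O => RtoC 0 | S m => (- (RtoC (INR m) * b m))%C end.

(* Coefficients of [d/dt ps a (cis (sigma * t))]. *)
Definition Tcoef (sigma : R) (a : nat -> C) (n : nat) : C :=
  (Ci * RtoC (sigma * INR n) * a n)%C.

Lemma bnd_Dcoef (k : nat) (rho M : R) (a : nat -> C) :
  0 < rho -> bnd (S k) rho M a -> bnd k rho (M / rho) (Dcoef a).
Proof.
intros Hr H n; specialize (H (S n)).
unfold Dcoef; rewrite Cmod_mult, Cmod_R, Rabs_pos_eq by apply pos_INR.
apply (Rmult_le_reg_r rho); [assumption|].
replace (M / rho * rho) with M by (field; lra).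
eapply Rle_trans; [|exact H].
pose proof (pos_INR n); rewrite S_INR.
assert (0 <= Cmod (a (S n)) * rho ^ (S n))
  by (apply Rmult_le_pos; [apply Cmod_ge_0 | apply pow_le; lra]).
replace ((INR n + 1) * Cmod (a (S n)) * rho ^ n * (INR n + 1) ^ k * rho)
  with (Cmod (a (S n)) * rho ^ (S n) * (INR n + 1) ^ (S k)) by (simpl; ring).
apply Rmult_le_compat_l; [assumption|].
apply pow_incr; lra.
Qed.

Lemma conv_Dcoef (rho : R) (a : nat -> C) : 0 < rho -> conv rho a -> conv rho (Dcoef a).
Proof.
intros Hr H k; destruct (H (S k)) as [M HM]; eexists; now apply bnd_Dcoef, HM.
Qed.

(** The index moves up by one: [rho <= 1] absorbs the extra power of [rho], and
    [INR n + 2 <= 2 * (INR n + 1)] accounts for [2 ^ k]. One order of decay pays for the factor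
    [INR m]. *)
Lemma bnd_Ecoef (k : nat) (rho M : R) (b : nat -> C) :
  0 < rho <= 1 -> bnd (S k) rho M b -> bnd k rho (2 ^ k * M) (Ecoef b).
Proof.
intros Hr H [|n]; unfold Ecoef.
- rewrite Cmod_0, !Rmult_0_l; apply Rmult_le_pos; [apply pow_le; lra | eapply bnd_pos, H].
- specialize (H n).
  rewrite Cmod_opp, Cmod_mult, Cmod_R, Rabs_pos_eq by apply pos_INR.
  pose proof (pos_INR n); pose proof (Cmod_ge_0 (b n)); rewrite S_INR.
  assert (P : 0 <= rho ^ n) by (apply pow_le; lra).
  assert (Q : 0 <= (INR n + 1) ^ k) by (apply pow_le; lra).
  assert (B : (INR n + 1 + 1) ^ k <= 2 ^ k * (INR n + 1) ^ k).
  { rewrite <- Rpow_mult_distr; apply pow_incr; lra. }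
  apply Rle_trans with (2 ^ k * (Cmod (b n) * rho ^ n * (INR n + 1) ^ S k)).
  2: { apply Rmult_le_compat_l; [apply pow_le; lra | exact H]. }
  apply Rle_trans with ((INR n + 1) * Cmod (b n) * rho ^ n * (2 ^ k * (INR n + 1) ^ k)).
  + apply Rmult_le_compat; try lra.
    * repeat apply Rmult_le_pos; try lra; apply pow_le; lra.
    * apply pow_le; lra.
    * simpl; replace (INR n * Cmod (b n) * (rho * rho ^ n))
        with ((INR n * rho) * (Cmod (b n) * rho ^ n)) by ring.
      rewrite (Rmult_assoc (INR n + 1)); apply Rmult_le_compat_r; [now apply Rmult_le_pos | nra].
  + right; simpl; ring.
Qed.

Lemma conv_Ecoef (rho : R) (b : nat -> C) : 0 < rho <= 1 -> conv rho b -> conv rho (Ecoef b).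
Proof.
intros Hr H k; destruct (H (S k)) as [M HM]; eexists; now apply bnd_Ecoef, HM.
Qed.

Lemma bnd_Tcoef (k : nat) (rho M sigma : R) (a : nat -> C) :
  0 <= rho -> Rabs sigma <= 1 -> bnd (S k) rho M a -> bnd k rho M (Tcoef sigma a).
Proof.
intros Hr Hs H n; specialize (H n); eapply Rle_trans; [|exact H].
unfold Tcoef; rewrite !Cmod_mult, Cmod_Ci, Cmod_R, Rabs_mult, (Rabs_pos_eq (INR n)) by apply pos_INR.
pose proof (pos_INR n); pose proof (Cmod_ge_0 (a n)).
assert (0 <= Cmod (a n) * rho ^ n * (INR n + 1) ^ k).
{ repeat apply Rmult_le_pos; try lra; apply pow_le; lra. }
assert (Rabs sigma * INR n <= INR n + 1) by (pose proof (Rabs_pos sigma); nra).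
replace (Cmod (a n) * rho ^ n * (INR n + 1) ^ S k) with
  ((INR n + 1) * (Cmod (a n) * rho ^ n * (INR n + 1) ^ k)) by (simpl; ring).
replace (1 * (Rabs sigma * INR n) * Cmod (a n) * rho ^ n * (INR n + 1) ^ k) with
  ((Rabs sigma * INR n) * (Cmod (a n) * rho ^ n * (INR n + 1) ^ k)) by ring.
now apply Rmult_le_compat_r.
Qed.

Lemma conv_Tcoef (rho sigma : R) (a : nat -> C) :
  0 <= rho -> Rabs sigma <= 1 -> conv rho a -> conv rho (Tcoef sigma a).
Proof.
intros Hr Hs H k; destruct (H (S k)) as [M HM]; eexists; now apply bnd_Tcoef, HM.
Qed.

(** Induction on [n]: the remainder for [S n] is [w] times the one for [n], plus
    [n z^(n-1) (w - z)^2]. The factor [rho ^ 2] stands on the left so that no exponent [n - 2]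
    occurs. *)
Lemma pow_taylor (rho : R) (z w : C) (n : nat) :
  Cmod z <= rho -> Cmod w <= rho ->
  Cmod (w ^ n - z ^ n - RtoC (INR n) * z ^ pred n * (w - z)) * rho ^ 2
    <= INR n ^ 2 * rho ^ n * Cmod (w - z) ^ 2.
Proof.
intros Hz Hw.
assert (Hr : 0 <= rho) by (pose proof (Cmod_ge_0 z); lra).
induction n as [|n IH].
- simpl; replace (1 - 1 - 0 * 1 * (w - z))%C with (RtoC 0) by ring.
  rewrite Cmod_0; lra.
- set (T := (w ^ n - z ^ n - RtoC (INR n) * z ^ pred n * (w - z))%C) in *.
  replace (w ^ S n - z ^ S n - RtoC (INR (S n)) * z ^ pred (S n) * (w - z))%C
    with (w * T + RtoC (INR n) * z ^ pred n * ((w - z) * (w - z)))%C.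
  + set (d := Cmod (w - z)) in *.
    assert (Hd : 0 <= d) by apply Cmod_ge_0.
    eapply Rle_trans.
    { apply Rmult_le_compat_r; [nra | apply Cmod_triangle]. }
    rewrite !Cmod_mult, Cmod_pow, Cmod_R, Rabs_pos_eq by apply pos_INR; fold d.
    rewrite Rmult_plus_distr_r.
    pose proof (pos_INR n) as Hn.
    assert (P : 0 <= rho ^ n) by (now apply pow_le).
    assert (A : Cmod w * Cmod T * rho ^ 2 <= rho * (INR n ^ 2 * rho ^ n * d ^ 2)).
    { rewrite Rmult_assoc; apply Rmult_le_compat; try apply Cmod_ge_0; auto.
      apply Rmult_le_pos; [apply Cmod_ge_0 | nra]. }
    assert (B : INR n * Cmod z ^ pred n * (d * d) * rho ^ 2 <= INR n * rho ^ S n * (d * d)).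
    { destruct n as [|n]; [simpl; lra|].
      replace (INR (S n) * rho ^ S (S n) * (d * d)) with
        (INR (S n) * rho ^ n * (d * d) * rho ^ 2) by (simpl pow; ring).
      apply Rmult_le_compat_r; [nra|]; apply Rmult_le_compat_r; [nra|].
      apply Rmult_le_compat_l; [assumption|]; simpl.
      apply pow_incr; split; [apply Cmod_ge_0 | assumption]. }
    eapply Rle_trans; [apply Rplus_le_compat; [exact A | exact B]|].
    rewrite S_INR; simpl pow.
    replace (rho * (INR n * (INR n * 1) * rho ^ n * (d * (d * 1))) + INR n * (rho * rho ^ n) * (d * d))
      with ((INR n * INR n + INR n) * (rho * rho ^ n * (d * d))) by ring.
    replace ((INR n + 1) * ((INR n + 1) * 1) * (rho * rho ^ n) * (d * (d * 1)))
      with ((INR n + 1) * (INR n + 1) * (rho * rho ^ n * (d * d))) by ring.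
    apply Rmult_le_compat_r; [|nra].
    apply Rmult_le_pos; nra.
  + unfold T; rewrite S_INR, RtoC_plus, !Cpow_S; simpl pred.
    destruct n as [|n]; [simpl; ring|].
    simpl pred; rewrite !Cpow_S; ring.
Qed.

Lemma is_Cseries_incr (a : nat -> C) (l : C) :
  a 0%nat = RtoC 0 -> is_Cseries (fun n => a (S n)) l -> is_Cseries a l.
Proof.
intros H0 H eps; destruct (H eps) as [N0 HN]; exists (S N0); intros N HNN.
destruct N as [|N]; [lia|].
replace (Csum a (S N)) with (Csum (fun n => a (S n)) N); [apply HN; lia|].
clear - H0; induction N as [|N IH].
- rewrite Csum_S, !Csum_0, H0; ring.
- rewrite (Csum_S _ (S N)), <- IH, Csum_S; reflexivity.
Qed.

(** Termwise [pow_taylor]. Of the four orders of decay, two absorb [INR n ^ 2] and two make the sum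
    converge. Both points may lie on the boundary circle. *)
Lemma ps_taylor (rho M : R) (a : nat -> C) (z w : C) :
  0 < rho -> bnd 4 rho M a -> Cmod z <= rho -> Cmod w <= rho ->
  Cmod (ps a w - ps a z - ps (Dcoef a) z * (w - z)) <= 2 * (M / rho ^ 2 * Cmod (w - z) ^ 2).
Proof.
intros Hr H Hz Hw.
assert (H2 : bnd 2 rho M a) by (apply (bnd_le 2 4); auto; lra).
assert (HD : bnd 2 rho (M / rho) (Dcoef a))
  by (apply bnd_Dcoef; auto; apply (bnd_le 3 4); auto; lra).
assert (S1 := ps_correct rho M a w (Rlt_le _ _ Hr) H2 Hw).
assert (S2 := ps_correct rho M a z (Rlt_le _ _ Hr) H2 Hz).
assert (S3 := ps_correct rho _ _ z (Rlt_le _ _ Hr) HD Hz).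
assert (S4 : is_Cseries (fun n => RtoC (INR n) * a n * z ^ pred n)%C (ps (Dcoef a) z)).
{ apply is_Cseries_incr; [simpl; ring|].
  revert S3; apply is_Cseries_ext; intros n; reflexivity. }
apply is_Cseries_bound with
  (fun n => a n * (w ^ n - z ^ n - RtoC (INR n) * z ^ pred n * (w - z)))%C.
- intros n; rewrite Cmod_mult.
  assert (T := pow_taylor rho z w n Hz Hw).
  set (X := Cmod (w ^ n - _ - _)) in *.
  set (d := Cmod (w - z)) in *.
  pose proof (Cmod_ge_0 (a n)); pose proof (pos_INR n).
  specialize (H n).
  assert (P : 0 < rho ^ 2) by (now apply pow_lt).
  apply (Rmult_le_reg_r (rho ^ 2)); [assumption|].
  replace (M / rho ^ 2 * d ^ 2 * tele n * rho ^ 2) with (M * tele n * d ^ 2)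
    by (field; lra).
  apply Rle_trans with (Cmod (a n) * rho ^ n * INR n ^ 2 * d ^ 2).
  + rewrite Rmult_assoc.
    apply (Rmult_le_compat_l (Cmod (a n))) in T; [|assumption]; lra.
  + apply Rmult_le_compat_r; [apply pow2_ge_0|].
    apply Rle_trans with (M * / (INR n + 1) ^ 2).
    2: { apply Rmult_le_compat_l; [eapply bnd_pos, H2 | apply inv_sqr_le_tele]. }
    apply (Rmult_le_reg_r ((INR n + 1) ^ 2)); [apply pow_lt; lra|].
    rewrite (Rmult_assoc M), Rinv_l, Rmult_1_r by (apply pow_nonzero; lra).
    eapply Rle_trans; [|exact H].
    replace ((INR n + 1) ^ 4) with ((INR n + 1) ^ 2 * (INR n + 1) ^ 2) by ring.
    rewrite <- Rmult_assoc; apply Rmult_le_compat_r; [apply pow_le; lra|].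
    apply Rmult_le_compat_l; [|apply pow_incr; lra].
    apply Rmult_le_pos; [assumption | apply pow_le; lra].
- apply (is_Cseries_ext (fun n => - (w - z) * (RtoC (INR n) * a n * z ^ pred n)
           + ((- (1)) * (a n * z ^ n) + a n * w ^ n))%C).
  { intros n; ring. }
  replace (ps a w - ps a z - ps (Dcoef a) z * (w - z))%C with
    (- (w - z) * ps (Dcoef a) z + ((- (1)) * ps a z + ps a w))%C by ring.
  apply is_Cseries_lin; [exact S4|]; now apply is_Cseries_lin.
Qed.

(** Differentiability relative to the closed disc, in the form that [is_RC_derive_chain_within]
    takes. *)
Lemma ps_derive_within (rho : R) (a : nat -> C) (z : C) (eps : posreal) :
  0 < rho -> conv rho a -> Cmod z <= rho ->
  exists d : posreal, forall w, Cmod w <= rho -> Cmod (w - z) < d ->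
    Cmod (ps a w - ps a z - ps (Dcoef a) z * (w - z)) <= eps * Cmod (w - z).
Proof.
intros Hr H Hz; destruct (H 4%nat) as [M HM].
assert (PM := bnd_pos _ _ _ _ HM).
assert (Pr : 0 < rho ^ 2) by (now apply pow_lt).
set (K := 2 * (M / rho ^ 2)).
assert (HK : 0 <= K).
{ unfold K; apply Rmult_le_pos; [lra|]; now apply Rdiv_le_0_compat. }
assert (Hd : 0 < eps / (K + 1)) by (apply Rdiv_lt_0_compat; [apply cond_pos | lra]).
exists (mkposreal _ Hd); simpl; intros w Hw Hwz.
eapply Rle_trans; [now apply (ps_taylor rho M)|].
set (x := Cmod (w - z)) in *.
assert (0 <= x) by apply Cmod_ge_0.
assert (E : (K + 1) * (eps / (K + 1)) = eps) by (field; lra).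
replace (2 * (M / rho ^ 2 * x ^ 2)) with (K * x * x) by (unfold K; ring).
apply Rmult_le_compat_r; [assumption|].
apply Rle_trans with ((K + 1) * x); [lra|].
rewrite <- E; apply Rmult_le_compat_l; lra.
Qed.

Lemma ps_derive (rho : R) (a : nat -> C) (z : C) :
  conv rho a -> Cmod z < rho -> is_C_derive (ps a) z (ps (Dcoef a) z).
Proof.
intros H Hz; pose proof (Cmod_ge_0 z) as Hz0.
apply is_C_derive_iff; intros eps.
destruct (ps_derive_within rho a z eps) as [d Hd]; [lra | assumption | lra |].
assert (Hm : 0 < Rmin d (rho - Cmod z)).
{ apply Rmin_pos; [apply cond_pos | lra]. }
exists (mkposreal _ Hm); simpl; intros w Hw; apply Hd.
- pose proof (Cmod_triangle_minus w z); pose proof (Rmin_r d (rho - Cmod z)); lra.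
- eapply Rlt_le_trans; [exact Hw | apply Rmin_l].
Qed.

(** From [ps_taylor]: one of the two factors [Cmod (w - z)] of the remainder is at most
    [2 * rho]. *)
Lemma ps_lipschitz (rho : R) (a : nat -> C) :
  0 < rho -> conv rho a -> exists K, 0 <= K /\
  forall z w, Cmod z <= rho -> Cmod w <= rho ->
    Cmod (ps a w - ps a z) <= K * Cmod (w - z).
Proof.
intros Hr H; destruct (H 4%nat) as [M HM].
assert (PM := bnd_pos _ _ _ _ HM).
assert (Pr : 0 < rho ^ 2) by (now apply pow_lt).
assert (P1 : 0 <= M / rho) by (now apply Rdiv_le_0_compat).
assert (P2 : 0 <= M / rho ^ 2) by (now apply Rdiv_le_0_compat).
exists (2 * (M / rho ^ 2) * (2 * rho) + 2 * (M / rho)); split; [nra|]; intros z w Hz Hw.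
assert (T := ps_taylor rho M a z w Hr HM Hz Hw).
assert (B : Cmod (ps (Dcoef a) z) <= 2 * (M / rho)).
{ apply (Cmod_ps_le rho); [lra | | assumption].
  apply bnd_Dcoef; auto; apply (bnd_le 3 4); auto; lra. }
set (x := Cmod (w - z)) in *.
assert (Hx : 0 <= x <= 2 * rho).
{ split; [apply Cmod_ge_0|]; unfold x.
  eapply Rle_trans; [apply Cmod_triangle|]; rewrite Cmod_opp; lra. }
pose proof (Cmod_triangle_minus (ps a w - ps a z) (ps (Dcoef a) z * (w - z))) as Q.
rewrite Cmod_mult in Q; fold x in Q.
assert (M / rho ^ 2 * x ^ 2 <= M / rho ^ 2 * (2 * rho * x))
  by (apply Rmult_le_compat_l; [assumption | nra]).
assert (Cmod (ps (Dcoef a) z) * x <= 2 * (M / rho) * x)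
  by (apply Rmult_le_compat_r; [apply Hx | assumption]).
lra.
Qed.

Lemma Cmod_Rcis (r t : R) : 0 <= r -> Cmod (RtoC r * cis t) = r.
Proof. intros H; rewrite Cmod_mult, Cmod_R, Cmod_cis, Rabs_pos_eq by assumption; ring. Qed.

Lemma ps_circle_continuous (rho r : R) (a : nat -> C) (t : R) :
  0 < rho -> conv rho a -> 0 <= r <= rho -> RC_continuous (fun t => ps a (RtoC r * cis t)) t.
Proof.
intros Hr H Hrr; destruct (ps_lipschitz rho a Hr H) as [K [HK L]].
apply RC_continuous_iff; intros eps.
assert (cc : RC_continuous (fun t => RtoC r * cis t)%C t)
  by (apply C_continuous_mult; [apply C_continuous_const | apply cis_continuous]).
rewrite RC_continuous_iff in cc.
pose proof (cond_pos eps).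
assert (P : 0 < eps / (K + 1)) by (apply Rdiv_lt_0_compat; lra).
destruct (cc (mkposreal _ P)) as [d Hd]; exists d; intros s Hs.
specialize (Hd s Hs); simpl in Hd.
eapply Rle_lt_trans; [apply L; rewrite Cmod_Rcis; lra|].
replace (pos eps) with ((K + 1) * (eps / (K + 1))) by (field; lra).
pose proof (Cmod_ge_0 (RtoC r * cis s - RtoC r * cis t)); nra.
Qed.

(** * Fourier coefficients of a power series on a circle *)

Lemma fc_Csum (c : nat -> C) (n : Z) (N : nat) :
  (forall t, RC_continuous (fun t => Csum (fun j => c j * expi (Z.of_nat j) t)%C N) t) /\
  fc (fun t => Csum (fun j => c j * expi (Z.of_nat j) t)%C N) n =
  Csum (fun j => c j * fc (fun _ => RtoC 1) (n - Z.of_nat j))%C N.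
Proof.
assert (T : forall j, (forall t, RC_continuous (fun t => c j * expi (Z.of_nat j) t)%C t) /\
  fc (fun t => c j * expi (Z.of_nat j) t)%C n = (c j * fc (fun _ => RtoC 1) (n - Z.of_nat j))%C).
{ intros j; split.
  - intros t; apply C_continuous_mult; [apply C_continuous_const | apply expi_continuous].
  - rewrite fc_scal by (intros; apply expi_continuous).
    rewrite <- fc_mult_expi; f_equal; apply fc_ext; intros; ring. }
induction N as [|N [IH1 IH2]].
- split.
  + intros t; apply (continuous_ext (fun t => c 0%nat * expi (Z.of_nat 0) t)%C).
    * intros s; now rewrite Csum_0.
    * apply T.
  + rewrite Csum_0, <- (proj2 (T 0%nat)); apply fc_ext; intros t; apply Csum_0.
- split.
  + intros t; eapply continuous_ext; [intros s; symmetry; apply Csum_S|].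
    apply C_continuous_plus; [apply IH1 | apply T].
  + rewrite Csum_S, <- IH2, <- (proj2 (T (S N))), <- fc_plus; [|apply IH1 | apply T].
    apply fc_ext; intros t; apply Csum_S.
Qed.

Lemma Csum_fc_1_nat (c : nat -> C) (n N : nat) :
  Csum (fun j => c j * fc (fun _ => RtoC 1) (Z.of_nat n - Z.of_nat j))%C N =
  if le_dec n N then (RtoC (2 * PI) * c n)%C else RtoC 0.
Proof.
induction N as [|N IH].
- rewrite Csum_0, fc_1.
  destruct (Z.eq_dec (Z.of_nat n - Z.of_nat 0) 0), (le_dec n 0); try lia; try ring.
  replace n with 0%nat by lia; ring.
- rewrite Csum_S, IH, fc_1.
  destruct (Z.eq_dec (Z.of_nat n - Z.of_nat (S N)) 0), (le_dec n N), (le_dec n (S N));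
    try lia; try ring.
  replace n with (S N) by lia; ring.
Qed.

Lemma Csum_fc_1_neg (c : nat -> C) (n : Z) (N : nat) : (n < 0)%Z ->
  Csum (fun j => c j * fc (fun _ => RtoC 1) (n - Z.of_nat j))%C N = RtoC 0.
Proof.
intros Hn; induction N as [|N IH].
- rewrite Csum_0, fc_1; destruct (Z.eq_dec (n - Z.of_nat 0) 0); [lia | ring].
- rewrite Csum_S, IH, fc_1; destruct (Z.eq_dec (n - Z.of_nat (S N)) 0); [lia | ring].
Qed.

(** The tail of the series is bounded uniformly on the circle, so integration commutes with
    summation up to an error of order [1 / N]. The partial sum on the right is eventually constant
    in [N], which determines the coefficient exactly. *)
Lemma fc_ps_approx (rho : R) (a : nat -> C) (n : Z) :
  0 < rho -> conv rho a -> exists K, forall N : nat,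
  Cmod (fc (fun t => ps a (RtoC rho * cis t)) n -
        Csum (fun j => (a j * RtoC rho ^ j) * fc (fun _ => RtoC 1) (n - Z.of_nat j)) N)%C
    <= K * / (INR N + 1).
Proof.
intros Hr H; destruct (H 2%nat) as [M HM].
exists (2 * PI * (2 * M)); intros N.
destruct (fc_Csum (fun j => a j * RtoC rho ^ j)%C n N) as [cS <-].
assert (cP : forall t, RC_continuous (fun t => ps a (RtoC rho * cis t)) t)
  by (intros t; apply (ps_circle_continuous rho rho); auto; lra).
rewrite <- fc_minus by assumption.
rewrite Rmult_assoc; apply Cmod_fc_le.
- intros t; apply (continuous_minus (V := C_R_NormedModule)); [apply cP | apply cS].
- intros t _.
  assert (Hz : Cmod (RtoC rho * cis t) <= rho) by (rewrite Cmod_Rcis; lra).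
  eapply Rle_trans; [|apply (is_Cseries_tail (fun j => a j * (RtoC rho * cis t) ^ j)%C (ps a (RtoC rho * cis t)) M N)].
  + rewrite (Csum_ext (fun j => a j * (RtoC rho * cis t) ^ j)%C
      (fun j => a j * RtoC rho ^ j * expi (Z.of_nat j) t)%C); [lra | intros j].
    rewrite Cpow_mult_l, expi_of_nat; ring.
  + apply (ps_term_le rho); auto; lra.
  + apply (ps_correct rho M); auto; lra.
Qed.

Lemma eq_of_le_inv_INR (z w : C) (K : R) (N0 : nat) :
  (forall N, (N0 <= N)%nat -> Cmod (z - w) <= K * / (INR N + 1)) -> z = w.
Proof.
intros H; apply (Cmod_eq_of_le _ _ (Rabs K)); intros eps.
destruct (archimed_cor1 eps (cond_pos eps)) as [N [HN PN]].
specialize (H (N0 + N)%nat ltac:(lia)).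
assert (P : 0 < INR N) by (now apply lt_0_INR).
assert (B : / (INR (N0 + N) + 1) <= eps).
{ apply Rle_trans with (/ INR N); [|lra].
  apply Rinv_le_contravar; [assumption|]; rewrite plus_INR; pose proof (pos_INR N0); lra. }
assert (0 <= / (INR (N0 + N) + 1)).
{ apply Rlt_le, Rinv_0_lt_compat; pose proof (pos_INR (N0 + N)); lra. }
eapply Rle_trans; [exact H|].
apply Rle_trans with (Rabs K * / (INR (N0 + N) + 1)).
- apply Rmult_le_compat_r; [assumption | apply Rle_abs].
- apply Rmult_le_compat_l; [apply Rabs_pos | assumption].
Qed.

Lemma fc_ps_nat (rho : R) (a : nat -> C) (n : nat) :
  0 < rho -> conv rho a ->
  fc (fun t => ps a (RtoC rho * cis t)) (Z.of_nat n) = (RtoC (2 * PI) * (a n * RtoC rho ^ n))%C.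
Proof.
intros Hr H; destruct (fc_ps_approx rho a (Z.of_nat n) Hr H) as [K HK].
apply (eq_of_le_inv_INR _ _ K n); intros N HN.
specialize (HK N); rewrite (Csum_fc_1_nat (fun j => a j * RtoC rho ^ j)%C) in HK.
destruct (le_dec n N); [exact HK | lia].
Qed.

Lemma fc_ps_neg (rho : R) (a : nat -> C) (n : Z) :
  0 < rho -> conv rho a -> (n < 0)%Z ->
  fc (fun t => ps a (RtoC rho * cis t)) n = RtoC 0.
Proof.
intros Hr H Hn; destruct (fc_ps_approx rho a n Hr H) as [K HK].
apply (eq_of_le_inv_INR _ _ K 0); intros N HN.
specialize (HK N); rewrite (Csum_fc_1_neg (fun j => a j * RtoC rho ^ j)%C) in HK by assumption.
exact HK.
Qed.

Lemma cauchy_estimate (rho M : R) (a : nat -> C) (n : nat) :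
  0 < rho -> conv rho a -> (forall z, Cmod z = rho -> Cmod (ps a z) <= M) ->
  Cmod (a n) * rho ^ n <= M.
Proof.
intros Hr H HM; pose proof two_PI_pos as HP.
assert (B := Cmod_fc_le (fun t => ps a (RtoC rho * cis t)) (Z.of_nat n) M).
rewrite fc_ps_nat, !Cmod_mult, Cmod_pow, !Cmod_R, !Rabs_pos_eq in B by (auto; lra).
apply (Rmult_le_reg_l (2 * PI)); [assumption|]; apply B.
- intros t; apply (ps_circle_continuous rho rho); auto; lra.
- intros t _; apply HM, Cmod_Rcis; lra.
Qed.

(** The curve runs on the boundary of the disc, hence the chain rule relative to the closed disc.
    The values [1] and [-1] of [sigma] serve the two halves of a Laurent series. *)
Lemma ps_circle_derive (sigma : R) (a : nat -> C) (t : R) :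
  conv 1 a -> Rabs sigma <= 1 ->
  is_RC_derive (fun t => ps a (cis (sigma * t))) t (ps (Tcoef sigma a) (cis (sigma * t))).
Proof.
intros H Hs; set (z := cis (sigma * t)).
assert (Hz : Cmod z <= 1) by (unfold z; rewrite Cmod_cis; lra).
eapply is_RC_derive_eq.
- apply (is_RC_derive_chain_within (fun w => Cmod w <= 1) (ps a) (fun t => cis (sigma * t))
    t (ps (Dcoef a) z)).
  + intros eps; apply ps_derive_within; auto; lra.
  + intros s; rewrite Cmod_cis; lra.
  + apply cis_derive.
- fold z; destruct (conv_Tcoef 1 sigma a ltac:(lra) Hs H 2%nat) as [M HM].
  destruct (conv_Dcoef 1 a ltac:(lra) H 2%nat) as [M' HM'].
  symmetry; apply (ps_unique 1 M); auto; [lra|].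
  apply is_Cseries_incr; [unfold Tcoef; simpl; rewrite Rmult_0_r; ring|].
  apply (is_Cseries_ext (fun n => (Ci * RtoC sigma * z) * (Dcoef a n * z ^ n) + 0)%C).
  { intros n; unfold Tcoef, Dcoef; rewrite RtoC_mult, Cpow_S; ring. }
  replace (ps (Dcoef a) z * (Ci * sigma * z))%C with
    ((Ci * RtoC sigma * z) * ps (Dcoef a) z + 0)%C by ring.
  apply (is_Cseries_lin _ _ (fun _ => RtoC 0)).
  + apply (ps_correct 1 M'); auto; lra.
  + apply is_Cseries_eq, Csum_zero.
Qed.

(** * Power series expansion on a punctured disc *)

(** Continuity of [dp] is what differentiation under the integral sign asks for. The centre is left
    out because there [z -> 1/z] brings in the point at infinity. *)
Definition C1_punctured (p dp : C -> C) : Prop :=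
  forall u, 0 < Cmod u < 1 ->
    is_C_derive p u (dp u) /\ @continuous C_UniformSpace C_UniformSpace dp u.

Lemma ray_derive (c : C) (r : R) : is_RC_derive (fun r => RtoC r * c)%C r c.
Proof.
apply is_RC_derive_comp_iff; split; simpl; auto_derive; auto; unfold Re, Im; ring.
Qed.

Lemma arc_derive (r t : R) : is_RC_derive (fun t => RtoC r * cis t)%C t (Ci * (RtoC r * cis t))%C.
Proof.
apply is_RC_derive_comp_iff; split; simpl; auto_derive; auto; ring.
Qed.

Lemma polar_continuous (r t : R) :
  @continuous (prod_UniformSpace R_UniformSpace R_UniformSpace) C_UniformSpace
    (fun q => RtoC (fst q) * cis (snd q))%C (r, t).
Proof.
apply C_continuous_mult.
- apply C_continuous_comp_iff; split; simpl.
  + apply (continuous_fst r t).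
  + apply continuous_const.
- apply (continuous_comp snd cis); [apply continuous_snd | apply cis_continuous].
Qed.

Lemma continuous_C_continuous_R (p : C -> C) (G : R -> C) (t : R) :
  RC_continuous G t -> @continuous C_UniformSpace C_UniformSpace p (G t) ->
  RC_continuous (fun t => p (G t)) t.
Proof. intros; now apply (continuous_comp G p). Qed.

Section Punctured.

Variables (p dp : C -> C).
Hypothesis Hp : C1_punctured p dp.

Lemma Cmod_polar_bounds (r t : R) : 0 < r < 1 -> 0 < Cmod (RtoC r * cis t) < 1.
Proof. intros H; rewrite Cmod_Rcis; lra. Qed.

Lemma circle_derive (r t : R) : 0 < r < 1 ->
  is_RC_derive (fun t => p (RtoC r * cis t)) t
    (dp (RtoC r * cis t) * (Ci * (RtoC r * cis t)))%C.
Proof.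
intros Hr.
apply (is_RC_derive_chain p (fun t => RtoC r * cis t)%C).
- apply Hp, Cmod_polar_bounds, Hr.
- apply arc_derive.
Qed.

Lemma circle_continuous (r t : R) : 0 < r < 1 -> RC_continuous (fun t => p (RtoC r * cis t)) t.
Proof. intros Hr; eapply is_RC_derive_continuous, circle_derive, Hr. Qed.

Lemma arc_continuous (r t : R) : RC_continuous (fun t => RtoC r * cis t)%C t.
Proof. eapply is_RC_derive_continuous, arc_derive. Qed.

Lemma circle_dp_continuous (r t : R) : 0 < r < 1 ->
  RC_continuous (fun t => dp (RtoC r * cis t)) t.
Proof.
intros Hr; apply (continuous_C_continuous_R dp (fun t => RtoC r * cis t)%C).
- apply arc_continuous.
- apply Hp, Cmod_polar_bounds, Hr.
Qed.

Definition circle_fc (r : R) (n : Z) : C := fc (fun t => p (RtoC r * cis t)) n.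

Lemma locally_unit_interval (r : R) : 0 < r < 1 -> locally r (fun u => 0 < u < 1).
Proof.
intros Hr; apply (open_and (fun u => 0 < u) (fun u => u < 1));
  [apply open_gt | apply open_lt | exact Hr].
Qed.

(** The parametric integral is differentiated for real-valued integrands; [L] treats the real and
    the imaginary part at once. *)
Lemma derive_RInt_circle (L : C -> R) (n : Z) (r : R) :
  L = Re \/ L = Im -> 0 < r < 1 ->
  is_derive (fun r => RInt (fun t => L (p (RtoC r * cis t) * expi (- n) t)%C) 0 (2 * PI)) r
    (RInt (fun t => L (dp (RtoC r * cis t) * cis t * expi (- n) t)%C) 0 (2 * PI)).
Proof.
intros HL Hr.
assert (DL : forall F x l, is_RC_derive F x l -> is_derive (fun s => L (F s)) x (L l)).
{ intros F x l H; apply is_RC_derive_comp_iff in H; destruct HL as [-> | ->]; apply H. }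
assert (CL : forall (U : UniformSpace) (F : U -> C) x,
  @continuous U C_UniformSpace F x -> continuous (fun s => L (F s)) x).
{ intros U F x H; apply C_continuous_comp_iff in H; destruct HL as [-> | ->]; apply H. }
set (f := fun u t => L (p (RtoC u * cis t) * expi (- n) t)%C).
set (g := fun u t => L (dp (RtoC u * cis t) * cis t * expi (- n) t)%C).
assert (Df : forall u t, 0 < u < 1 -> is_derive (fun u => f u t) u (g u t)).
{ intros u t Hu; apply DL; eapply is_RC_derive_eq.
  - apply is_RC_derive_mult; [|apply is_RC_derive_const].
    apply (is_RC_derive_chain p (fun u => RtoC u * cis t)%C).
    + apply Hp, Cmod_polar_bounds, Hu.
    + apply ray_derive.
  - cbv beta; ring. }
assert (LI := locally_unit_interval r Hr).
replace (RInt _ 0 (2 * PI)) with (RInt (fun t => Derive (fun u => f u t) r) 0 (2 * PI)).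
- apply is_derive_RInt_param.
  + revert LI; apply filter_imp; intros u Hu t _; eexists; now apply Df.
  + intros t _.
    apply (continuity_2d_pt_ext_loc g).
    * destruct LI as [d Hd]; exists d; intros u v Hu _; symmetry.
      apply is_derive_unique, Df, Hd, Hu.
    * apply continuity_2d_pt_filterlim; unfold g.
      change (continuous (fun q : R * R => L (dp (RtoC (fst q) * cis (snd q)) * cis (snd q) * expi (- n) (snd q))%C) (r, t)).
      apply CL.
      apply C_continuous_mult; [apply C_continuous_mult|].
      -- apply (continuous_comp (fun q : R * R => RtoC (fst q) * cis (snd q))%C dp).
         ++ apply polar_continuous.
         ++ apply Hp, Cmod_polar_bounds, Hr.
      -- apply (continuous_comp snd cis); [apply continuous_snd | apply cis_continuous].
      -- apply (continuous_comp snd (expi (- n))); [apply continuous_snd | apply expi_continuous].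
  + revert LI; apply filter_imp; intros u Hu.
    apply (ex_RInt_continuous (V := R_CompleteNormedModule)); intros t _; apply CL.
    apply C_continuous_mult; [now apply circle_continuous | apply expi_continuous].
- apply RInt_ext; intros t _; apply is_derive_unique, Df, Hr.
Qed.

(** The Cauchy-Riemann equations in polar form: the angular derivative of [p] is [Ci * r] times the
    radial one. Its Fourier coefficient is also [Ci * n] times that of [p], whence the equation
    [c' = (n / r) c] in the radius. *)
Lemma circle_fc_derive (n : Z) (r : R) : 0 < r < 1 ->
  is_RC_derive (fun r => circle_fc r n) r (RtoC (IZR n / r) * circle_fc r n)%C.
Proof.
intros Hr.
assert (E : forall u, 0 < u < 1 -> circle_fc u n =
  (RInt (fun t => Re (p (RtoC u * cis t) * expi (- n) t)) 0 (2 * PI),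
   RInt (fun t => Im (p (RtoC u * cis t) * expi (- n) t)) 0 (2 * PI))).
{ intros u Hu; apply CInt_comp; intros t.
  apply C_continuous_mult; [now apply circle_continuous | apply expi_continuous]. }
assert (cD : forall t, RC_continuous (fun t => dp (RtoC r * cis t) * cis t)%C t).
{ intros t; apply C_continuous_mult; [now apply circle_dp_continuous | apply cis_continuous]. }
(* The coefficient of the radial derivative, obtained from that of the angular derivative by
   division by [Ci * r]. *)
assert (V : fc (fun t => dp (RtoC r * cis t) * cis t)%C n = (RtoC (IZR n / r) * circle_fc r n)%C).
{ assert (H : fc (fun t => dp (RtoC r * cis t) * (Ci * (RtoC r * cis t)))%C n
    = (Ci * RtoC (IZR n) * circle_fc r n)%C).
  { apply fc_derive.
    - intros t; now apply circle_derive.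
    - intros t; apply C_continuous_mult; [now apply circle_dp_continuous|].
      apply C_continuous_mult; [apply C_continuous_const | apply arc_continuous].
    - intros t; now rewrite cis_periodic. }
  rewrite (fc_ext _ (fun t => Ci * RtoC r * (dp (RtoC r * cis t) * cis t))%C) in H
    by (intros; ring).
  rewrite fc_scal in H by exact cD.
  assert (Nr : RtoC r <> RtoC 0) by (intros X; apply RtoC_inj in X; lra).
  assert (N : (Ci * RtoC r)%C <> RtoC 0) by (apply Cmult_neq_0; [apply Ci_nz | exact Nr]).
  set (v := fc _ n) in *.
  replace v with (/ (Ci * RtoC r) * (Ci * RtoC r * v))%C
    by (field; split; [exact Nr | apply Ci_nz]).
  rewrite H, RtoC_div by lra; field; split; [exact Nr | apply Ci_nz]. }
rewrite <- V; unfold fc; rewrite CInt_comp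
  by (intros t; apply C_continuous_mult; [apply cD | apply expi_continuous]).
apply (is_derive_ext_loc (V := C_R_NormedModule) (fun u =>
  (RInt (fun t => Re (p (RtoC u * cis t) * expi (- n) t)) 0 (2 * PI),
   RInt (fun t => Im (p (RtoC u * cis t) * expi (- n) t)) 0 (2 * PI)))).
- generalize (locally_unit_interval r Hr); apply filter_imp; intros u Hu; symmetry; now apply E.
- apply is_RC_derive_comp_iff; split; simpl Re; simpl Im.
  + apply (derive_RInt_circle Re); auto.
  + apply (derive_RInt_circle Im); auto.
Qed.

(** The factor [r^(-n)] is the integrating factor of the equation of [circle_fc_derive], so the
    product has derivative zero. [Rpower] covers both signs of [n]. *)
Lemma circle_fc_radial (n : Z) (r s : R) : 0 < r < 1 -> 0 < s < 1 ->
  (RtoC (Rpower r (- IZR n)) * circle_fc r n)%C = (RtoC (Rpower s (- IZR n)) * circle_fc s n)%C.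
Proof.
intros Hr Hs.
assert (D : forall u, 0 < u < 1 ->
  is_RC_derive (fun u => RtoC (Rpower u (- IZR n)) * circle_fc u n)%C u (RtoC 0)).
{ intros u Hu.
  assert (D1 : is_RC_derive (fun u => RtoC (Rpower u (- IZR n))) u
     (RtoC (- IZR n / u * Rpower u (- IZR n)))).
  { apply is_RC_derive_comp_iff; split; simpl.
    - unfold Rpower; auto_derive; [lra | field; lra].
    - apply (is_derive_const (V := R_NormedModule)). }
  eapply is_RC_derive_eq; [apply is_RC_derive_mult; [exact D1 | now apply circle_fc_derive]|].
  cbv beta; set (w := Rpower u (- IZR n)).
  unfold Rdiv; rewrite !RtoC_mult, RtoC_opp; ring. }
assert (K : forall a b, 0 < a < 1 -> 0 < b < 1 -> a < b ->
  (RtoC (Rpower a (- IZR n)) * circle_fc a n)%C = (RtoC (Rpower b (- IZR n)) * circle_fc b n)%C).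
{ intros a b Ha Hb Hab.
  apply (eq_is_derive (V := C_R_NormedModule)
    (fun u => RtoC (Rpower u (- IZR n)) * circle_fc u n)%C a b); [|exact Hab].
  intros t Ht; apply D; lra. }
destruct (Rtotal_order r s) as [H|[->|H]]; auto.
symmetry; auto.
Qed.

(** For [n < 0] the constant product of [circle_fc_radial] is a positive power of the radius times a
    coefficient that stays bounded near the centre; it is therefore arbitrarily small. *)
Lemma circle_fc_neg (r : R) (n : Z) (d M : R) :
  0 < d -> (forall u, 0 < Cmod u < d -> Cmod (p u) <= M) ->
  0 < r < 1 -> (n < 0)%Z -> circle_fc r n = RtoC 0.
Proof.
intros Hd HM Hr Hn.
assert (HM0 : 0 <= M).
{ eapply Rle_trans; [apply Cmod_ge_0 | apply (HM (RtoC (d / 2)))].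
  rewrite Cmod_R, Rabs_pos_eq; lra. }
set (A := Rpower r (- IZR n)).
assert (PA : 0 < A) by apply exp_pos.
pose proof two_PI_pos as HPI.
assert (HA : (RtoC A * circle_fc r n)%C = RtoC 0).
{ apply (Cmod_eq_of_le _ _ (2 * PI * M)); intros eps.
  replace (RtoC A * circle_fc r n - 0)%C with (RtoC A * circle_fc r n)%C by ring.
  pose proof (cond_pos eps) as He.
  (* [s <= d / 2] makes the bound [M] available on the circle of radius [s]; [s <= 1 / 2] gives
     [s^(-n) <= s], as [- n >= 1]; and [s <= eps] concludes. *)
  set (s := Rmin eps (Rmin (d / 2) (1 / 2))).
  assert (Hs : 0 < s /\ s <= eps /\ s <= d / 2 /\ s <= 1 / 2).
  { unfold s; split; [repeat apply Rmin_pos; lra|].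
    split; [apply Rmin_l|]; split; (eapply Rle_trans; [apply Rmin_r|]);
      [apply Rmin_l | apply Rmin_r]. }
  unfold A; rewrite (circle_fc_radial n r s) by lra.
  rewrite Cmod_mult, Cmod_R, Rabs_pos_eq by (apply Rlt_le, exp_pos).
  rewrite Rmult_comm; apply Rmult_le_compat; try apply Cmod_ge_0.
  - apply Rlt_le, exp_pos.
  - apply Cmod_fc_le.
    + intros t; apply circle_continuous; lra.
    + intros t _; apply HM; rewrite Cmod_Rcis; lra.
  - apply Rle_trans with s; [|lra].
    rewrite <- (Rpower_1 s) at 2 by lra.
    unfold Rpower; apply Rnot_lt_le; intros X; apply exp_lt_inv in X; revert X.
    apply Rle_not_lt.
    assert (ln s < 0) by (rewrite <- ln_1; apply ln_increasing; lra).
    assert (1 <= - IZR n) by (rewrite <- opp_IZR; apply IZR_le; lia).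
    nra. }
assert (N : RtoC A <> RtoC 0) by (intros X; apply RtoC_inj in X; lra).
replace (circle_fc r n) with (/ RtoC A * (RtoC A * circle_fc r n))%C by (field; exact N).
rewrite HA; ring.
Qed.

(** The coefficient is read off on the circle of radius [1 / 2], an arbitrary choice by
    [circle_fc_radial]; [2 ^ n] undoes the power of that radius. *)
Definition taylor_coef (n : nat) : C :=
  (RtoC (/ (2 * PI) * 2 ^ n) * circle_fc (1 / 2) (Z.of_nat n))%C.

Lemma circle_fc_nat (r : R) (n : nat) : 0 < r < 1 ->
  circle_fc r (Z.of_nat n) = (RtoC (2 * PI) * (taylor_coef n * RtoC r ^ n))%C.
Proof.
intros Hr; unfold taylor_coef.
assert (H := circle_fc_radial (Z.of_nat n) r (1 / 2) Hr ltac:(lra)).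
rewrite <- INR_IZR_INZ, !Rpower_Ropp, !Rpower_pow in H by lra.
replace (/ (1 / 2) ^ n) with (2 ^ n) in H.
2: { rewrite <- pow_inv; f_equal; lra. }
pose proof two_PI_pos.
assert (Pr : 0 < r ^ n) by (apply pow_lt; lra).
rewrite (RtoC_mult (/ (2 * PI))).
transitivity (RtoC (2 * PI) * (RtoC (/ (2 * PI)) * (RtoC (2 ^ n) * circle_fc (1 / 2) (Z.of_nat n)) * RtoC r ^ n))%C.
2: { ring. }
rewrite <- H, <- RtoC_pow.
transitivity ((RtoC (2 * PI) * RtoC (/ (2 * PI))) * (RtoC (/ r ^ n) * RtoC (r ^ n)) * circle_fc r (Z.of_nat n))%C.
2: { ring. }
rewrite <- !RtoC_mult, Rinv_r, Rinv_l, Rmult_1_l by lra; ring.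
Qed.

End Punctured.

Lemma RC_continuous_bounded (F : R -> C) (a b : R) : a <= b ->
  (forall t, RC_continuous F t) -> exists M, forall t, a <= t <= b -> Cmod (F t) <= M.
Proof.
intros Hab HF.
destruct (continuity_ab_maj (fun t => Cmod (F t)) a b Hab) as [m [Hm _]].
- intros t _; apply continuity_pt_filterlim.
  change (continuous (fun t => Cmod (F t)) t).
  apply (continuous_ext (fun t => @norm R_AbsRing C_R_NormedModule (F t))); [intros; apply norm_C_R|].
  apply (continuous_comp F (@norm R_AbsRing C_R_NormedModule)); [apply HF|].
  apply (filterlim_norm (V := C_R_NormedModule)).
- exists (Cmod (F m)); exact Hm.
Qed.

(** Induction on [k], writing [q = s * s]: one factor [s ^ n] absorbs a power of [INR n + 1], the
    other is left to the induction hypothesis. *)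
Lemma geometric_poly_bounded (k : nat) (q : R) : 0 <= q < 1 ->
  exists K, forall n, q ^ n * (INR n + 1) ^ k <= K.
Proof.
revert q; induction k as [|k IH]; intros q Hq.
- exists 1; intros n; rewrite pow_O, Rmult_1_r.
  rewrite <- (pow1 n); apply pow_incr; lra.
- set (s := sqrt q).
  assert (Hss : s * s = q) by (apply sqrt_sqrt; lra).
  assert (Hs : 0 <= s < 1).
  { split; [apply sqrt_pos|]; pose proof (sqrt_pos q); fold s in H; nra. }
  destruct (IH s Hs) as [K HK]; exists (K * / (1 - s)); intros n.
  (* This is [(n + 1) s^n <= 1 + s + ... + s^n], multiplied by [1 - s]. *)
  assert (B : (1 - s) * ((INR n + 1) * s ^ n) <= 1 - s ^ S n).
  { induction n as [|n IHn]; [simpl; lra|].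
    rewrite S_INR; simpl pow in *.
    assert (0 <= s ^ n <= 1).
    { split; [apply pow_le; lra | rewrite <- (pow1 n); apply pow_incr; lra]. }
    set (x := s ^ n) in *.
    apply (Rmult_le_compat_l s) in IHn; [|lra].
    assert (s * x * (1 - s) <= 1 * (1 - s)) by (apply Rmult_le_compat_r; nra).
    nra. }
  assert (0 <= s ^ S n) by (apply pow_le; lra).
  assert (B' : (INR n + 1) * s ^ n <= / (1 - s)).
  { apply (Rmult_le_reg_l (1 - s)); [lra|]; rewrite Rinv_r by lra; lra. }
  replace (q ^ n * (INR n + 1) ^ S k) with
    ((s ^ n * (INR n + 1) ^ k) * ((INR n + 1) * s ^ n))
    by (rewrite <- Hss, Rpow_mult_distr; simpl; ring).
  pose proof (pos_INR n).
  apply Rmult_le_compat; auto; apply Rmult_le_pos; try lra; apply pow_le; lra.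
Qed.

Lemma conv_of_bounded (r rho M : R) (a : nat -> C) :
  0 <= rho < r -> (forall n, Cmod (a n) * r ^ n <= M) -> conv rho a.
Proof.
intros Hr H k.
assert (Hq : 0 <= rho / r < 1).
{ split; [apply Rdiv_le_0_compat; lra|].
  apply (Rmult_lt_reg_r r); [lra|]; unfold Rdiv; rewrite Rmult_assoc, Rinv_l; lra. }
destruct (geometric_poly_bounded k _ Hq) as [K HK].
exists (M * K); intros n.
replace (Cmod (a n) * rho ^ n * (INR n + 1) ^ k) with
  ((Cmod (a n) * r ^ n) * ((rho / r) ^ n * (INR n + 1) ^ k)).
- pose proof (pos_INR n); apply Rmult_le_compat; auto.
  + apply Rmult_le_pos; [apply Cmod_ge_0 | apply pow_le; lra].
  + apply Rmult_le_pos; apply pow_le; lra.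
- unfold Rdiv; rewrite Rpow_mult_distr, pow_inv; field.
  apply pow_nonzero; lra.
Qed.

Lemma power_series_expansion (p dp : C -> C) (d M : R) :
  C1_punctured p dp -> 0 < d -> (forall u, 0 < Cmod u < d -> Cmod (p u) <= M) ->
  exists a, (forall rho, 0 <= rho < 1 -> conv rho a) /\
    forall u, 0 < Cmod u < 1 -> p u = ps a u.
Proof.
intros Hp Hd HM; exists (taylor_coef p).
pose proof two_PI_pos as HPI.
assert (HC : forall rho, 0 <= rho < 1 -> conv rho (taylor_coef p)).
{ intros rho Hr.
  (* On a circle strictly larger than [rho] boundedness of [p] suffices: the ratio [rho / r] beats
     every polynomial weight. *)
  set (r := (1 + rho) / 2); assert (Hr' : 0 < r < 1 /\ rho < r) by (unfold r; lra).
  assert (cF : forall t, RC_continuous (fun t => p (RtoC r * cis t)%C) t)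
    by (intros t; now apply (circle_continuous p dp Hp)).
  destruct (RC_continuous_bounded _ 0 (2 * PI) ltac:(lra) cF) as [K HK].
  apply (conv_of_bounded r rho K); [lra|]; intros n.
  assert (B : Cmod (circle_fc p r (Z.of_nat n)) <= 2 * PI * K) by (now apply Cmod_fc_le).
  rewrite (circle_fc_nat p dp Hp), !Cmod_mult, Cmod_pow, !Cmod_R, !Rabs_pos_eq in B by lra.
  apply (Rmult_le_reg_l (2 * PI)); lra. }
split; [exact HC|]; intros u Hu.
set (r := Cmod u) in *; destruct (cis_polar u) as [t Ht]; fold r in Ht.
assert (E : ps (taylor_coef p) u = p u); [|now symmetry].
destruct (HC r ltac:(lra) 2%nat) as [K HK].
apply (ps_unique r K); auto; [lra | unfold r; lra |].
intros eps.
assert (He : 0 < 2 * PI * eps) by (apply Rmult_lt_0_compat; [assumption | apply cond_pos]).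
(* Inversion is stated for functions on the unit circle, so [p] is rescaled to the circle through
   [u]. *)
destruct (fourier_inversion (fun w => p (RtoC r * w)%C) t
  (dp (RtoC r * cis t)%C * (Ci * (RtoC r * cis t)))%C (mkposreal _ He)) as [N0 HN].
{ intros s; now apply (circle_continuous p dp Hp). }
{ now apply circle_derive. }
exists N0; intros N HNN; specialize (HN N HNN); simpl in HN.
rewrite <- Ht in HN.
replace (Csum (fourier_term (fun t => p (RtoC r * cis t)%C) t) N) with
  (RtoC (2 * PI) * Csum (fun n => taylor_coef p n * u ^ n) N)%C in HN.
- replace (RtoC (2 * PI) * Csum (fun n => taylor_coef p n * u ^ n) N - RtoC (2 * PI) * p u)%C
    with (RtoC (2 * PI) * (Csum (fun n => taylor_coef p n * u ^ n) N - p u))%C in HN by ring.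
  rewrite Cmod_mult, Cmod_R, Rabs_pos_eq in HN by lra.
  apply (Rmult_le_reg_l (2 * PI)); lra.
- assert (T : forall n, fourier_term (fun t => p (RtoC r * cis t)%C) t n =
    (RtoC (2 * PI) * (taylor_coef p n * u ^ n) + 0)%C).
  { intros n.
    assert (E : (circle_fc p r (Z.of_nat n) * expi (Z.of_nat n) t = RtoC (2 * PI) * (taylor_coef p n * u ^ n))%C).
    { rewrite (circle_fc_nat p dp Hp), expi_of_nat by assumption.
      rewrite Ht, Cpow_mult_l; ring. }
    destruct n as [|n]; unfold fourier_term.
    - rewrite expi_0, Cmult_1_r in E; unfold circle_fc in E; rewrite <- E; simpl Z.of_nat; ring.
    - fold (circle_fc p r (Z.of_nat (S n))); fold (circle_fc p r (- Z.of_nat (S n))).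
      rewrite E, (circle_fc_neg p dp Hp r _ d M); auto; [ring | lia]. }
  rewrite (Csum_ext _ _ N T), Csum_lin.
  rewrite Csum_zero; ring.
Qed.

(** * Coefficients of the elements of the two spaces *)

Lemma continuous_on_iff (K : C -> Prop) (f : C -> C) :
  @continuous_on C_UniformSpace C_UniformSpace K f <->
  forall z, K z -> forall eps : posreal, exists d : posreal, forall w, K w ->
    Cmod (w - z) < d -> Cmod (f w - f z) < eps.
Proof.
split.
- intros H z Kz eps.
  assert (L : @locally C_UniformSpace (f z) (fun y => Cmod (y - f z) < eps))
    by (apply C_locally_iff; exists eps; auto).
  specialize (H z Kz _ L); apply C_locally_iff in H; destruct H as [d Hd].
  exists d; intros w Kw Hw; now apply Hd.
- intros H z Kz P HP; apply C_locally_iff in HP; destruct HP as [eps He].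
  destruct (H z Kz eps) as [d Hd].
  apply C_locally_iff; exists d; intros w Hw Kw; apply He, Hd; assumption.
Qed.

Lemma C_continuous_iff (f : C -> C) (z : C) :
  @continuous C_UniformSpace C_UniformSpace f z <->
  forall eps : posreal, exists d : posreal, forall w,
    Cmod (w - z) < d -> Cmod (f w - f z) < eps.
Proof.
split.
- intros H eps.
  assert (L : @locally C_UniformSpace (f z) (fun y => Cmod (y - f z) < eps))
    by (apply C_locally_iff; exists eps; auto).
  specialize (H _ L); apply C_locally_iff in H; exact H.
- intros H P HP; apply C_locally_iff in HP; destruct HP as [eps He].
  destruct (H eps) as [d Hd].
  apply C_locally_iff; exists d; intros w Hw; apply He, Hd; assumption.
Qed.

(** A gauge argument: closedness of [K] is given as a positive distance from each outer point, and
    the gauge [delta z] is both a radius and, through [/ delta z + 1], a bound for [f] within that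
    radius. Compactness of the square gives one [d] below the gauge at a suitable centre near each
    point. *)
Lemma compact_bounded (K : C -> Prop) (f : C -> C) (B : R) :
  (forall z, K z -> Cmod z <= B) ->
  (forall z, ~ K z -> exists d : posreal, forall w, K w -> d <= Cmod (w - z)) ->
  @continuous_on C_UniformSpace C_UniformSpace K f ->
  exists M, forall z, K z -> Cmod (f z) <= M.
Proof.
intros HB Hcl Hf; rewrite continuous_on_iff in Hf.
assert (S2 := Rlt_sqrt2_0).
(* Off [K] the radius is so small that no point of [K] is met and the bound holds vacuously. The
   factor [sqrt 2] accounts for the squares in which compactness is phrased. *)
assert (D : forall z, exists d : posreal,
  forall w, K w -> Cmod (w - z) < sqrt 2 * d -> Cmod (f w) <= / d + 1).
{ intros z; destruct (classic (K z)) as [Kz|NK].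
  - destruct (Hf z Kz (mkposreal 1 Rlt_0_1)) as [d0 Hd0]; simpl in Hd0.
    set (d := Rmin (d0 / sqrt 2) (/ (Cmod (f z) + 1))).
    pose proof (Cmod_ge_0 (f z)) as P0.
    assert (Pd : 0 < d).
    { apply Rmin_pos; [apply Rdiv_lt_0_compat; [apply cond_pos | assumption]
                      | apply Rinv_0_lt_compat; lra]. }
    exists (mkposreal d Pd); simpl; intros w Kw Hw.
    assert (A1 : sqrt 2 * d <= d0).
    { apply Rle_trans with (sqrt 2 * (d0 / sqrt 2)).
      - apply Rmult_le_compat_l; [lra | apply Rmin_l].
      - right; field; lra. }
    assert (A2 : Cmod (f z) + 1 <= / d).
    { rewrite <- (Rinv_inv (Cmod (f z) + 1)); apply Rinv_le_contravar; [assumption | apply Rmin_r]. }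
    specialize (Hd0 w Kw ltac:(lra)).
    pose proof (Cmod_triangle_minus (f w) (f z)); lra.
  - destruct (Hcl z NK) as [d0 Hd0].
    assert (Pd : 0 < d0 / sqrt 2) by (apply Rdiv_lt_0_compat; [apply cond_pos | assumption]).
    exists (mkposreal _ Pd); simpl; intros w Kw Hw; specialize (Hd0 w Kw).
    replace (sqrt 2 * (d0 / sqrt 2)) with (pos d0) in Hw by (field; lra); lra. }
set (delta := fun z => proj1_sig (constructive_indefinite_description _ (D z))).
assert (Hdelta : forall z w, K w -> Cmod (w - z) < sqrt 2 * delta z -> Cmod (f w) <= / delta z + 1)
  by (intros z; apply (proj2_sig (constructive_indefinite_description _ (D z)))).
clearbody delta.
destruct (compactness_value_2d (- B) B (- B) B (fun x y => delta (x, y))) as [d Hd].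
exists (/ d + 1); intros z Kz; apply Rnot_lt_le; intros X.
assert (Hz := Rmax_Cmod z); assert (HBz := HB z Kz).
pose proof (Rmax_l (Rabs (fst z)) (Rabs (snd z))).
pose proof (Rmax_r (Rabs (fst z)) (Rabs (snd z))).
assert (H1 : Rabs (fst z) <= B) by lra; assert (H2 : Rabs (snd z) <= B) by lra.
apply Rabs_le_between in H1; apply Rabs_le_between in H2.
(* Compactness is available under a double negation, which is why the bound is proved by
   contradiction. *)
apply (Hd (fst z) (snd z) H1 H2); intros [u [v [_ [_ [Hu [Hv Huv]]]]]].
apply (Rlt_not_le _ _ X).
apply Rle_trans with (/ delta (u, v) + 1).
- apply (Hdelta (u, v)); [assumption|].
  eapply Rle_lt_trans; [apply Cmod_2Rmax|].
  apply Rmult_lt_compat_l; [assumption|]; simpl; apply Rmax_case; assumption.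
- apply Rplus_le_compat_r, Rinv_le_contravar; [apply cond_pos | assumption].
Qed.

(** Agreement on an open set passes to derivatives, so a family of successive derivatives identifies
    all iterated derivatives of [f] on [U]. *)
Lemma C_derive_n_family (U : C -> Prop) (gs : nat -> C -> C) (f : C -> C) :
  (forall z, U z -> @locally C_UniformSpace z U) ->
  (forall l z, U z -> is_C_derive (gs l) z (gs (S l) z)) ->
  agree_on U f (gs 0%nat) ->
  forall l, agree_on U (C_derive_n l f) (gs l).
Proof.
intros HU Hgs Hf l; induction l as [|l IH]; [exact Hf|].
intros z Uz; change (C_derive (C_derive_n l f) z = gs (S l) z).
apply is_C_derive_unique.
apply (is_derive_ext_loc (K := C_AbsRing) (V := C_NormedModule) (gs l)).
- apply locally_C; generalize (HU z Uz); apply filter_imp; intros w Uw; symmetry; now apply IH.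
- now apply Hgs.
Qed.

Lemma unit_disc_open (z : C) : unit_disc z -> @locally C_UniformSpace z unit_disc.
Proof.
unfold unit_disc; intros Hz.
assert (P : 0 < 1 - Cmod z) by lra.
apply C_locally_iff; exists (mkposreal _ P); simpl; intros w Hw.
pose proof (Cmod_triangle_minus w z); lra.
Qed.

Lemma exterior_open (z : C) : exterior z -> @locally C_UniformSpace z exterior.
Proof.
unfold exterior; intros Hz.
assert (P : 0 < Cmod z - 1) by lra.
apply C_locally_iff; exists (mkposreal _ P); simpl; intros w Hw.
pose proof (Cmod_triangle_minus z w); rewrite Cmod_minus_sym in Hw; lra.
Qed.

Lemma conv_le (r rho : R) (a : nat -> C) : 0 <= r <= rho -> conv rho a -> conv r a.
Proof.
intros Hr H k; destruct (H k) as [M HM]; exists M; intros n.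
eapply Rle_trans; [|apply (HM n)].
apply Rmult_le_compat_r; [apply pow_le; pose proof (pos_INR n); lra|].
apply Rmult_le_compat_l; [apply Cmod_ge_0|]; apply pow_incr; lra.
Qed.

(** All that the expansion alone provides; passing to [conv 1] uses the behaviour of the derivatives
    at the boundary. *)
Definition conv_disc (a : nat -> C) : Prop := forall rho, 0 < rho < 1 -> conv rho a.

Lemma conv_disc_of_conv (a : nat -> C) : conv 1 a -> conv_disc a.
Proof. intros H rho Hr; apply (conv_le rho 1); [lra | assumption]. Qed.

Definition Dcoef_n (l : nat) (a : nat -> C) : nat -> C := Nat.iter l Dcoef a.
Definition Ecoef_n (l : nat) (a : nat -> C) : nat -> C := Nat.iter l Ecoef a.
Definition Tcoef_n (sigma : R) (l : nat) (a : nat -> C) : nat -> C := Nat.iter l (Tcoef sigma) a.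

Lemma conv_disc_Dcoef_n (l : nat) (a : nat -> C) : conv_disc a -> conv_disc (Dcoef_n l a).
Proof.
intros H; induction l as [|l IH]; [exact H|].
intros rho Hr; apply conv_Dcoef; [lra | now apply IH].
Qed.

Lemma conv_disc_Ecoef_n (l : nat) (a : nat -> C) : conv_disc a -> conv_disc (Ecoef_n l a).
Proof.
intros H; induction l as [|l IH]; [exact H|].
intros rho Hr; apply conv_Ecoef; [lra | now apply IH].
Qed.

Lemma conv_Dcoef_n (l : nat) (a : nat -> C) : conv 1 a -> conv 1 (Dcoef_n l a).
Proof. intros H; induction l as [|l IH]; [exact H | apply conv_Dcoef; [lra | exact IH]]. Qed.

Lemma conv_Ecoef_n (l : nat) (a : nat -> C) : conv 1 a -> conv 1 (Ecoef_n l a).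
Proof. intros H; induction l as [|l IH]; [exact H | apply conv_Ecoef; [lra | exact IH]]. Qed.

Lemma conv_Tcoef_n (sigma : R) (l : nat) (a : nat -> C) :
  Rabs sigma <= 1 -> conv 1 a -> conv 1 (Tcoef_n sigma l a).
Proof. intros Hs H; induction l as [|l IH]; [exact H | apply conv_Tcoef; auto; lra]. Qed.

Lemma bnd_Dcoef_n (l k : nat) (M : R) (a : nat -> C) :
  bnd (l + k) 1 M a -> bnd k 1 M (Dcoef_n l a).
Proof.
revert k; induction l as [|l IH]; intros k H; [exact H|].
replace M with (M / 1) by field; apply bnd_Dcoef; [lra|]; apply IH.
now rewrite Nat.add_succ_r.
Qed.

Lemma bnd_Tcoef_n (sigma : R) (l k : nat) (M : R) (a : nat -> C) :
  Rabs sigma <= 1 -> bnd (l + k) 1 M a -> bnd k 1 M (Tcoef_n sigma l a).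
Proof.
intros Hs; revert k; induction l as [|l IH]; intros k H; [exact H|].
apply bnd_Tcoef; [lra | assumption |]; apply IH; now rewrite Nat.add_succ_r.
Qed.

(** The constant is chosen before [M] and [b]: this uniformity is what the continuity of
    [proj_minus] rests on. *)
Lemma bnd_Ecoef_n (l k : nat) : exists c, 0 <= c /\ forall (M : R) (b : nat -> C),
  bnd (l + k) 1 M b -> bnd k 1 (c * M) (Ecoef_n l b).
Proof.
revert k; induction l as [|l IH]; intros k.
- exists 1; split; [lra|]; intros M b H; rewrite Rmult_1_l; exact H.
- destruct (IH (S k)) as [c [Hc H]]; exists (2 ^ k * c); split.
  + apply Rmult_le_pos; [apply pow_le; lra | assumption].
  + intros M b Hb; rewrite Rmult_assoc; apply bnd_Ecoef; [lra|]; apply H.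
    now rewrite Nat.add_succ_r.
Qed.

(** The coefficients of the [j]-th derivative carry a factor comparable to [n ^ j], so bounding them
    is bounding weighted coefficients of [a]. The constant depends on [k] alone, as the continuity
    of the restriction maps requires. *)
Lemma rapid_of_Dcoef_n (k : nat) : exists c, 0 <= c /\ forall (a : nat -> C) (M : R),
  (forall j n, (j <= k)%nat -> Cmod (Dcoef_n j a n) <= M) -> bnd k 1 (c * M) a.
Proof.
induction k as [|k [c [Hc IH]]].
- exists 1; split; [lra|]; intros a M H n.
  rewrite pow1, pow_O, !Rmult_1_r, Rmult_1_l; now apply (H 0%nat).
(* The [1] covers [a 0], which differentiation kills; [2 ^ S k] pays for the shift of index in the
   weight. *)
- exists (2 ^ S k * c + 1).
  assert (P : 0 <= 2 ^ S k) by (apply pow_le; lra).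
  split; [nra|]; intros a M H.
  assert (B : bnd k 1 (c * M) (Dcoef a)).
  { apply IH; intros j n Hj; unfold Dcoef_n; rewrite <- Nat.iter_succ_r; apply (H (S j)); lia. }
  assert (PB := bnd_pos _ _ _ _ B).
  assert (PM : 0 <= M).
  { eapply Rle_trans; [apply Cmod_ge_0 | apply (H 0%nat 0%nat); lia]. }
  intros [|n].
  + simpl; rewrite Rplus_0_l, pow1, !Rmult_1_r.
    eapply Rle_trans; [apply (H 0%nat 0%nat); lia|].
    assert (0 <= 2 ^ S k * (c * M)) by (now apply Rmult_le_pos).
    simpl in *; lra.
  + specialize (B n); unfold Dcoef in B.
    rewrite Cmod_mult, Cmod_R, Rabs_pos_eq, S_INR, pow1, Rmult_1_r in B by apply pos_INR.
    rewrite pow1, S_INR, Rmult_1_r.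
    pose proof (pos_INR n); pose proof (Cmod_ge_0 (a (S n))).
    assert (Q : (INR n + 1 + 1) ^ S k <= 2 ^ S k * (INR n + 1) ^ S k).
    { rewrite <- Rpow_mult_distr; apply pow_incr; lra. }
    apply Rle_trans with (2 ^ S k * (c * M)); [|lra].
    apply Rle_trans with (Cmod (a (S n)) * (2 ^ S k * (INR n + 1) ^ S k)).
    * now apply Rmult_le_compat_l.
    * replace (Cmod (a (S n)) * (2 ^ S k * (INR n + 1) ^ S k)) with
        (2 ^ S k * ((INR n + 1) * Cmod (a (S n)) * (INR n + 1) ^ k)) by (simpl; ring).
      now apply Rmult_le_compat_l.
Qed.

(** [Ecoef] multiplies [b m] by [- m] and moves it up one place. For [m >= 1] one has
    [m + 1 <= 2 * m], whence a factor [2] at each order; the coefficient of index [0] vanishes by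
    hypothesis. *)
Lemma rapid_of_Ecoef_n (k : nat) : exists c, 0 <= c /\ forall (b : nat -> C) (M : R),
  b 0%nat = RtoC 0 ->
  (forall j n, (j <= k)%nat -> Cmod (Ecoef_n j b n) <= M) -> bnd k 1 (c * M) b.
Proof.
induction k as [|k [c [Hc IH]]].
- exists 1; split; [lra|]; intros b M _ H n.
  rewrite pow1, pow_O, !Rmult_1_r, Rmult_1_l; now apply (H 0%nat).
- exists (2 * c); split; [lra|]; intros b M H0 H.
  assert (B : bnd k 1 (c * M) (Ecoef b)).
  { apply IH; [reflexivity|].
    intros j n Hj; unfold Ecoef_n; rewrite <- Nat.iter_succ_r; apply (H (S j)); lia. }
  assert (PB := bnd_pos _ _ _ _ B).
  intros [|n].
  + rewrite H0, Cmod_0; lra.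
  + specialize (B (S (S n))); unfold Ecoef in B.
    rewrite Cmod_opp, Cmod_mult, Cmod_R, Rabs_pos_eq, (S_INR (S n)), pow1, Rmult_1_r in B by apply pos_INR.
    rewrite pow1, Rmult_1_r.
    pose proof (pos_INR n); pose proof (Cmod_ge_0 (b (S n))).
    assert (P1 : 0 <= (INR (S n) + 1) ^ k) by (apply pow_le; rewrite S_INR; lra).
    assert (Q : (INR (S n) + 1) ^ k <= (INR (S n) + 1 + 1) ^ k)
      by (apply pow_incr; rewrite S_INR; lra).
    assert (A : INR (S n) + 1 <= 2 * INR (S n)) by (rewrite S_INR; lra).
    replace (Cmod (b (S n)) * (INR (S n) + 1) ^ S k) with
      ((INR (S n) + 1) * Cmod (b (S n)) * (INR (S n) + 1) ^ k) by (simpl; ring).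
    rewrite (Rmult_assoc 2 c M).
    eapply Rle_trans; [|apply Rmult_le_compat_l; [lra | exact B]].
    rewrite <- !Rmult_assoc.
    apply Rmult_le_compat; auto.
    * apply Rmult_le_pos; [rewrite S_INR; lra | assumption].
    * now apply Rmult_le_compat_r.
Qed.

Lemma bernoulli (d : R) (n : nat) : 0 <= d <= 1 -> 1 - INR n * d <= (1 - d) ^ n.
Proof.
intros Hd; induction n as [|n IH]; [simpl; lra|].
rewrite S_INR; simpl.
assert (0 <= (1 - d) ^ n) by (apply pow_le; lra).
pose proof (pos_INR n).
destruct (Rle_dec 0 (1 - INR n * d)) as [A|A].
- apply Rle_trans with ((1 - d) * (1 - INR n * d)); [nra|]; apply Rmult_le_compat_l; lra.
- apply Rle_trans with 0; [nra|]; apply Rmult_le_pos; lra.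
Qed.

(** Cauchy estimates on circles of radius [1 - d], with [d] tending to [0]. Only an annulus along
    the boundary enters; under [z -> 1/z] it corresponds to a bounded part of the exterior. *)
Lemma coef_bound (a : nat -> C) (M : R) :
  conv_disc a -> (forall z, 1 / 2 <= Cmod z < 1 -> Cmod (ps a z) <= M) ->
  forall n, Cmod (a n) <= M.
Proof.
intros H HM n.
set (x := Cmod (a n)); assert (Px : 0 <= x) by apply Cmod_ge_0.
pose proof (pos_INR n) as Pn.
apply le_epsilon; intros eps He.
(* By Bernoulli the loss in replacing [(1 - d) ^ n] by [1] is at most [x * INR n * d <= eps]. *)
set (d := Rmin (1 / 2) (eps / ((x + 1) * (INR n + 1)))).
assert (Pp : 0 < (x + 1) * (INR n + 1)) by nra.
assert (Pd : 0 < d <= 1 / 2).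
{ split; [apply Rmin_pos; [lra | now apply Rdiv_lt_0_compat] | apply Rmin_l]. }
assert (E : Cmod (a n) * (1 - d) ^ n <= M).
{ apply cauchy_estimate; [lra | apply H; lra |].
  intros z Hz; apply HM; lra. }
fold x in E.
assert (Bn := bernoulli d n ltac:(lra)).
assert (D : (x + 1) * (INR n + 1) * d <= eps).
{ apply Rle_trans with ((x + 1) * (INR n + 1) * (eps / ((x + 1) * (INR n + 1)))).
  - apply Rmult_le_compat_l; [lra | apply Rmin_r].
  - right; field; lra. }
assert (x * (1 - INR n * d) <= x * (1 - d) ^ n) by (now apply Rmult_le_compat_l).
assert (x * (INR n * d) <= (x + 1) * (INR n + 1) * d).
{ rewrite <- Rmult_assoc; apply Rmult_le_compat_r; nra. }
lra.
Qed.

Lemma ps_derive_disc (a : nat -> C) (z : C) :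
  conv_disc a -> Cmod z < 1 -> is_C_derive (ps a) z (ps (Dcoef a) z).
Proof.
intros H Hz; pose proof (Cmod_ge_0 z).
apply (ps_derive ((1 + Cmod z) / 2)); [apply H|]; lra.
Qed.

Lemma disc_derive_n (g : C -> C) (a : nat -> C) :
  conv_disc a -> agree_on unit_disc g (ps a) ->
  forall l, agree_on unit_disc (C_derive_n l g) (ps (Dcoef_n l a)).
Proof.
intros Ha Hg; apply (C_derive_n_family unit_disc (fun l => ps (Dcoef_n l a))).
- apply unit_disc_open.
- intros l z Hz; apply ps_derive_disc; [now apply conv_disc_Dcoef_n | exact Hz].
- exact Hg.
Qed.

Lemma Cinv_derive (z : C) : z <> RtoC 0 -> is_C_derive Cinv z (- (/ z * / z))%C.
Proof.
intros Nz; assert (Pz : 0 < Cmod z) by (now apply Cmod_gt_0).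
set (r := Cmod z) in *.
apply is_C_derive_iff; intros eps; pose proof (cond_pos eps) as He.
assert (Pd : 0 < Rmin (r / 2) (eps * (r * r * r) / 2)).
{ apply Rmin_pos; [lra|].
  assert (0 < eps * (r * r * r)) by (repeat apply Rmult_lt_0_compat; assumption); lra. }
exists (mkposreal _ Pd); simpl; intros w Hw.
set (x := Cmod (w - z)) in *.
assert (H1 : x < r / 2) by (eapply Rlt_le_trans; [exact Hw | apply Rmin_l]).
assert (H2 : x < eps * (r * r * r) / 2) by (eapply Rlt_le_trans; [exact Hw | apply Rmin_r]).
assert (Px : 0 <= x) by apply Cmod_ge_0.
assert (Hwr : r / 2 < Cmod w).
{ pose proof (Cmod_triangle_minus z w) as T; rewrite Cmod_minus_sym in T; fold x r in T; lra. }
assert (Nw : w <> RtoC 0) by (apply Cmod_gt_0; lra).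
replace (/ w - / z - - (/ z * / z) * (w - z))%C with ((w - z) * (w - z) / (w * z * z))%C
  by (field; split; assumption).
rewrite Cmod_div by (repeat apply Cmult_neq_0; assumption).
rewrite !Cmod_mult; fold x r.
apply (Rmult_le_reg_r (Cmod w * r * r)); [repeat apply Rmult_lt_0_compat; lra|].
unfold Rdiv; rewrite (Rmult_assoc (x * x)), Rinv_l, Rmult_1_r
  by (apply Rgt_not_eq; repeat apply Rmult_lt_0_compat; lra).
replace (eps * x * (Cmod w * r * r)) with (x * (eps * Cmod w * (r * r))) by ring.
apply Rmult_le_compat_l; [assumption|].
apply Rle_trans with (eps * (r / 2) * (r * r)); [lra|].
apply Rmult_le_compat_r; [nra|]; apply Rmult_le_compat_l; lra.
Qed.

Lemma is_C_derive_continuous (f : C -> C) (z l : C) :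
  is_C_derive f z l -> @continuous C_UniformSpace C_UniformSpace f z.
Proof.
rewrite is_C_derive_iff, C_continuous_iff; intros H eps.
destruct (H (mkposreal 1 Rlt_0_1)) as [d Hd]; simpl in Hd.
pose proof (Cmod_ge_0 l) as Hl.
assert (P : 0 < Rmin d (eps / (Cmod l + 2))).
{ apply Rmin_pos; [apply cond_pos | apply Rdiv_lt_0_compat; [apply cond_pos | lra]]. }
exists (mkposreal _ P); simpl; intros w Hw.
specialize (Hd w (Rlt_le_trans _ _ _ Hw (Rmin_l _ _))).
assert (X := Rlt_le_trans _ _ _ Hw (Rmin_r _ _)).
set (x := Cmod (w - z)) in *; assert (0 <= x) by apply Cmod_ge_0.
pose proof (Cmod_triangle_minus (f w - f z) (l * (w - z))) as T.
rewrite Cmod_mult in T; fold x in T.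
apply Rle_lt_trans with ((Cmod l + 2) * x); [nra|].
apply (Rmult_lt_compat_l (Cmod l + 2)) in X; [|lra].
replace ((Cmod l + 2) * (eps / (Cmod l + 2))) with (pos eps) in X by (field; lra).
exact X.
Qed.

Lemma is_C_derive_comp (f g : C -> C) (z l m : C) :
  is_C_derive f (g z) l -> is_C_derive g z m ->
  is_C_derive (fun w => f (g w)) z (l * m)%C.
Proof.
intros Hf HG.
assert (cG := is_C_derive_continuous _ _ _ HG).
rewrite is_C_derive_iff in Hf, HG; rewrite C_continuous_iff in cG.
apply is_C_derive_iff; intros eps.
pose proof (cond_pos eps) as He.
pose proof (Cmod_ge_0 l); pose proof (Cmod_ge_0 m).
assert (H1 : 0 < eps / (2 * (Cmod m + 1))) by (apply Rdiv_lt_0_compat; lra).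
assert (H2 : 0 < Rmin 1 (eps / (2 * (Cmod l + 1)))).
{ apply Rmin_pos; [lra | apply Rdiv_lt_0_compat; lra]. }
destruct (Hf (mkposreal _ H1)) as [d1 Hd1].
destruct (HG (mkposreal _ H2)) as [d2 Hd2].
destruct (cG d1) as [d3 Hd3].
exists (mkposreal _ (Rmin_stable_in_posreal d2 d3)); simpl; intros w Hw.
specialize (Hd2 w (Rlt_le_trans _ _ _ Hw (Rmin_l _ _))).
specialize (Hd3 w (Rlt_le_trans _ _ _ Hw (Rmin_r _ _))).
specialize (Hd1 _ Hd3); simpl in Hd1, Hd2.
set (x := Cmod (w - z)) in *; assert (Px : 0 <= x) by apply Cmod_ge_0.
set (D := (g w - g z)%C) in *; set (E := (D - m * (w - z))%C) in *.
set (A := (f (g w) - f (g z) - l * D)%C) in *.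
replace (f (g w) - f (g z) - l * m * (w - z))%C with (A + l * E)%C
  by (unfold A, E; ring).
assert (HD : Cmod D <= (Cmod m + 1) * x).
{ replace D with (m * (w - z) + E)%C by (unfold E; ring).
  eapply Rle_trans; [apply Cmod_triangle|].
  rewrite Cmod_mult; fold x.
  pose proof (Rmin_l 1 (eps / (2 * (Cmod l + 1)))); nra. }
eapply Rle_trans; [apply Cmod_triangle|]; rewrite Cmod_mult.
assert (HA : Cmod A <= eps / 2 * x).
{ eapply Rle_trans; [exact Hd1|].
  replace (eps / 2 * x) with (eps / (2 * (Cmod m + 1)) * ((Cmod m + 1) * x)) by (field; lra).
  apply Rmult_le_compat_l; [lra | exact HD]. }
assert (HE : Cmod l * Cmod E <= eps / 2 * x).
{ apply Rle_trans with ((Cmod l + 1) * (eps / (2 * (Cmod l + 1)) * x)).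
  - apply Rmult_le_compat; try apply Cmod_ge_0; try lra.
    eapply Rle_trans; [exact Hd2|]; apply Rmult_le_compat_r; [assumption | apply Rmin_r].
  - right; field; lra. }
lra.
Qed.

Lemma ps_Ecoef (b : nat -> C) (u : C) : conv_disc b -> Cmod u < 1 ->
  ps (Ecoef b) u = (ps (Dcoef b) u * - (u * u))%C.
Proof.
intros Hb Hu; pose proof (Cmod_ge_0 u).
set (rho := (1 + Cmod u) / 2); assert (Hr : 0 < rho < 1 /\ Cmod u < rho) by (unfold rho; lra).
destruct (conv_Ecoef rho b ltac:(lra) (Hb rho ltac:(lra)) 2%nat) as [M HM].
destruct (conv_Dcoef rho b ltac:(lra) (Hb rho ltac:(lra)) 2%nat) as [M' HM'].
apply (ps_unique rho M); auto; try lra.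
(* Two terms are dropped: [Ecoef b 0] is zero by definition, [Ecoef b 1] because of the factor
   [INR 0]. *)
apply is_Cseries_incr; [simpl; ring|].
apply is_Cseries_incr; [simpl; ring|].
apply (is_Cseries_ext (fun n => - (u * u) * (Dcoef b n * u ^ n) + 0 * (Dcoef b n * u ^ n))%C).
{ intros n; unfold Dcoef, Ecoef; rewrite !Cpow_S; ring. }
replace (ps (Dcoef b) u * - (u * u))%C with
  (- (u * u) * ps (Dcoef b) u + 0 * ps (Dcoef b) u)%C by ring.
assert (S := ps_correct rho M' (Dcoef b) u ltac:(lra) HM' ltac:(lra)).
apply (is_Cseries_lin (- (u * u)) _ (fun n => 0 * (Dcoef b n * u ^ n))%C); [exact S|].
apply (is_Cseries_ext (fun n => - (1) * (Dcoef b n * u ^ n) + Dcoef b n * u ^ n)%C).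
{ intros n; ring. }
replace (0 * ps (Dcoef b) u)%C with (- (1) * ps (Dcoef b) u + ps (Dcoef b) u)%C by ring.
now apply is_Cseries_lin.
Qed.

Lemma Cmod_inv_lt_1 (z : C) : 1 < Cmod z -> Cmod (/ z) < 1.
Proof.
intros Hz; assert (Nz : z <> RtoC 0) by (apply Cmod_gt_0; lra).
rewrite Cmod_inv, <- Rinv_1 by assumption; apply Rinv_lt_contravar; lra.
Qed.

Lemma Cmod_inv_le_1 (z : C) : 1 <= Cmod z -> Cmod (/ z) <= 1.
Proof.
intros Hz; assert (Nz : z <> RtoC 0) by (apply Cmod_gt_0; lra).
rewrite Cmod_inv, <- Rinv_1 by assumption; apply Rinv_le_contravar; lra.
Qed.

Lemma exterior_derive_n (h : C -> C) (b : nat -> C) :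
  conv_disc b -> agree_on exterior h (fun z => ps b (/ z)) ->
  forall l, agree_on exterior (C_derive_n l h) (fun z => ps (Ecoef_n l b) (/ z)).
Proof.
intros Hb Hh; apply (C_derive_n_family exterior (fun l z => ps (Ecoef_n l b) (/ z))).
- apply exterior_open.
- intros l z Hz; assert (Nz : z <> RtoC 0) by (apply Cmod_gt_0; unfold exterior in Hz; lra).
  assert (Hi := Cmod_inv_lt_1 z Hz).
  assert (Hl := conv_disc_Ecoef_n l b Hb).
  change (is_C_derive (fun z => ps (Ecoef_n l b) (/ z)) z (ps (Ecoef (Ecoef_n l b)) (/ z))).
  rewrite ps_Ecoef by assumption.
  apply (is_C_derive_comp (ps (Ecoef_n l b)) Cinv).
  + now apply ps_derive_disc.
  + now apply Cinv_derive.
- exact Hh.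
Qed.

Lemma ps_continuous_on (a : nat -> C) : conv 1 a ->
  @continuous_on C_UniformSpace C_UniformSpace closed_disc (ps a).
Proof.
intros H; destruct (ps_lipschitz 1 a Rlt_0_1 H) as [K [HK L]].
apply continuous_on_iff; intros z Hz eps; pose proof (cond_pos eps).
assert (P : 0 < eps / (K + 1)) by (apply Rdiv_lt_0_compat; lra).
exists (mkposreal _ P); simpl; intros w Hw Hwz.
eapply Rle_lt_trans; [now apply L|].
replace (pos eps) with ((K + 1) * (eps / (K + 1))) by (field; lra).
pose proof (Cmod_ge_0 (w - z)); nra.
Qed.

Lemma ps_inv_continuous_on (b : nat -> C) : conv 1 b ->
  @continuous_on C_UniformSpace C_UniformSpace closed_exterior (fun z => ps b (/ z)).
Proof.
intros H; assert (cb := ps_continuous_on b H).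
rewrite continuous_on_iff in cb |- *; intros z Hz eps.
assert (Nz : z <> RtoC 0) by (apply Cmod_gt_0; unfold closed_exterior in Hz; lra).
destruct (cb (/ z)%C (Cmod_inv_le_1 z Hz) eps) as [d Hd].
assert (ci := is_C_derive_continuous _ _ _ (Cinv_derive z Nz)).
rewrite C_continuous_iff in ci; destruct (ci d) as [d' Hd'].
exists d'; intros w Hw Hwz; apply Hd; [now apply Cmod_inv_le_1 | now apply Hd'].
Qed.

(** * From coefficients to membership and boundary values *)

Lemma A_infty_of_coef (g : C -> C) (a : nat -> C) :
  conv 1 a -> agree_on unit_disc g (ps a) -> mem A_infty g.
Proof.
intros Ha Hg; assert (Ha' := conv_disc_of_conv a Ha).
assert (HD := disc_derive_n g a Ha' Hg).
split.
- intros z Hz; exists (ps (Dcoef a) z).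
  apply (is_derive_ext_loc (K := C_AbsRing) (V := C_NormedModule) (ps a)).
  + apply locally_C; generalize (unit_disc_open z Hz); apply filter_imp; intros w Hw; symmetry; now apply Hg.
  + now apply ps_derive_disc.
- intros l; exists (ps (Dcoef_n l a)); split; [|intros z Hz; symmetry; now apply HD].
  now apply ps_continuous_on, conv_Dcoef_n.
Qed.

Lemma ext_disc_derive_n (g : C -> C) (a : nat -> C) (l : nat) (z : C) :
  conv 1 a -> agree_on unit_disc g (ps a) -> closed_disc z ->
  ext unit_disc (C_derive_n l g) z = ps (Dcoef_n l a) z.
Proof.
intros Ha Hg Hz.
apply (ext_eq unit_disc closed_disc).
- unfold unit_disc, closed_disc; intros; lra.
- now apply ps_continuous_on, conv_Dcoef_n.
- intros w Hw; symmetry; apply disc_derive_n; [now apply conv_disc_of_conv | exact Hg | exact Hw].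
- exact Hz.
- now apply disc_proper.
Qed.

Lemma A0_infty_of_coef (h : C -> C) (b : nat -> C) :
  conv 1 b -> b 0%nat = RtoC 0 -> agree_on exterior h (fun z => ps b (/ z)) ->
  mem A0_infty h.
Proof.
intros Hb H0 Hh; assert (Hb' := conv_disc_of_conv b Hb).
assert (HD := exterior_derive_n h b Hb' Hh).
split; [|split].
- intros z Hz; exists (ps (Dcoef b) (/ z) * (- (/ z * / z)))%C.
  apply (is_derive_ext_loc (K := C_AbsRing) (V := C_NormedModule) (fun z => ps b (/ z))).
  + apply locally_C; generalize (exterior_open z Hz); apply filter_imp; intros w Hw; symmetry; now apply Hh.
  + apply (is_C_derive_comp (ps b) Cinv).
    * apply ps_derive_disc; [assumption | now apply Cmod_inv_lt_1].
    * apply Cinv_derive, Cmod_gt_0; unfold exterior in Hz; lra.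
- intros l; exists (fun z => ps (Ecoef_n l b) (/ z)); split; [|intros z Hz; symmetry; now apply HD].
  now apply ps_inv_continuous_on, conv_Ecoef_n.
- intros P HP; apply C_locally_iff in HP; destruct HP as [eps He].
  destruct (ps_lipschitz 1 b Rlt_0_1 Hb) as [K [HK L]].
  pose proof (cond_pos eps).
  (* Since the series vanishes at [0], the Lipschitz bound gives [Cmod (h z) <= K / Cmod z]; the
     summand [1] keeps [z] in the exterior. *)
  exists (1 + (K + 1) / eps); intros z Hz.
  assert (P1 : 0 < (K + 1) / eps) by (apply Rdiv_lt_0_compat; lra).
  assert (P2 : 0 < Cmod z) by lra.
  assert (Nz : z <> RtoC 0) by (now apply Cmod_gt_0).
  apply He; rewrite Hh by (unfold exterior; lra).
  assert (Z : ps b 0 = RtoC 0).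
  { destruct (Hb 2%nat) as [M HM]; rewrite (ps_at_0 1 M), H0; auto; lra. }
  rewrite <- Z; eapply Rle_lt_trans.
  { apply L; [rewrite Cmod_0; lra | apply Rlt_le, Cmod_inv_lt_1; lra]. }
  replace (/ z - 0)%C with (/ z)%C by ring; rewrite Cmod_inv by assumption.
  apply (Rmult_lt_reg_r (Cmod z)); [assumption|].
  rewrite Rmult_assoc, Rinv_l, Rmult_1_r by lra.
  apply Rlt_trans with (eps * ((K + 1) / eps)).
  + replace (eps * ((K + 1) / eps)) with (K + 1) by (field; lra); lra.
  + apply Rmult_lt_compat_l; lra.
Qed.

Lemma ext_exterior_derive_n (h : C -> C) (b : nat -> C) (l : nat) (z : C) :
  conv 1 b -> agree_on exterior h (fun z => ps b (/ z)) -> closed_exterior z ->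
  ext exterior (C_derive_n l h) z = ps (Ecoef_n l b) (/ z).
Proof.
intros Hb Hh Hz.
apply (ext_eq exterior closed_exterior (C_derive_n l h) (fun z => ps (Ecoef_n l b) (/ z))).
- unfold exterior, closed_exterior; intros; lra.
- now apply ps_inv_continuous_on, conv_Ecoef_n.
- intros w Hw; symmetry; apply (exterior_derive_n h b); [now apply conv_disc_of_conv | exact Hh | exact Hw].
- exact Hz.
- now apply exterior_proper.
Qed.

(** * From membership to rapidly decreasing coefficients *)

(** Applied to the first derivative, this supplies the continuity that [C1_punctured] asks for. *)
Lemma interior_continuous (U K : C -> Prop) (f : C -> C) (z : C) :
  (forall w, U w -> K w) -> (forall w, U w -> @locally C_UniformSpace w U) ->
  extends_continuously U K f -> U z -> @continuous C_UniformSpace C_UniformSpace f z.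
Proof.
intros UK HU [e [ce fe]] Uz; rewrite continuous_on_iff in ce; apply C_continuous_iff; intros eps.
destruct (ce z (UK z Uz) eps) as [d Hd].
destruct (proj1 (C_locally_iff _ _) (HU z Uz)) as [d' Hd'].
exists (mkposreal _ (Rmin_stable_in_posreal d d')); simpl; intros w Hw.
assert (Uw : U w) by (apply Hd'; eapply Rlt_le_trans; [exact Hw | apply Rmin_r]).
rewrite <- !fe by assumption; apply Hd; [now apply UK|].
eapply Rlt_le_trans; [exact Hw | apply Rmin_l].
Qed.

(** The expansion holds off the centre; at the centre it follows because both sides are continuous
    there. *)
Lemma ps_at_0_limit (f : C -> C) (a : nat -> C) : conv_disc a ->
  @continuous C_UniformSpace C_UniformSpace f (RtoC 0) ->
  (forall u, 0 < Cmod u < 1 -> f u = ps a u) -> f 0 = ps a 0.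
Proof.
intros Ha cf E.
assert (cp := is_C_derive_continuous _ _ _ (ps_derive_disc a 0 Ha ltac:(rewrite Cmod_0; lra))).
rewrite C_continuous_iff in cf, cp.
apply (Cmod_eq_of_le _ _ 2); intros eps.
destruct (cf eps) as [d1 H1]; destruct (cp eps) as [d2 H2].
set (s := Rmin (1 / 2) (Rmin d1 d2) / 2).
assert (Hs : 0 < s /\ s < 1 /\ s < d1 /\ s < d2).
{ pose proof (cond_pos d1); pose proof (cond_pos d2).
  pose proof (Rmin_l (1 / 2) (Rmin d1 d2)); pose proof (Rmin_r (1 / 2) (Rmin d1 d2)).
  pose proof (Rmin_l d1 d2); pose proof (Rmin_r d1 d2).
  assert (0 < Rmin (1 / 2) (Rmin d1 d2)) by (repeat apply Rmin_pos; lra).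
  unfold s; repeat split; lra. }
assert (Es : Cmod (RtoC s) = s) by (rewrite Cmod_R, Rabs_pos_eq; lra).
assert (Es' : Cmod (RtoC s - 0) = s) by (rewrite <- Es; f_equal; rewrite Es; ring).
specialize (H1 (RtoC s) ltac:(lra)); specialize (H2 (RtoC s) ltac:(lra)).
rewrite E in H1 by lra.
replace (f 0 - ps a 0)%C with ((ps a s - ps a 0) + - (ps a s - f 0))%C by ring.
eapply Rle_trans; [apply Cmod_triangle|]; rewrite Cmod_opp; lra.
Qed.

(** Each derivative is bounded on the disc because its extension is continuous on a compact set.
    [coef_bound] turns this into bounds on the coefficients of every derivative, and
    [rapid_of_Dcoef_n] into rapid decrease. *)
Lemma coef_of_A_infty (g : C -> C) : mem A_infty g ->
  exists a, conv 1 a /\ agree_on unit_disc g (ps a).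
Proof.
intros [Hh He].
assert (DC : forall w, unit_disc w -> closed_disc w)
  by (unfold unit_disc, closed_disc; intros; lra).
assert (Dg : forall z, unit_disc z -> is_C_derive g z (C_derive g z)).
{ intros z Hz; apply C_derive_correct; [exact z | now apply Hh]. }
assert (cg0 : @continuous C_UniformSpace C_UniformSpace g (RtoC 0)).
{ eapply is_C_derive_continuous, Dg; unfold unit_disc; rewrite Cmod_0; lra. }
destruct (proj1 (C_continuous_iff _ _) cg0 (mkposreal 1 Rlt_0_1)) as [d Hd]; simpl in Hd.
destruct (power_series_expansion g (C_derive g) d (Cmod (g 0) + 1)) as [a [Ha Hg]].
- intros u Hu; split; [apply Dg, Hu|].
  apply (interior_continuous unit_disc closed_disc); auto using unit_disc_open.
  + apply (He 1%nat).
  + apply Hu.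
- apply cond_pos.
- intros u Hu; specialize (Hd u); replace (u - 0)%C with u in Hd by ring.
  specialize (Hd ltac:(lra)).
  pose proof (Cmod_triangle_minus (g u) (g 0)); lra.
- assert (Ha' : conv_disc a) by (intros rho Hr; apply Ha; lra).
  assert (Hag : agree_on unit_disc g (ps a)).
  { intros z Hz; destruct (Ceq_dec z 0) as [->|Nz].
    - now apply ps_at_0_limit.
    - apply Hg; split; [now apply Cmod_gt_0 | exact Hz]. }
  exists a; split; [|exact Hag].
  assert (HB : forall l, exists M, forall n, Cmod (Dcoef_n l a n) <= M).
  { intros l; destruct (He l) as [e [ce ee]].
    destruct (compact_bounded closed_disc e 1) as [M HM]; auto.
    - intros z Nz; unfold closed_disc in *.
      assert (P : 0 < Cmod z - 1) by lra.
      exists (mkposreal _ P); simpl; intros w Hw.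
      pose proof (Cmod_triangle_minus z w) as T; rewrite Cmod_minus_sym in T; lra.
    - exists M; apply coef_bound; [now apply conv_disc_Dcoef_n|].
      intros z Hz; rewrite <- (disc_derive_n g a Ha' Hag l z) by apply Hz.
      rewrite <- ee by apply Hz; apply HM, DC, Hz. }
  intros k; destruct (rapid_of_Dcoef_n k) as [c [_ Hc]].
  assert (HBk : exists M, forall j n, (j <= k)%nat -> Cmod (Dcoef_n j a n) <= M).
  { clear Hc; induction k as [|k [M IH]].
    - destruct (HB 0%nat) as [M HM]; exists M; intros j n Hj.
      replace j with 0%nat by lia; apply HM.
    - destruct (HB (S k)) as [M' HM']; exists (Rmax M M'); intros j n Hj.
      destruct (Nat.eq_dec j (S k)) as [->|].
      + eapply Rle_trans; [apply HM' | apply Rmax_r].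
      + eapply Rle_trans; [apply IH; lia | apply Rmax_l]. }
  destruct HBk as [M HM]; exists (c * M); now apply Hc.
Qed.

(** The limit at infinity is used twice for [u -> h (1/u)]: it bounds the function near the centre,
    so that the expansion applies, and it makes the constant coefficient vanish. *)
Lemma coef_of_A0_infty (h : C -> C) : mem A0_infty h ->
  exists b, conv 1 b /\ b 0%nat = RtoC 0 /\ agree_on exterior h (fun z => ps b (/ z)).
Proof.
intros [Hh [He Hinf]].
assert (EC : forall w, exterior w -> closed_exterior w)
  by (unfold exterior, closed_exterior; intros; lra).
assert (Dh : forall z, exterior z -> is_C_derive h z (C_derive h z)).
{ intros z Hz; apply C_derive_correct; [exact z | now apply Hh]. }
assert (Hu0 : forall u, 0 < Cmod u < 1 -> u <> RtoC 0 /\ exterior (/ u)).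
{ intros u Hu; assert (Nu : u <> RtoC 0) by (apply Cmod_gt_0; lra); split; [exact Nu|].
  unfold exterior; rewrite Cmod_inv, <- Rinv_1 by assumption.
  apply Rinv_lt_contravar; lra. }
assert (Hlim : forall eps : posreal, exists d : posreal, forall u, 0 < Cmod u < d ->
  Cmod (h (/ u)%C) < eps).
{ intros eps; destruct (Hinf (fun y => Cmod (y - 0) < eps)) as [M HM].
  { apply C_locally_iff; exists eps; auto. }
  assert (P : 0 < / (Rabs M + 1)) by (apply Rinv_0_lt_compat; pose proof (Rabs_pos M); lra).
  exists (mkposreal _ P); simpl; intros u Hu.
  assert (Nu : u <> RtoC 0) by (apply Cmod_gt_0; lra).
  replace (h (/ u)%C) with (h (/ u)%C - 0)%C by ring; apply HM.
  rewrite Cmod_inv by assumption.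
  pose proof (Rle_abs M); pose proof (Rabs_pos M).
  apply Rlt_trans with (Rabs M + 1); [lra|].
  rewrite <- (Rinv_inv (Rabs M + 1)); apply Rinv_lt_contravar; [|lra].
  apply Rmult_lt_0_compat; lra. }
destruct (Hlim (mkposreal 1 Rlt_0_1)) as [d Hd]; simpl in Hd.
destruct (power_series_expansion (fun u => h (/ u)%C)
  (fun u => C_derive h (/ u)%C * (- (/ u * / u)))%C d 1) as [b [Hb Hhb]].
- intros u Hu; destruct (Hu0 u Hu) as [Nu Eu]; split.
  + apply (is_C_derive_comp h Cinv); [now apply Dh | now apply Cinv_derive].
  + assert (ci := is_C_derive_continuous _ _ _ (Cinv_derive u Nu)).
    apply C_continuous_mult.
    * apply (continuous_comp Cinv (C_derive h)); [exact ci|].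
      apply (interior_continuous exterior closed_exterior); auto using exterior_open.
      apply (He 1%nat).
    * apply (continuous_opp (V := C_R_NormedModule)).
      now apply C_continuous_mult.
- apply cond_pos.
- intros u Hu; now apply Rlt_le, Hd.
- assert (Hb' : conv_disc b) by (intros rho Hr; apply Hb; lra).
  assert (Hag : agree_on exterior h (fun z => ps b (/ z))).
  { intros z Hz; unfold exterior in Hz.
    assert (Nz : z <> RtoC 0) by (apply Cmod_gt_0; lra).
    rewrite <- Hhb.
    - f_equal; field; exact Nz.
    - split; [rewrite Cmod_inv by assumption; apply Rinv_0_lt_compat; lra
             | now apply Cmod_inv_lt_1]. }
  assert (Z : b 0%nat = RtoC 0).
  (* The centre stands for the point at infinity, so the value filled in there is the limit [0]. *)
  { set (f := fun u => if Ceq_dec u 0 then RtoC 0 else h (/ u)%C).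
    assert (F0 : f 0 = RtoC 0) by (unfold f; destruct (Ceq_dec 0 0); congruence).
    assert (E : f 0 = ps b 0).
    { apply ps_at_0_limit; [exact Hb' | |].
      - apply C_continuous_iff; intros eps; destruct (Hlim eps) as [d' Hd'].
        exists d'; intros w Hw; replace (w - 0)%C with w in Hw by ring.
        rewrite F0; replace (f w - 0)%C with (f w) by ring; unfold f.
        destruct (Ceq_dec w 0) as [_|Nw]; [rewrite Cmod_0; apply cond_pos|].
        apply Hd'; split; [now apply Cmod_gt_0 | exact Hw].
      - intros u Hu; unfold f; destruct (Ceq_dec u 0) as [->|_].
        + rewrite Cmod_0 in Hu; lra.
        + now apply Hhb. }
    rewrite F0 in E; rewrite E; symmetry.
    destruct (Hb (1 / 2) ltac:(lra) 2%nat) as [M HM].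
    apply (ps_at_0 (1 / 2) M); [lra | exact HM]. }
  exists b; split; [|split; [exact Z | exact Hag]].
  assert (HB : forall l, exists M, forall n, Cmod (Ecoef_n l b n) <= M).
  { intros l; destruct (He l) as [e [ce ee]].
    (* The closed exterior is not compact; this annulus is, and it contains the inverses of the
       points with [1 / 2 <= Cmod u < 1] that [coef_bound] looks at. *)
    destruct (compact_bounded (fun z => 1 <= Cmod z <= 2) e 2) as [M HM].
    - intros z Hz; apply Hz.
    - intros z Nz.
      destruct (Rlt_le_dec (Cmod z) 1) as [A|A].
      + assert (P : 0 < 1 - Cmod z) by lra.
        exists (mkposreal _ P); simpl; intros w Hw.
        pose proof (Cmod_triangle_minus w z); lra.
      + assert (P : 0 < Cmod z - 2).
        { destruct (Rlt_le_dec 2 (Cmod z)); [lra|]; elim Nz; lra. }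
        exists (mkposreal _ P); simpl; intros w Hw.
        pose proof (Cmod_triangle_minus z w) as T; rewrite Cmod_minus_sym in T; lra.
    - rewrite continuous_on_iff in ce |- *; intros z Hz eps.
      destruct (ce z (proj1 Hz) eps) as [d1 Hd1].
      exists d1; intros w Hw; apply Hd1, Hw.
    - exists M; apply coef_bound; [now apply conv_disc_Ecoef_n|].
      intros u Hu; destruct (Hu0 u ltac:(lra)) as [Nu Eu].
      assert (X := exterior_derive_n h b Hb' Hag l (/ u)%C Eu); cbv beta in X.
      replace (/ / u)%C with u in X by (field; exact Nu).
      rewrite <- X, <- ee by exact Eu; apply HM; split; [apply EC, Eu|].
      rewrite Cmod_inv by assumption.
      replace 2 with (/ (1 / 2)) by lra; apply Rinv_le_contravar; lra. }
  intros k; destruct (rapid_of_Ecoef_n k) as [c [_ Hc]].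
  assert (HBk : exists M, forall j n, (j <= k)%nat -> Cmod (Ecoef_n j b n) <= M).
  { clear Hc; induction k as [|k [M IH]].
    - destruct (HB 0%nat) as [M HM]; exists M; intros j n Hj.
      replace j with 0%nat by lia; apply HM.
    - destruct (HB (S k)) as [M' HM']; exists (Rmax M M'); intros j n Hj.
      destruct (Nat.eq_dec j (S k)) as [->|].
      + eapply Rle_trans; [apply HM' | apply Rmax_r].
      + eapply Rle_trans; [apply IH; lia | apply Rmax_l]. }
  destruct HBk as [M HM]; exists (c * M); now apply Hc.
Qed.

(** * Smooth functions on the circle *)

Lemma Lub_Rbar_le (E : R -> Prop) (M : R) :
  (forall x, E x -> x <= M) -> Rbar_le (Lub_Rbar E) M.
Proof. intros H; apply (proj2 (Lub_Rbar_correct E)); intros x Ex; apply H, Ex. Qed.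

Lemma le_of_Lub_Rbar_lt (E : R -> Prop) (M x : R) :
  Rbar_lt (Lub_Rbar E) M -> E x -> x <= M.
Proof.
intros H Ex.
assert (L := proj1 (Lub_Rbar_correct E) x Ex).
exact (Rbar_lt_le _ _ (Rbar_le_lt_trans _ _ _ L H)).
Qed.

(** The estimate is stated for differences and for a real [M] strictly above finitely many
    semi-norms; this avoids both arithmetic with infinite values and a separate statement of
    linearity. *)
Lemma continuous_map_of_bound (X Y : fspace) (P : (C -> C) -> (C -> C)) :
  (forall f, mem X f -> mem Y (P f)) ->
  (forall l : nat, exists (L : list nat) (K : R), 0 <= K /\
     forall f g (M : R), mem X f -> mem X g ->
     (forall j, In j L -> Rbar_lt (snorm X j (fun z => g z - f z)%C) M) ->
     Rbar_le (snorm Y l (fun z => P g z - P f z)%C) (K * M)) ->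
  continuous_map X Y P.
Proof.
intros HP HB f Hf; split; [now apply HP|].
intros U [L [eps HU]].
(* Finitely many target semi-norms are controlled by one list and one constant, obtained by
   concatenating lists and adding constants. *)
assert (H : exists (L' : list nat) (K : R), 0 <= K /\ forall g (M : R), 0 < M -> mem X g ->
   (forall j, In j L' -> Rbar_lt (snorm X j (fun z => g z - f z)%C) M) ->
   forall l, In l L -> Rbar_le (snorm Y l (fun z => P g z - P f z)%C) (K * M)).
{ clear HU; induction L as [|l L [L' [K [HK IH]]]].
  - exists nil, 0; split; [lra|]; intros g M _ _ _ l [].
  - destruct (HB l) as [L1 [K1 [HK1 H1]]].
    exists (L1 ++ L'), (K1 + K); split; [lra|].
    intros g M HM Hg Hj m [<-|Hm].
    + eapply Rbar_le_trans.
      * apply H1; auto; intros j Hj1; apply Hj, in_or_app; now left.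
      * simpl; nra.
    + eapply Rbar_le_trans.
      * apply (IH g M); auto; intros j Hj1; apply Hj, in_or_app; now right.
      * simpl; nra. }
destruct H as [L' [K [HK H]]].
pose proof (cond_pos eps) as He.
(* [K + 1] also covers [K = 0] and makes the final inequality strict. *)
assert (Pe : 0 < eps / (K + 1)) by (apply Rdiv_lt_0_compat; lra).
exists L', (mkposreal _ Pe); simpl; intros g Hg Hj.
apply HU; [now apply HP|]; intros l Hl.
eapply Rbar_le_lt_trans; [now apply (H g (eps / (K + 1)))|]; simpl.
apply Rlt_le_trans with ((K + 1) * (eps / (K + 1))).
- apply Rmult_lt_compat_r; lra.
- right; field; lra.
Qed.

Lemma agree_on_disc_lin (f g : C -> C) (a b : nat -> C) (k : C) :
  conv 1 a -> conv 1 b ->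
  agree_on unit_disc f (ps a) -> agree_on unit_disc g (ps b) ->
  agree_on unit_disc (fun z => k * f z + g z)%C (ps (fun n => k * a n + b n)%C).
Proof.
intros Ha Hb Hf Hg z Hz; rewrite Hf, Hg by assumption; symmetry.
unfold unit_disc in Hz; apply (ps_lin 1); auto; lra.
Qed.

Lemma agree_on_exterior_lin (f g : C -> C) (a b : nat -> C) (k : C) :
  conv 1 a -> conv 1 b ->
  agree_on exterior f (fun z => ps a (/ z)) -> agree_on exterior g (fun z => ps b (/ z)) ->
  agree_on exterior (fun z => k * f z + g z)%C (fun z => ps (fun n => k * a n + b n)%C (/ z)).
Proof.
intros Ha Hb Hf Hg z Hz; rewrite Hf, Hg by assumption; symmetry.
assert (Hi := Cmod_inv_lt_1 z Hz); apply (ps_lin 1); auto; lra.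
Qed.

(** The substitution [t -> - t] carries the interval to [[- 2 PI, 0]], which periodicity brings
    back. It treats the part in [1/z], as [1 / cis t = cis (- t)]. *)
Lemma fc_reflect (F : R -> C) (n : Z) :
  (forall t, RC_continuous F t) -> (forall t, F (t + 2 * PI) = F t) ->
  fc (fun t => F (- t)) n = fc F (- n).
Proof.
intros cF pF; unfold fc; rewrite Z.opp_involutive.
set (G := fun t => (F t * expi n t)%C).
assert (cG : forall t, RC_continuous G t) by (now apply fc_continuous).
assert (pG : forall t, G (t + 2 * PI) = G t) by (intros t; unfold G; now rewrite pF, expi_periodic).
assert (E1 : CInt (fun t => scal (-1) (G (-1 * t + 0)) : C_R_ModuleSpace) 0 (2 * PI)
   = CInt G (-1 * 0 + 0) (-1 * (2 * PI) + 0)).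
{ apply (RInt_comp_lin (V := C_R_CompleteNormedModule)); eexists; now apply CInt_correct. }
assert (E2 : CInt (fun t => scal (-1) (G (-1 * t + 0)) : C_R_ModuleSpace) 0 (2 * PI)
   = (RtoC (-1) * CInt (fun t => F (- t)%R * expi (- n) t)%C 0 (2 * PI))%C).
{ rewrite <- CInt_scal.
  - apply CInt_ext; intros t; rewrite scal_R_Cmult; f_equal; unfold G.
    replace (-1 * t + 0) with (- t) by ring.
    f_equal; unfold expi; f_equal; rewrite opp_IZR; ring.
  - intros t; apply C_continuous_mult; [|apply expi_continuous].
    apply (continuous_comp (fun t => - t) F); [|apply cF].
    apply (continuous_opp (V := R_NormedModule)), continuous_id. }
assert (E3 : CInt G (-1 * 0 + 0) (-1 * (2 * PI) + 0) = (- CInt G (- (2 * PI)) 0)%C).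
{ replace (-1 * 0 + 0) with 0 by ring; replace (-1 * (2 * PI) + 0) with (- (2 * PI)) by ring.
  symmetry; apply (opp_RInt_swap (V := C_R_CompleteNormedModule)).
  eexists; now apply CInt_correct. }
assert (E4 : CInt G (- (2 * PI)) 0 = CInt G 0 (2 * PI)).
{ rewrite <- (CInt_periodic G (- (2 * PI))) by assumption; f_equal; ring. }
rewrite E1, E3, E4 in E2.
replace (CInt (fun t => F (- t)%R * expi (- n) t)%C 0 (2 * PI)) with
  (- (RtoC (-1) * CInt (fun t => F (- t)%R * expi (- n) t)%C 0 (2 * PI)))%C.
- rewrite <- E2; ring.
- replace (RtoC (-1)) with (- (1))%C; [ring|]; apply C_ext; simpl; ring.
Qed.

Lemma unit_circle_cis (z : C) : unit_circle z -> exists t, z = cis t.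
Proof.
unfold unit_circle; intros Hz; destruct (cis_polar z) as [t Ht].
exists t; rewrite Ht, Hz; ring.
Qed.

Lemma ps_cis_continuous (a : nat -> C) (t : R) : conv 1 a -> RC_continuous (fun t => ps a (cis t)) t.
Proof.
intros H; apply (continuous_ext (fun t => ps a (RtoC 1 * cis t))).
- intros s; now rewrite Cmult_1_l.
- apply (ps_circle_continuous 1 1); auto; lra.
Qed.

(** The Fourier coefficient of index [n > 0] sees [a n] alone and that of index [- n] sees [b n]
    alone. At index [0] both contribute, and [b 0 = 0] separates them. *)
Lemma laurent_unique (a b : nat -> C) : conv 1 a -> conv 1 b -> b 0%nat = RtoC 0 ->
  (forall t, (ps a (cis t) + ps b (cis (- t)))%C = RtoC 0) ->
  (forall n, a n = RtoC 0) /\ (forall n, b n = RtoC 0).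
Proof.
intros Ha Hb H0 H; pose proof two_PI_pos as HPI.
assert (ca : forall t, RC_continuous (fun t => ps a (cis t)) t)
  by (intros t; now apply ps_cis_continuous).
assert (cb : forall t, RC_continuous (fun t => ps b (cis t)) t)
  by (intros t; now apply ps_cis_continuous).
assert (cb' : forall t, RC_continuous (fun t => ps b (cis (- t))) t).
{ intros t; apply (continuous_comp (fun t => - t) (fun t => ps b (cis t))); [|apply cb].
  apply (continuous_opp (V := R_NormedModule)), continuous_id. }
assert (HS : forall n, (fc (fun t => ps a (cis t)) n + fc (fun t => ps b (cis t)) (- n) = 0)%C).
{ intros n; rewrite <- (fc_reflect (fun t => ps b (cis t))); [|exact cb|].
  - rewrite <- fc_plus by assumption.
    rewrite (fc_ext _ (fun _ => 0 * 1)%C) by (intros t; rewrite H; ring).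
    rewrite fc_scal by (intros; apply C_continuous_const); ring.
  - intros t; now rewrite cis_periodic. }
assert (Fa : forall c n, conv 1 c -> fc (fun t => ps c (cis t)) (Z.of_nat n) = (RtoC (2 * PI) * c n)%C).
{ intros c n Hc; rewrite (fc_ext _ (fun t => ps c (RtoC 1 * cis t)))
    by (intros; now rewrite Cmult_1_l).
  rewrite (fc_ps_nat 1), Cpow_1_l by (auto; lra); ring. }
assert (Fb : forall c n, conv 1 c -> (n < 0)%Z -> fc (fun t => ps c (cis t)) n = RtoC 0).
{ intros c n Hc Hn; rewrite (fc_ext _ (fun t => ps c (RtoC 1 * cis t)))
    by (intros; now rewrite Cmult_1_l).
  apply (fc_ps_neg 1); auto; lra. }
assert (N : forall x : C, (RtoC (2 * PI) * x = 0)%C -> x = RtoC 0).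
{ intros x Hx; assert (Nz : RtoC (2 * PI) <> RtoC 0) by (intros X; apply RtoC_inj in X; lra).
  replace x with (/ RtoC (2 * PI) * (RtoC (2 * PI) * x))%C by (field; exact Nz).
  rewrite Hx; ring. }
split; intros n; apply N.
- rewrite <- Fa, <- (HS (Z.of_nat n)) by assumption.
  destruct n as [|n].
  + change (- Z.of_nat 0)%Z with (Z.of_nat 0); rewrite (Fa b 0%nat), H0 by assumption; ring.
  + rewrite (Fb b (- Z.of_nat (S n))%Z) by (auto; lia); ring.
- destruct n as [|n]; [rewrite H0; ring|].
  rewrite <- Fa, <- (HS (- Z.of_nat (S n))%Z) by assumption.
  rewrite Z.opp_involutive, (Fb a) by (auto; lia); ring.
Qed.

Lemma RC_derive_n_family (F : R -> C) (Fs : nat -> R -> C) :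
  (forall t, F t = Fs 0%nat t) -> (forall l t, is_RC_derive (Fs l) t (Fs (S l) t)) ->
  forall l t, RC_derive_n F l t = Fs l t.
Proof.
intros H0 H; induction l as [|l IH]; intros t.
- symmetry; rewrite <- H0; apply C_ext; reflexivity.
- assert (D := proj1 (is_RC_derive_comp_iff _ _ _) (H l t)); destruct D as [D1 D2].
  apply C_ext; simpl.
  + rewrite (Derive_ext _ (fun s => Re (Fs l s))) by (intros s; now rewrite <- IH).
    now apply is_derive_unique.
  + rewrite (Derive_ext _ (fun s => Im (Fs l s))) by (intros s; now rewrite <- IH).
    now apply is_derive_unique.
Qed.

Lemma smooth_circle_family (f : C -> C) : mem smooth_circle f ->
  forall l t, is_RC_derive (RC_derive_n (fun s => f (cis s)) l) t
    (RC_derive_n (fun s => f (cis s)) (S l) t).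
Proof.
intros H l t; destruct (H l t) as [d Hd].
eapply is_RC_derive_eq; [exact Hd|].
apply is_RC_derive_comp_iff in Hd; destruct Hd as [D1 D2].
apply C_ext; simpl; symmetry; now apply is_derive_unique.
Qed.

Lemma smooth_circle_of_family (f : C -> C) (Fs : nat -> R -> C) :
  (forall t, f (cis t) = Fs 0%nat t) -> (forall l t, is_RC_derive (Fs l) t (Fs (S l) t)) ->
  mem smooth_circle f.
Proof.
intros H0 H l t; exists (Fs (S l) t).
apply (is_derive_ext (V := C_R_NormedModule) (Fs l)); [|apply H].
intros s; symmetry; now apply (RC_derive_n_family (fun s => f (cis s))).
Qed.

(** Both angles are written [sigma * t], the form to which [ps_circle_derive] applies. *)
Definition laurent_derive_n (a b : nat -> C) (l : nat) (t : R) : C :=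
  (ps (Tcoef_n 1 l a) (cis (1 * t)) + ps (Tcoef_n (-1) l b) (cis (-1 * t)))%C.

Lemma laurent_family (a b : nat -> C) (l : nat) (t : R) : conv 1 a -> conv 1 b ->
  is_RC_derive (laurent_derive_n a b l) t (laurent_derive_n a b (S l) t).
Proof.
intros Ha Hb.
assert (S1 : Rabs 1 <= 1) by (rewrite Rabs_R1; lra).
assert (S2 : Rabs (-1) <= 1) by (rewrite Rabs_left; lra).
apply is_RC_derive_plus; apply ps_circle_derive; auto; now apply conv_Tcoef_n.
Qed.

Lemma laurent_smooth (f : C -> C) (a b : nat -> C) : conv 1 a -> conv 1 b ->
  (forall t, f (cis t) = (ps a (cis t) + ps b (cis (- t)))%C) ->
  mem smooth_circle f /\
  forall l t, RC_derive_n (fun s => f (cis s)) l t = laurent_derive_n a b l t.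
Proof.
intros Ha Hb H.
assert (E : forall t, f (cis t) = laurent_derive_n a b 0 t).
{ intros t; rewrite H; unfold laurent_derive_n; simpl Tcoef_n.
  do 3 f_equal; ring. }
assert (F := fun l t => laurent_family a b l t Ha Hb); split.
- now apply (smooth_circle_of_family f (laurent_derive_n a b)).
- intros l t; now apply (RC_derive_n_family (fun s => f (cis s))).
Qed.

Lemma laurent_derive_n_bound (a b : nat -> C) (l : nat) (M M' : R) (t : R) :
  bnd (l + 2) 1 M a -> bnd (l + 2) 1 M' b -> Cmod (laurent_derive_n a b l t) <= 2 * M + 2 * M'.
Proof.
intros Ha Hb.
assert (S1 : Rabs 1 <= 1) by (rewrite Rabs_R1; lra).
assert (S2 : Rabs (-1) <= 1) by (rewrite Rabs_left; lra).
eapply Rle_trans; [apply Cmod_triangle|].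
apply Rplus_le_compat; apply (Cmod_ps_le 1); try lra; try (rewrite Cmod_cis; lra);
  now apply bnd_Tcoef_n.
Qed.

(** * The two projections of a smooth function *)

Definition plus_coef (f : C -> C) (n : nat) : C :=
  (RtoC (/ (2 * PI)) * fc (fun t => f (cis t)) (Z.of_nat n))%C.

(** The constant term of the Fourier series goes to [plus_coef]; the value [0] at index [0] makes
    the other part vanish at infinity. *)
Definition minus_coef (f : C -> C) (n : nat) : C :=
  match n with
  | O => RtoC 0
  | S _ => (RtoC (/ (2 * PI)) * fc (fun t => f (cis t)) (- Z.of_nat n))%C
  end.

Definition proj_plus (f : C -> C) : C -> C := ps (plus_coef f).
Definition proj_minus (f : C -> C) (z : C) : C := ps (minus_coef f) (/ z).

Section Smooth.

Variable f : C -> C.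
Hypothesis Hf : mem smooth_circle f.

Let F (l : nat) : R -> C := RC_derive_n (fun s => f (cis s)) l.

Lemma smooth_continuous (l : nat) (t : R) : RC_continuous (F l) t.
Proof. eapply is_RC_derive_continuous, smooth_circle_family, Hf. Qed.

Lemma smooth_0 (t : R) : F 0 t = f (cis t).
Proof. apply C_ext; reflexivity. Qed.

Lemma smooth_cis_continuous (t : R) : RC_continuous (fun t => f (cis t)) t.
Proof. apply (continuous_ext (F 0)); [apply smooth_0 | apply smooth_continuous]. Qed.

(** The translated family satisfies the same derivative relations and starts from the same function,
    so it is the family of derivatives itself. *)
Lemma smooth_periodic (l : nat) (t : R) : F l (t + 2 * PI) = F l t.
Proof.
symmetry; apply (RC_derive_n_family (fun s => f (cis s)) (fun l t => F l (t + 2 * PI))).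
- intros s; now rewrite smooth_0, cis_periodic.
- intros m s; eapply is_RC_derive_eq.
  + apply (is_derive_comp (V := C_R_NormedModule) (F m) (fun s => s + 2 * PI)).
    * apply smooth_circle_family, Hf.
    * auto_derive; [exact I | reflexivity].
  + apply (scal_one (RC_derive_n (fun s => f (cis s)) (S m) (s + 2 * PI) : C_R_ModuleSpace)).
Qed.

Lemma fc_smooth (k : nat) (n : Z) :
  fc (F k) n = ((Ci * RtoC (IZR n)) ^ k * fc (fun t => f (cis t)) n)%C.
Proof.
induction k as [|k IH].
- simpl; rewrite Cmult_1_l; apply fc_ext, smooth_0.
- rewrite (fc_derive (F k)), IH, Cpow_S; [ring | | |].
  + apply smooth_circle_family, Hf.
  + apply smooth_continuous.
  + apply smooth_periodic.
Qed.

(** For [n <> 0] the [k]-th derivative bounds [|n|^k] times the coefficient, and [|n| + 1 <= 2 |n|]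
    costs [2 ^ k]. At [n = 0] the derivative says nothing for [k > 0]; there the bound on the
    function itself is used. *)
Lemma fourier_decay (k : nat) (M : R) (n : Z) :
  (forall t, 0 <= t <= 2 * PI -> Cmod (F 0 t) <= M) ->
  (forall t, 0 <= t <= 2 * PI -> Cmod (F k t) <= M) ->
  Cmod (RtoC (/ (2 * PI)) * fc (fun t => f (cis t)) n) * (IZR (Z.abs n) + 1) ^ k
    <= 2 ^ k * M.
Proof.
intros H0 Hk; pose proof two_PI_pos as HPI.
set (x := Cmod (RtoC (/ (2 * PI)) * fc (fun t => f (cis t)) n)).
assert (Px : 0 <= x) by apply Cmod_ge_0.
assert (P2 : 0 <= 2 ^ k) by (apply pow_le; lra).
assert (Ex : x = / (2 * PI) * Cmod (fc (fun t => f (cis t)) n)).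
{ unfold x; rewrite Cmod_mult, Cmod_R, Rabs_pos_eq; [reflexivity|].
  apply Rlt_le, Rinv_0_lt_compat, HPI. }
assert (B : forall j, (forall t, 0 <= t <= 2 * PI -> Cmod (F j t) <= M) ->
  x * IZR (Z.abs n) ^ j <= M).
{ intros j Hj; assert (C1 := Cmod_fc_le (F j) n M (smooth_continuous j) Hj).
  rewrite fc_smooth, Cmod_mult, Cmod_pow, Cmod_mult, Cmod_Ci, Cmod_R, Rmult_1_l, <- abs_IZR in C1.
  apply (Rmult_le_reg_l (2 * PI)); [assumption|].
  eapply Rle_trans; [|exact C1]; rewrite Ex; right; field; lra. }
destruct (Z.eq_dec n 0) as [->|Hn].
- specialize (B 0%nat H0); simpl in *; rewrite Rplus_0_l, pow1.
  assert (1 <= 2 ^ k) by (apply pow_R1_Rle; lra); nra.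
- specialize (B k Hk).
  assert (1 <= IZR (Z.abs n)) by (apply IZR_le; lia).
  apply Rle_trans with (x * (2 ^ k * IZR (Z.abs n) ^ k)).
  + apply Rmult_le_compat_l; [assumption|].
    rewrite <- Rpow_mult_distr; apply pow_incr; lra.
  + replace (x * (2 ^ k * IZR (Z.abs n) ^ k)) with (2 ^ k * (x * IZR (Z.abs n) ^ k)) by ring.
    now apply Rmult_le_compat_l.
Qed.

Lemma bnd_plus_coef (k : nat) (M : R) :
  (forall t, 0 <= t <= 2 * PI -> Cmod (F 0 t) <= M) ->
  (forall t, 0 <= t <= 2 * PI -> Cmod (F k t) <= M) ->
  bnd k 1 (2 ^ k * M) (plus_coef f).
Proof.
intros H0 Hk n; rewrite pow1, Rmult_1_r, INR_IZR_INZ.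
rewrite <- (Z.abs_eq (Z.of_nat n)) by lia; now apply fourier_decay.
Qed.

Lemma bnd_minus_coef (k : nat) (M : R) :
  (forall t, 0 <= t <= 2 * PI -> Cmod (F 0 t) <= M) ->
  (forall t, 0 <= t <= 2 * PI -> Cmod (F k t) <= M) ->
  bnd k 1 (2 ^ k * M) (minus_coef f).
Proof.
intros H0 Hk [|n]; rewrite pow1, Rmult_1_r, INR_IZR_INZ.
- simpl; rewrite Cmod_0, Rmult_0_l; apply Rmult_le_pos; [apply pow_le; lra|].
  eapply Rle_trans; [apply Cmod_ge_0 | apply (H0 0)]; pose proof two_PI_pos; lra.
- replace (Z.of_nat (S n)) with (Z.abs (- Z.of_nat (S n))) by lia; now apply fourier_decay.
Qed.

Lemma smooth_bounded (k : nat) : exists M,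
  (forall t, 0 <= t <= 2 * PI -> Cmod (F 0 t) <= M) /\
  (forall t, 0 <= t <= 2 * PI -> Cmod (F k t) <= M).
Proof.
pose proof two_PI_pos as HPI.
destruct (RC_continuous_bounded (F 0) 0 (2 * PI) ltac:(lra) (smooth_continuous 0)) as [M H].
destruct (RC_continuous_bounded (F k) 0 (2 * PI) ltac:(lra) (smooth_continuous k)) as [M' H'].
exists (Rmax M M'); split; intros t Ht.
- eapply Rle_trans; [now apply H | apply Rmax_l].
- eapply Rle_trans; [now apply H' | apply Rmax_r].
Qed.

Lemma conv_plus_coef : conv 1 (plus_coef f).
Proof.
intros k; destruct (smooth_bounded k) as [M [H0 Hk]].
exists (2 ^ k * M); now apply bnd_plus_coef.
Qed.

Lemma conv_minus_coef : conv 1 (minus_coef f).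
Proof.
intros k; destruct (smooth_bounded k) as [M [H0 Hk]].
exists (2 ^ k * M); now apply bnd_minus_coef.
Qed.

Lemma laurent_expansion (t : R) :
  f (cis t) = (ps (plus_coef f) (cis t) + ps (minus_coef f) (cis (- t)))%C.
Proof.
pose proof two_PI_pos as HPI.
assert (Nz : RtoC (2 * PI) <> RtoC 0) by (intros X; apply RtoC_inj in X; lra).
destruct (conv_plus_coef 2%nat) as [M HM]; destruct (conv_minus_coef 2%nat) as [M' HM'].
assert (S1 := ps_correct 1 M _ (cis t) ltac:(lra) HM ltac:(rewrite Cmod_cis; lra)).
assert (S2 := ps_correct 1 M' _ (cis (- t)) ltac:(lra) HM' ltac:(rewrite Cmod_cis; lra)).
assert (HS := is_Cseries_lin 1 _ _ _ _ S1 S2).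
rewrite Cmult_1_l in HS; symmetry; apply (is_Cseries_unique _ _ _ HS).
intros eps.
assert (He : 0 < 2 * PI * eps) by (apply Rmult_lt_0_compat; [assumption | apply cond_pos]).
destruct (fourier_inversion f t (F 1 t) (mkposreal _ He)) as [N0 HN].
{ apply smooth_cis_continuous. }
{ apply (is_derive_ext (V := C_R_NormedModule) (F 0)); [apply smooth_0|].
  apply smooth_circle_family, Hf. }
exists N0; intros N HNN; specialize (HN N HNN); simpl in HN.
match goal with |- Cmod (Csum ?u N - _) <= _ => set (u0 := u) in * end.
(* The [n]-th terms of the two power series together form the symmetric Fourier term, up to the
   normalisation; the [+ 0] fits the shape of [Csum_lin]. *)
assert (T : forall n, fourier_term (fun t => f (cis t)) t n = (RtoC (2 * PI) * u0 n + 0)%C).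
{ assert (Q : (RtoC (2 * PI) * RtoC (/ (2 * PI)) = 1)%C)
    by (rewrite <- RtoC_mult, Rinv_r by lra; reflexivity).
  intros [|n]; unfold u0, fourier_term, plus_coef, minus_coef.
  - simpl Z.of_nat.
    transitivity ((RtoC (2 * PI) * RtoC (/ (2 * PI))) * fc (fun t => f (cis t)) 0)%C;
      [rewrite Q; ring | simpl; ring].
  - rewrite !expi_of_nat, expi_opp, expi_of_nat, cis_neg, Cpow_inv by apply cis_neq_0.
    set (x := fc _ (Z.of_nat (S n))); set (y := fc _ (- Z.of_nat (S n))).
    set (v := (cis t ^ S n)%C).
    transitivity ((RtoC (2 * PI) * RtoC (/ (2 * PI))) * (x * v + y * / v))%C;
      [rewrite Q; ring | ring]. }
rewrite (Csum_ext _ _ N T), Csum_lin in HN.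
rewrite Csum_zero in HN.
replace (RtoC (2 * PI) * Csum u0 N + 0 - RtoC (2 * PI) * f (cis t))%C with
  (RtoC (2 * PI) * (Csum u0 N - f (cis t)))%C in HN by ring.
rewrite Cmod_mult, Cmod_R, Rabs_pos_eq in HN by lra.
apply (Rmult_le_reg_l (2 * PI)); lra.
Qed.

End Smooth.

Lemma ext_proj_plus (f : C -> C) (z : C) : mem smooth_circle f -> closed_disc z ->
  ext unit_disc (proj_plus f) z = ps (plus_coef f) z.
Proof.
intros Hf Hz; apply (ext_disc_derive_n _ _ 0); [now apply conv_plus_coef | | exact Hz].
intros w _; reflexivity.
Qed.

Lemma ext_proj_minus (f : C -> C) (z : C) : mem smooth_circle f -> closed_exterior z ->
  ext exterior (proj_minus f) z = ps (minus_coef f) (/ z).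
Proof.
intros Hf Hz; apply (ext_exterior_derive_n _ _ 0); [now apply conv_minus_coef | | exact Hz].
intros w _; reflexivity.
Qed.

Lemma proj_decomposes (f : C -> C) : mem smooth_circle f ->
  decomposes smooth_circle (ext unit_disc) (ext exterior) f (proj_plus f) (proj_minus f).
Proof.
intros Hf z Hz; simpl in Hz.
rewrite ext_proj_plus, ext_proj_minus; try assumption;
  try (unfold closed_disc, closed_exterior, unit_circle in *; lra).
destruct (unit_circle_cis z Hz) as [t ->]; rewrite <- cis_neg.
now apply laurent_expansion.
Qed.

Lemma proj_plus_mem (f : C -> C) : mem smooth_circle f -> mem A_infty (proj_plus f).
Proof.
intros Hf; apply (A_infty_of_coef _ (plus_coef f)); [now apply conv_plus_coef|].
intros z _; reflexivity.
Qed.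

Lemma proj_minus_mem (f : C -> C) : mem smooth_circle f -> mem A0_infty (proj_minus f).
Proof.
intros Hf; apply (A0_infty_of_coef _ (minus_coef f)); [now apply conv_minus_coef | reflexivity |].
intros z _; reflexivity.
Qed.

Lemma smooth_circle_minus (f g : C -> C) : mem smooth_circle f -> mem smooth_circle g ->
  mem smooth_circle (fun z => g z - f z)%C.
Proof.
intros Hf Hg; apply (smooth_circle_of_family _ (fun l t =>
  (RC_derive_n (fun s => g (cis s)) l t + RtoC (-1) * RC_derive_n (fun s => f (cis s)) l t)%C)).
- intros t; apply C_ext; simpl; unfold Re, Im; ring.
- intros l t; apply is_RC_derive_plus; [|apply is_RC_derive_scal]; now apply smooth_circle_family.
Qed.

Lemma fc_cis_minus (f g : C -> C) (n : Z) : mem smooth_circle f -> mem smooth_circle g ->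
  fc (fun t => g (cis t) - f (cis t))%C n =
  (fc (fun t => g (cis t)) n - fc (fun t => f (cis t)) n)%C.
Proof. intros Hf Hg; apply fc_minus; intros; now apply smooth_cis_continuous. Qed.

Lemma smooth_norm_bound (f : C -> C) (M : R) (l : nat) (t : R) :
  Rbar_lt (snorm smooth_circle l f) M -> Cmod (RC_derive_n (fun s => f (cis s)) l t) <= M.
Proof. intros H; apply (le_of_Lub_Rbar_lt _ _ _ H); now exists t. Qed.

Lemma proj_plus_continuous : continuous_map smooth_circle A_infty proj_plus.
Proof.
apply continuous_map_of_bound; [apply proj_plus_mem|].
(* [l] orders of decay pay for the derivatives and two for the summation; the index [0] is there for
   the constant coefficient. [2 ^ (l + 2)] comes from [fourier_decay], and the factor [2] is the sum
   of [tele]. *)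
intros l; exists (0 :: (l + 2) :: nil)%nat, (2 * 2 ^ (l + 2)); split.
{ apply Rmult_le_pos; [lra | apply pow_le; lra]. }
intros f g M Hf Hg H.
assert (Hd := smooth_circle_minus f g Hf Hg).
assert (B : bnd (l + 2) 1 (2 ^ (l + 2) * M) (plus_coef (fun z => g z - f z)%C)).
{ apply bnd_plus_coef; [exact Hd | |]; intros t _;
    apply (smooth_norm_bound (fun z => g z - f z)%C), H; simpl; auto. }
(* Linearity: on the disc the difference of the projections is the projection of the difference, so
   the decay estimate is applied to [g - f]. *)
assert (E : agree_on unit_disc (fun z => proj_plus g z - proj_plus f z)%C
  (ps (plus_coef (fun z => g z - f z)%C))).
{ intros z Hz; unfold proj_plus, unit_disc in *.
  rewrite (ps_ext (plus_coef (fun z => g z - f z)%C)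
    (fun n => - (1) * plus_coef f n + plus_coef g n)%C).
  - rewrite (ps_lin 1); try lra; try now apply conv_plus_coef. ring.
  - intros n; unfold plus_coef; rewrite fc_cis_minus by assumption; ring. }
apply Lub_Rbar_le; intros x [z [Hz ->]].
rewrite (ext_disc_derive_n _ _ l z (conv_plus_coef _ Hd) E Hz), Rmult_assoc.
apply (Cmod_ps_le 1); [lra | now apply bnd_Dcoef_n | exact Hz].
Qed.

Lemma proj_minus_continuous : continuous_map smooth_circle A0_infty proj_minus.
Proof.
apply continuous_map_of_bound; [apply proj_minus_mem|].
intros l; destruct (bnd_Ecoef_n l 2) as [c [Hc HE]].
exists (0 :: (l + 2) :: nil)%nat, (2 * (c * 2 ^ (l + 2))); split.
{ repeat apply Rmult_le_pos; try lra; apply pow_le; lra. }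
intros f g M Hf Hg H.
assert (Hd := smooth_circle_minus f g Hf Hg).
assert (B : bnd (l + 2) 1 (2 ^ (l + 2) * M) (minus_coef (fun z => g z - f z)%C)).
{ apply bnd_minus_coef; [exact Hd | |]; intros t _;
    apply (smooth_norm_bound (fun z => g z - f z)%C), H; simpl; auto. }
assert (E : agree_on exterior (fun z => proj_minus g z - proj_minus f z)%C
  (fun z => ps (minus_coef (fun z => g z - f z)%C) (/ z))).
{ intros z Hz; unfold proj_minus.
  assert (Hi := Cmod_inv_lt_1 z Hz).
  rewrite (ps_ext (minus_coef (fun z => g z - f z)%C)
    (fun n => - (1) * minus_coef f n + minus_coef g n)%C).
  - rewrite (ps_lin 1); try lra; try now apply conv_minus_coef. ring.
  - intros [|n]; unfold minus_coef; [ring | rewrite fc_cis_minus by assumption; ring]. }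
apply Lub_Rbar_le; intros x [z [Hz ->]].
rewrite (ext_exterior_derive_n _ _ l z (conv_minus_coef _ Hd) E Hz), !Rmult_assoc.
apply (Cmod_ps_le 1); [lra | now apply HE | now apply Cmod_inv_le_1].
Qed.

(** * Restriction to the circle *)

Lemma ext_A_infty_cis (g : C -> C) (a : nat -> C) (t : R) :
  conv 1 a -> agree_on unit_disc g (ps a) -> ext unit_disc g (cis t) = ps a (cis t).
Proof.
intros Ha Hg; apply (ext_disc_derive_n g a 0 (cis t) Ha Hg).
unfold closed_disc; rewrite Cmod_cis; lra.
Qed.

Lemma ext_A0_infty_cis (h : C -> C) (b : nat -> C) (t : R) :
  conv 1 b -> agree_on exterior h (fun z => ps b (/ z)) ->
  ext exterior h (cis t) = ps b (cis (- t)).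
Proof.
intros Hb Hh; rewrite cis_neg; apply (ext_exterior_derive_n h b 0 (cis t) Hb Hh).
unfold closed_exterior; rewrite Cmod_cis; lra.
Qed.

Lemma conv_0 : conv 1 (fun _ => RtoC 0).
Proof. intros k; exists 0; intros n; rewrite Cmod_0; lra. Qed.

Lemma ext_disc_smooth (g : C -> C) : mem A_infty g -> mem smooth_circle (ext unit_disc g).
Proof.
intros Hg; destruct (coef_of_A_infty g Hg) as [a [Ha E]].
apply (laurent_smooth _ a (fun _ => RtoC 0) Ha conv_0).
intros t; rewrite ps_zero_coef, Cplus_0_r; now apply ext_A_infty_cis.
Qed.

Lemma ext_exterior_smooth (h : C -> C) : mem A0_infty h -> mem smooth_circle (ext exterior h).
Proof.
intros Hh; destruct (coef_of_A0_infty h Hh) as [b [Hb [_ E]]].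
apply (laurent_smooth _ (fun _ => RtoC 0) b conv_0 Hb).
intros t; rewrite ps_zero_coef, Cplus_0_l; now apply ext_A0_infty_cis.
Qed.

Lemma ext_disc_continuous : continuous_map A_infty smooth_circle (ext unit_disc).
Proof.
apply continuous_map_of_bound; [apply ext_disc_smooth|].
intros l; destruct (rapid_of_Dcoef_n (l + 2)) as [c [Hc HD]].
(* Decay of order [l + 2] is recovered from the derivatives of every order from [0] to [l + 2], all
   of which the list contains. *)
exists (seq 0 (S (l + 2))), (2 * c); split; [lra|].
intros f g M Hf Hg H.
destruct (coef_of_A_infty f Hf) as [a [Ha Ea]]; destruct (coef_of_A_infty g Hg) as [b [Hb Eb]].
set (d := fun n => (- (1) * a n + b n)%C).
assert (Hd : conv 1 d) by (apply conv_lin; auto; lra).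
assert (Ed : agree_on unit_disc (fun z => g z - f z)%C (ps d)).
{ intros z Hz; transitivity (- (1) * f z + g z)%C; [ring|].
  now apply (agree_on_disc_lin f g a b (- (1))%C Ha Hb Ea Eb). }
assert (B : bnd (l + 2) 1 (c * M) d).
{ apply HD; intros j n Hj; revert n; apply coef_bound.
  - now apply conv_disc_of_conv, conv_Dcoef_n.
  - intros z Hz; assert (Cz : closed_disc z) by (unfold closed_disc; lra).
    rewrite <- (ext_disc_derive_n _ _ j z Hd Ed Cz).
    refine (le_of_Lub_Rbar_lt _ _ _ (H j _) _); [apply in_seq; lia | now exists z]. }
apply Lub_Rbar_le; intros x [t ->].
destruct (laurent_smooth (fun z => ext unit_disc g z - ext unit_disc f z)%C d (fun _ => RtoC 0) Hd conv_0)
  as [_ L].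
{ intros s; rewrite (ext_A_infty_cis g b s Hb Eb), (ext_A_infty_cis f a s Ha Ea), ps_zero_coef.
  unfold d; rewrite (ps_lin 1); auto; try lra; [ring | rewrite Cmod_cis; lra]. }
rewrite L.
assert (B0 : bnd (l + 2) 1 0 (fun _ => RtoC 0)) by (intros n; rewrite Cmod_0; lra).
eapply Rle_trans; [apply (laurent_derive_n_bound _ _ _ _ _ _ B B0) | lra].
Qed.

Lemma ext_exterior_continuous : continuous_map A0_infty smooth_circle (ext exterior).
Proof.
apply continuous_map_of_bound; [apply ext_exterior_smooth|].
intros l; destruct (rapid_of_Ecoef_n (l + 2)) as [c [Hc HD]].
exists (seq 0 (S (l + 2))), (2 * c); split; [lra|].
intros f g M Hf Hg H.
destruct (coef_of_A0_infty f Hf) as [a [Ha [Za Ea]]].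
destruct (coef_of_A0_infty g Hg) as [b [Hb [Zb Eb]]].
set (d := fun n => (- (1) * a n + b n)%C).
assert (Hd : conv 1 d) by (apply conv_lin; auto; lra).
assert (Ed : agree_on exterior (fun z => g z - f z)%C (fun z => ps d (/ z))).
{ intros z Hz; transitivity (- (1) * f z + g z)%C; [ring|].
  now apply (agree_on_exterior_lin f g a b (- (1))%C Ha Hb Ea Eb). }
assert (B : bnd (l + 2) 1 (c * M) d).
{ apply HD; [unfold d; rewrite Za, Zb; ring|].
  intros j n Hj; revert n; apply coef_bound.
  - now apply conv_disc_of_conv, conv_Ecoef_n.
  - intros u Hu; assert (Nu : u <> RtoC 0) by (apply Cmod_gt_0; lra).
    assert (Cz : closed_exterior (/ u)).
    { unfold closed_exterior; rewrite Cmod_inv, <- Rinv_1 by assumption.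
      apply Rinv_le_contravar; lra. }
    assert (X := ext_exterior_derive_n _ _ j (/ u)%C Hd Ed Cz).
    replace (/ / u)%C with u in X by (field; exact Nu).
    rewrite <- X.
    refine (le_of_Lub_Rbar_lt _ _ _ (H j _) _); [apply in_seq; lia | now exists (/ u)%C]. }
apply Lub_Rbar_le; intros x [t ->].
destruct (laurent_smooth (fun z => ext exterior g z - ext exterior f z)%C (fun _ => RtoC 0) d conv_0 Hd)
  as [_ L].
{ intros s; rewrite (ext_A0_infty_cis g b s Hb Eb), (ext_A0_infty_cis f a s Ha Ea), ps_zero_coef.
  unfold d; rewrite (ps_lin 1); auto; try lra; [ring | rewrite Cmod_cis; lra]. }
rewrite L.
assert (B0 : bnd (l + 2) 1 0 (fun _ => RtoC 0)) by (intros n; rewrite Cmod_0; lra).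
eapply Rle_trans; [apply (laurent_derive_n_bound _ _ _ _ _ _ B0 B) | lra].
Qed.

(** * Uniqueness, linearity and the direct sum *)

Lemma decomposition_unique (g h g' h' : C -> C) :
  mem A_infty g -> mem A0_infty h -> mem A_infty g' -> mem A0_infty h' ->
  (forall z, unit_circle z ->
     (ext unit_disc g z + ext exterior h z = ext unit_disc g' z + ext exterior h' z)%C) ->
  (forall z, unit_disc z -> g' z = g z) /\ (forall z, exterior z -> h' z = h z).
Proof.
intros Hg Hh Hg' Hh' H.
destruct (coef_of_A_infty g Hg) as [a [Ha Ea]].
destruct (coef_of_A0_infty h Hh) as [b [Hb [Zb Eb]]].
destruct (coef_of_A_infty g' Hg') as [a' [Ha' Ea']].
destruct (coef_of_A0_infty h' Hh') as [b' [Hb' [Zb' Eb']]].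
destruct (laurent_unique (fun n => - (1) * a n + a' n)%C (fun n => - (1) * b n + b' n)%C) as [U1 U2].
- apply conv_lin; auto; lra.
- apply conv_lin; auto; lra.
- rewrite Zb, Zb'; ring.
- intros t; specialize (H (cis t) (Cmod_cis t)).
  rewrite (ext_A_infty_cis g a), (ext_A_infty_cis g' a'), (ext_A0_infty_cis h b),
    (ext_A0_infty_cis h' b') in H by assumption.
  rewrite !(ps_lin 1); auto; try lra; try (rewrite Cmod_cis; lra).
  transitivity ((ps a' (cis t) + ps b' (cis (- t))) - (ps a (cis t) + ps b (cis (- t))))%C; [ring|].
  rewrite H; ring.
- split.
  + intros z Hz; rewrite Ea, Ea' by assumption; apply ps_ext; intros n.
    apply Ceq_minus; rewrite <- (U1 n); ring.
  + intros z Hz; rewrite Eb, Eb' by assumption; apply ps_ext; intros n.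
    apply Ceq_minus; rewrite <- (U2 n); ring.
Qed.

Lemma A_infty_lin (k : C) (g g' : C -> C) : mem A_infty g -> mem A_infty g' ->
  mem A_infty (fun z => k * g z + g' z)%C /\
  forall z, unit_circle z ->
    ext unit_disc (fun z => k * g z + g' z)%C z = (k * ext unit_disc g z + ext unit_disc g' z)%C.
Proof.
intros Hg Hg'; destruct (coef_of_A_infty g Hg) as [a [Ha Ea]].
destruct (coef_of_A_infty g' Hg') as [a' [Ha' Ea']].
assert (HL : conv 1 (fun n => k * a n + a' n)%C) by (apply conv_lin; auto; lra).
assert (EL := agree_on_disc_lin g g' a a' k Ha Ha' Ea Ea').
split; [now apply (A_infty_of_coef _ (fun n => k * a n + a' n)%C)|].
intros z Hz; destruct (unit_circle_cis z Hz) as [t ->].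
rewrite (ext_A_infty_cis _ _ t HL EL), (ext_A_infty_cis g a), (ext_A_infty_cis g' a') by assumption.
apply (ps_lin 1); auto; try lra; rewrite Cmod_cis; lra.
Qed.

Lemma A0_infty_lin (k : C) (h h' : C -> C) : mem A0_infty h -> mem A0_infty h' ->
  mem A0_infty (fun z => k * h z + h' z)%C /\
  forall z, unit_circle z ->
    ext exterior (fun z => k * h z + h' z)%C z = (k * ext exterior h z + ext exterior h' z)%C.
Proof.
intros Hh Hh'; destruct (coef_of_A0_infty h Hh) as [b [Hb [Zb Eb]]].
destruct (coef_of_A0_infty h' Hh') as [b' [Hb' [Zb' Eb']]].
assert (HL : conv 1 (fun n => k * b n + b' n)%C) by (apply conv_lin; auto; lra).
assert (EL := agree_on_exterior_lin h h' b b' k Hb Hb' Eb Eb').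
split.
{ apply (A0_infty_of_coef _ (fun n => k * b n + b' n)%C); auto; rewrite Zb, Zb'; ring. }
intros z Hz; destruct (unit_circle_cis z Hz) as [t ->].
rewrite (ext_A0_infty_cis _ _ t HL EL), (ext_A0_infty_cis h b), (ext_A0_infty_cis h' b') by assumption.
apply (ps_lin 1); auto; try lra; rewrite Cmod_cis; lra.
Qed.

Lemma A_infty_0 : mem A_infty (fun _ => RtoC 0).
Proof.
apply (A_infty_of_coef _ (fun _ => RtoC 0) conv_0); intros z _; symmetry; apply ps_zero_coef.
Qed.

Lemma A0_infty_0 : mem A0_infty (fun _ => RtoC 0).
Proof.
apply (A0_infty_of_coef _ (fun _ => RtoC 0) conv_0); [reflexivity|].
intros z _; symmetry; apply ps_zero_coef.
Qed.

Theorem theorem6 :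
  (forall f : C -> C, mem smooth_circle f ->
     (exists g h : C -> C, mem A_infty g /\ mem A0_infty h /\
        forall z : C, unit_circle z -> f z = (ext unit_disc g z + ext exterior h z)%C) /\
     (forall g h g' h' : C -> C,
        mem A_infty g -> mem A0_infty h ->
        mem A_infty g' -> mem A0_infty h' ->
        (forall z : C, unit_circle z -> f z = (ext unit_disc g z + ext exterior h z)%C) ->
        (forall z : C, unit_circle z -> f z = (ext unit_disc g' z + ext exterior h' z)%C) ->
        (forall z : C, unit_disc z -> g' z = g z) /\
        (forall z : C, exterior z -> h' z = h z)))
  /\
  topological_direct_sum smooth_circle A_infty A0_infty (ext unit_disc) (ext exterior).
Proof.
split.
- intros f Hf; split.
  + exists (proj_plus f), (proj_minus f); split; [|split].
    * now apply proj_plus_mem.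
    * now apply proj_minus_mem.
    * now apply proj_decomposes.
  + intros g h g' h' Hg Hh Hg' Hh' E E'; apply decomposition_unique; auto.
    intros z Hz; rewrite <- E by exact Hz; now apply E'.
- split.
  + split.
    * apply A_infty_0.
    * intros k a a' Ha Ha'; now apply A_infty_lin.
    * intros k a a' Ha Ha' z Hz; now apply A_infty_lin.
    * intros a a' Ha Ha' E z Hz.
      (* Injectivity of the restriction is uniqueness of the decomposition with zero exterior
         part. *)
      destruct (decomposition_unique a (fun _ => RtoC 0) a' (fun _ => RtoC 0)) as [U _];
        auto using A0_infty_0.
      -- intros w Hw; now rewrite (E w Hw).
      -- symmetry; now apply U.
    * apply ext_disc_continuous.
  + split.
    * apply A0_infty_0.
    * intros k a a' Ha Ha'; now apply A0_infty_lin.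
    * intros k a a' Ha Ha' z Hz; now apply A0_infty_lin.
    * intros a a' Ha Ha' E z Hz.
      destruct (decomposition_unique (fun _ => RtoC 0) a (fun _ => RtoC 0) a') as [_ U];
        auto using A_infty_0.
      -- intros w Hw; now rewrite (E w Hw).
      -- symmetry; now apply U.
    * apply ext_exterior_continuous.
  + intros f; split.
    * intros Hf; exists (proj_plus f), (proj_minus f); split; [|split].
      -- now apply proj_plus_mem.
      -- now apply proj_minus_mem.
      -- now apply proj_decomposes.
    (* [f] is known only on the circle, and smoothness there depends only on [f (cis t)], which is a
       Laurent series with rapidly decreasing coefficients. *)
    * intros [g [h [Hg [Hh E]]]].
      destruct (coef_of_A_infty g Hg) as [a [Ha Ea]].
      destruct (coef_of_A0_infty h Hh) as [b [Hb [_ Eb]]].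
      apply (laurent_smooth f a b Ha Hb); intros t.
      rewrite (E (cis t) (Cmod_cis t)), (ext_A_infty_cis g a t Ha Ea).
      now rewrite (ext_A0_infty_cis h b t Hb Eb).
  + intros g h Hg Hh E z Hz.
    destruct (coef_of_A_infty g Hg) as [a [Ha Ea]].
    destruct (coef_of_A0_infty h Hh) as [b [Hb [Zb Eb]]].
    (* Equality of the two boundary values is the vanishing of the Laurent series with coefficients
       [a] and [- b]; the [+ 0] gives the form of [conv_lin] and [ps_lin]. *)
    destruct (laurent_unique a (fun n => - (1) * b n + 0)%C) as [U _]; auto.
    * apply (conv_lin 1 (- (1)) b (fun _ => RtoC 0)); auto using conv_0; lra.
    * rewrite Zb; ring.
    * intros t; specialize (E (cis t) (Cmod_cis t)).
      rewrite (ext_A_infty_cis g a t Ha Ea), (ext_A0_infty_cis h b t Hb Eb) in E.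
      rewrite (ps_lin 1 (- (1)) b (fun _ => RtoC 0)), ps_zero_coef, E; auto using conv_0;
        [ring | lra | rewrite Cmod_cis; lra].
    * destruct (unit_circle_cis z Hz) as [t ->].
      rewrite (ext_A_infty_cis g a t Ha Ea), (ps_ext a (fun _ => RtoC 0)); [apply ps_zero_coef | exact U].
  + exists proj_plus, proj_minus; split; [|split].
    * intros f Hf; now apply proj_decomposes.
    * apply proj_plus_continuous.
    * apply proj_minus_continuous.
Qed.
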